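(* Let $\mathcal{A}$ be a real fibered affine line arrangement with horizontal lines $\ell_1,\dots,\ell_n$, and assume that all parameters of horizontal lines are different from $1$. Let $p\in\pi(\mathcal{S})$, let $x\in\mathbb{R}$ be very close to $p$, $x\neq p$, let $x'$ be the point symmetric to $x$ with respect to $p$, and let $\mu_x=\tau(x',x)\circ\tau(x,x')$ be the local monodromy around $p$, an automorphism of $H_1(F_x;\mathcal{L}_x)$. Let $\Delta_1,\dots,\Delta_h$ be the partition of $\{1,\dots,n\}$ into blocks of consecutive integers, each block consisting of the indices (in the $x$-ordering) of the horizontal lines through one singular point of $\mathcal{A}$ on $\mathbb{C}_p$. Let $s_k$ be the parameter of the $k$-th line in the $x$-ordering. Then for $i=1,\dots,n-1$: (1) if $i,i+1$ belong to the same block $\Delta$, then $$\mu_x(\alpha^{(x)}_{i,i+1})=\Big(\prod_{j\in\Delta}s_j\Big)\alpha^{(x)}_{i,i+1};$$ (2) if $i$ is the last element of the block $\{a,a+1,\dots,i\}$ and $i+1$ is the first element of the next block $\{i+1,i+2,\dots,b\}$, then $$\mu_x(\alpha^{(x)}_{i,i+1})=\alpha^{(x)}_{i,i+1}+\sum_{k=a}^{i-1}(1-s_a\cdots s_k)\,\alpha^{(x)}_{k,k+1}+\sum_{k=i+2}^{b}s_{i+1}\cdots s_{k-1}(1-s_k\cdots s_b)\,\alpha^{(x)}_{k-1,k}.$$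
   Context: $\mathcal{A}=\{\ell_1,\dots,\ell_n,\ell'_1,\dots,\ell'_m\}$ is a finite arrangement of affine lines in $\mathbb{C}^2$ (coordinates $x,y$), defined over $\mathbb{R}$, with complement $\mathcal{M}(\mathcal{A})$; $\pi(x,y)=x$; $\mathcal{S}$ is the set of singular points (points lying on at least two lines); so $\pi(\mathcal{S})\subset\mathbb{R}$. The vertical lines are $\ell'_j=\pi^{-1}(\xi)$ with $\xi\in\pi(\mathcal{S})$, and the horizontal lines satisfy $\pi(\ell_i)=\mathbb{C}$. ''Fibered'' means: for every $\xi\in\pi(\mathcal{S})$ the line $\pi^{-1}(\xi)$ belongs to $\mathcal{A}$. Put $B=\mathbb{C}\setminus\pi(\mathcal{S})$; then $\pi:\mathcal{M}(\mathcal{A})\to B$ is a fiber bundle with fiber $F_x=\mathbb{C}_x\setminus\bigcup_i\ell_i$, $\mathbb{C}_x=\pi^{-1}(x)$. A rank one local system on $\mathcal{M}(\mathcal{A})$ is given by assigning to each line a nonzero complex number (its parameter) by which a standard positively oriented small circle around the line acts; $\mathcal{L}_x$ is its restriction to $F_x$. For $x\in\mathbb{R}\setminus\pi(\mathcal{S})$ the $x$-ordering of the horizontal lines is by increasing intersection with the real axis of $\mathbb{C}_x$. Fix $y_0$ with $\Im(y_0)\gg0$, take $(x,y_0)$ as base point of $F_x$, and let $\alpha^{(x)}_1,\dots,\alpha^{(x)}_n$ be the elementary well-ordered generators of $\pi_1(F_x,(x,y_0))$: $\alpha^{(x)}_i$ goes along a straight path from the base point to a small circle around the intersection of $\mathbb{C}_x$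 with the $i$-th line in the $x$-ordering, runs around it counterclockwise and comes back (products of loops are read from left to right). With $s_i$ the parameter of the $i$-th line in the $x$-ordering, $H_1(F_x;\mathcal{L}_x)$ is the kernel of $\bigoplus_i\mathbb{C}\alpha^{(x)}_i\to\mathbb{C}$, $\alpha^{(x)}_i\mapsto s_i-1$. When all $s_i\neq1$ it has the basis $$\alpha^{(x)}_{i,i+1}=\frac{\alpha^{(x)}_i}{1-s_i}-\frac{\alpha^{(x)}_{i+1}}{1-s_{i+1}},\quad i=1,\dots,n-1.$$ Parallel transport: for $x,x'\in\mathbb{R}\setminus\pi(\mathcal{S})$ let $\gamma(x,x')$ be a path $\gamma(t)$ in $B$ from $x$ to $x'$ with $\gamma\cap\mathbb{R}=\{x,x'\}$ and $\Im(\gamma(t))(x-x')\ge0$. Transport of fibers along it, preserving the base points $(\cdot,y_0)$, induces an isomorphism $\gamma_*:\pi_1(F_x)\to\pi_1(F_{x'})$ and hence an isomorphism $\tau(x,x'):H_1(F_x;\mathcal{L}_x)\to H_1(F_{x'};\mathcal{L}_{x'})$, the restriction of the linear map $\alpha^{(x)}_i\mapsto\sum_j\varphi\big(\partial\gamma_*(\alpha^{(x)}_i)/\partial\alpha^{(x')}_j\big)\alpha^{(x')}_j$, where $\partial$ denotes Fox derivatives ($\partial(uv)=\partial u+u\,\partial v$) and $\varphi$ sends each $\alpha^{(x')}_j$ to the parameter of the corresponding line. *)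

(* Defs.v *)
From HB Require Import structures.
From mathcomp Require Import all_boot all_order all_algebra.
From mathcomp Require Import complex.
From mathcomp Require Import all_classical all_reals all_analysis.

Set Implicit Arguments.
Unset Strict Implicit.
Unset Printing Implicit Defensive.

Import Order.TTheory GRing.Theory Num.Theory numFieldNormedType.Exports.

Local Open Scope classical_set_scope.
Local Open Scope complex_scope.
Local Open Scope ring_scope.

(* The field of complex numbers over the reals R is R[i]; it gets the topology
   of its modulus. *)
HB.instance Definition _ (R : realType) := PseudoPointedMetric.copy R[i] R[i]^o.

(** * Real arrangements of lines in C^2 *)

(* The horizontal line i has equation y = slope i * x + offset i, the vertical
   line j has equation x = abscissa j; distinct indices give distinct lines. *)
Record arrangement (R : realType) (n m : nat) := Arrangement {
  slope : 'I_n -> R;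
  offset : 'I_n -> R;
  abscissa : 'I_m -> R;
  horizontal_inj : injective (fun i => (slope i, offset i));
  vertical_inj : injective abscissa
}.

Section Arrangement.
Context {R : realType} {n m : nat} (A : arrangement R n m).

Definition line (l : 'I_n + 'I_m) : set (R[i] * R[i]) :=
  match l with
  | inl i => [set z | z.2 = (slope A i)%:C * z.1 + (offset A i)%:C]
  | inr j => [set z | z.1 = (abscissa A j)%:C]
  end.

Definition singular : set (R[i] * R[i]) :=
  [set z | exists l l', [/\ l != l', line l z & line l' z]].

Definition singular_abscissae : set R[i] := fst @` singular.

(* The converse, that vertical lines lie over pi(S), is automatic when n > 0. *)
Definition fibered : Prop :=
  forall xi, singular_abscissae xi -> exists l, line l = fst @^-1` [set xi].

Definition fiber (x : R[i]) : set R[i] :=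
  [set y | forall i, ~ line (inl i) (x, y)].

(* For real x, the intersection of line i with C_x is the real number
   height x i. *)
Definition height (x : R) (i : 'I_n) : R := slope A i * x + offset A i.

(* The k-th horizontal line in the x-ordering; indices start from 0. *)
Definition ordered_line (x : R) (k : 'I_n) : 'I_n :=
  tnth (sort_tuple (fun i j => height x i <= height x j) (ord_tuple n)) k.

Definition puncture (x : R) (k : 'I_n) : R[i] := (height x (ordered_line x k))%:C.

(* The indices, in the x-ordering, of the horizontal lines through (p, y). *)
Definition block (p x : R) (y : R[i]) : set 'I_n :=
  [set k | line (inl (ordered_line x k)) (p%:C, y)].

(* x is closer to p than any other element of pi(S): then the closed segment
   between x and its symmetric meets pi(S) at most in p. *)
Definition close_to (p x : R) : Prop :=
  x != p /\ forall xi, singular_abscissae xi -> xi <> p%:C ->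
    `|x%:C - p%:C| < `|xi - p%:C|.

End Arrangement.

(** * Paths, parametrized by [0, 1] *)

Section Paths.
Context {R : realType}.
Implicit Types (f g : R -> R[i]) (z u v : R[i]).

(* f first, then g *)
Definition path_cat f g (s : R) : R[i] :=
  if s <= 2^-1 then f (2 * s) else g (2 * s - 1).

Definition path_rev f (s : R) : R[i] := f (1 - s).

Definition segment u v (s : R) : R[i] := u + s%:C * (v - u).

(* The counterclockwise circle around z that starts at z + d. *)
Definition circle z d (s : R) : R[i] :=
  z + d * (cos (2 * pi * s) +i* sin (2 * pi * s)).

Definition lasso y0 z (r : R) : R -> R[i] :=
  let d := r%:C * ((y0 - z) / `|y0 - z|) in
  path_cat (path_cat (segment y0 (z + d)) (circle z d)) (segment (z + d) y0).

End Paths.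

(** * Free group words and Fox derivatives *)

Section Fox.
Context {n : nat}.

(* (k, true) stands for alpha_k and (k, false) for its inverse *)
Definition letter : choiceType := ('I_n * bool)%type.
Definition word : choiceType := seq letter.

(* Formal Z-linear combinations of words, with values in the group ring of the
   free group.  The rules are d 1 = 0, d (u v) = d u + u (d v),
   d alpha_k / d alpha_j = delta_kj, hence
   d alpha_k^-1 / d alpha_j = - delta_kj alpha_k^-1. *)
Definition fox_letter (j : 'I_n) (l : letter) : seq (int * word) :=
  if l.1 != j then [::]
  else if l.2 then [:: (1, [::])] else [:: (-1, [:: l])].

Fixpoint fox (j : 'I_n) (w : word) : seq (int * word) :=
  if w is l :: v then fox_letter j l ++ [seq (cu.1, l :: cu.2) | cu <- fox j v]
  else [::].

Context {K : fieldType} (s : 'I_n -> K).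

Definition eval_word (w : word) : K :=
  \prod_(l <- w) (if l.2 then s l.1 else (s l.1)^-1).

Definition eval_sum (c : seq (int * word)) : K :=
  \sum_(cu <- c) cu.1%:~R * eval_word cu.2.

End Fox.

Arguments word n : clear implicits.

(** * Fundamental groups of the fibers and parallel transport *)

Section Transport.
Context {R : realType} {n m : nat} (A : arrangement R n m).

(* A third of the least of Im y0 and of the distances between two distinct
   punctures: the closed discs of this radius around the punctures of F_x are
   disjoint and do not contain the base point. *)
Definition radius (x : R) (y0 : R[i]) : R :=
  (\big[Num.min/complex.Im y0]_(ij : 'I_n * 'I_n | ij.1 != ij.2)
     `|height A x ij.1 - height A x ij.2|) / 3.

(* The elementary generator alpha^(x)_k of pi_1(F_x, y0). *)
Definition alpha_loop (x : R) (y0 : R[i]) (k : 'I_n) : R -> R[i] :=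
  lasso y0 (puncture A x k) (radius x y0).

(* A loop representing a word in the alpha^(x)_k, read from left to right. *)
Definition word_loop (x : R) (y0 : R[i]) (w : word n) : R -> R[i] :=
  foldr (fun l f => path_cat (if l.2 then alpha_loop x y0 l.1
                              else path_rev (alpha_loop x y0 l.1)) f)
        (fun=> y0) w.

(* gamma is a path in C \ pi(S) from x to x' such that gamma meets the real
   axis exactly in x and x', and Im gamma(t) (x - x') >= 0. *)
Definition half_plane_path (x x' : R) (gamma : R -> R[i]) : Prop :=
  [/\ {within `[0, 1], continuous gamma},
      gamma 0 = x%:C /\ gamma 1 = x'%:C,
      gamma @` `[0, 1] `<=` ~` singular_abscissae A,
      gamma @` `[0, 1] `&` [set z | complex.Im z = 0] = [set x%:C; x'%:C]
    & forall t, t \in `[0, 1] -> 0 <= complex.Im (gamma t) * (x - x')].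

(* y0 lies higher than all the punctures of the fibers over gamma. *)
Definition high_above (gamma : R -> R[i]) (y0 : R[i]) : Prop :=
  forall t i, t \in `[0, 1] ->
    complex.Im ((slope A i)%:C * gamma t + (offset A i)%:C) < complex.Im y0.

(* A continuous family H(t, _) of loops based at y0 in the fibers F_gamma(t),
   from f to g: the class of g in pi_1(F_gamma(1)) is the image under gamma_*
   of the class of f in pi_1(F_gamma(0)).  For constant gamma this is the
   homotopy of based loops. *)
Definition transports (gamma : R -> R[i]) (y0 : R[i]) (f g : R -> R[i]) : Prop :=
  exists H : R * R -> R[i],
    [/\ {within `[0, 1] `*` `[0, 1], continuous H},
        forall t s, t \in `[0, 1] -> s \in `[0, 1] ->
          fiber A (gamma t) (H (t, s)),
        forall t, t \in `[0, 1] -> H (t, 0) = y0 /\ H (t, 1) = y0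
      & forall s, s \in `[0, 1] -> H (0, s) = f s /\ H (1, s) = g s].

(* gamma_*(alpha^(x)_i), as a word in the alpha^(x')_j.  Any two such words
   define the same element of the free group pi_1(F_x', y0). *)
Definition transport_word (x x' : R) (gamma : R -> R[i]) (y0 : R[i]) (i : 'I_n)
    : word n :=
  xget [::] [set w : word n |
    transports gamma y0 (alpha_loop x y0 i) (word_loop x' y0 w)].

(** * Homology with coefficients in a rank one local system *)

(* The local system is given by the parameters of all the lines. *)
Context (a : 'I_n + 'I_m -> R[i]).

Definition parameter (x : R) (k : 'I_n) : R[i] := a (inl (ordered_line A x k)).

(* The row vector v stands for the combination of the alpha^(x)_k with
   coefficients v 0 k. *)
Definition H1 (x : R) : set 'rV[R[i]]_n :=
  [set v | \sum_(k < n) v 0 k * (parameter x k - 1) = 0].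

(* alpha_pair x k l is alpha^(x)_{k,l}, used for l the successor of k *)
Definition alpha_pair (x : R) (k l : 'I_n) : 'rV[R[i]]_n :=
  (1 - parameter x k)^-1 *: delta_mx 0 k - (1 - parameter x l)^-1 *: delta_mx 0 l.

(* tau(x, x'), or rather the map of which it is the restriction to H1 x *)
Definition tau (x x' : R) (gamma : R -> R[i]) (y0 : R[i]) (v : 'rV[R[i]]_n)
    : 'rV[R[i]]_n :=
  v *m \matrix_(i < n, j < n)
         eval_sum (parameter x') (fox j (transport_word x x' gamma y0 i)).

Definition monodromy (x x' : R) (gamma gamma' : R -> R[i]) (y0 : R[i]) :=
  tau x' x gamma' y0 \o tau x x' gamma y0.

End Transport.

(* Main.v *)
(** Let sg be the sign of the half plane swept by gamma, and cut each fibre C_x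
    with sg Im x >= 0 along the horizontal half lines going left from the
    punctures.  Since Im (a_i x + b_i) = a_i Im x, the punctures are ordered by
    slope for all x at once, so group elements g_i attached to the lines and
    multiplied by decreasing sg a_i define a locally constant transport law over
    the whole half plane, the real fibres included.  Its holonomy is invariant
    under moving loops, and gamma_* is controlled by the holonomies of the
    elementary generators in the two real fibres: these are M_k M_(k+1)^-1, with
    M_k the ordered product of the g_i over the lines in positions >= k.

    Splitting these products at the slope of a line shows that a half turn acts
    on each block by a half twist, and that two half turns conjugate alpha_k by
    the product of the generators of its block.  When the g_i are affine maps of
    the line, the translation part of a word is a combination of its Fox
    derivatives, which yields the monodromy matrix, and the two formulas follow
    by Abel summation.

    That gamma_* of a generator is represented by a word follows by pushing a
    loop along with the punctures by small bumps, then cutting the resulting loop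
    of the real fibre into short pieces, each inside a convex set. *)

Require Import Defs.
From HB Require Import structures.
From mathcomp Require Import all_boot all_order all_algebra.
From mathcomp Require Import complex.
From mathcomp Require Import all_classical all_reals all_analysis.
From mathcomp Require Import ring lra zify.
From Corelib Require Setoid Morphisms.

Set Implicit Arguments.
Unset Strict Implicit.
Unset Printing Implicit Defensive.

Import Order.TTheory GRing.Theory Num.Theory numFieldNormedType.Exports.

Local Open Scope classical_set_scope.
Local Open Scope complex_scope.
Local Open Scope ring_scope.

(** * Continuity of complex-valued maps *)

Section Topology.
Context {R : realType}.

(** The word chosen for gamma_* is known only through the homotopy class of the loop it represents,
    and gamma is an arbitrary curve, so neither can be computed with directly: everything has to be
    read off an invariant of loops. The values of this invariant on the generators of a fibre must
    moreover be free to choose, which is the role of [twist_solve]: whatever values are prescribed,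
    some family (g_i) realises them. In the affine group one prescribes the parameters s_k as linear
    parts and an arbitrary vector xi as translation parts. The matrix of tau is thus determined
    through its products with all columns xi, and no word is ever written down.

    The outward path and the return path sweep opposite half planes, in which the g_i are multiplied
    in opposite orders. One family cannot serve both; two families are used, matched over x' by
    their values on the generators of that fibre. *)

Lemma continuous_Re : continuous (@complex.Re R : R[i] -> R).
Proof.
move=> z; apply/(@cvgrPdist_lt _ _ _ _ (nbhs_filter z)) => e e0.
have ec : 0 < e%:C :> R[i] by rewrite ltcR.
move: (@nbhsx_ballx _ R[i]^o z _ ec); apply: (@filterS _ _ (nbhs_filter (z : R[i]^o))) => w.
rewrite /ball /= normc_def ltcR; apply: le_lt_trans.
rewrite -sqrtr_sqr ler_wsqrtr //; case: z {ec} => a b; case: w => c d /=.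
by rewrite lerDl sqr_ge0.
Qed.

Lemma continuous_Im : continuous (@complex.Im R : R[i] -> R).
Proof.
move=> z; apply/(@cvgrPdist_lt _ _ _ _ (nbhs_filter z)) => e e0.
have ec : 0 < e%:C :> R[i] by rewrite ltcR.
move: (@nbhsx_ballx _ R[i]^o z _ ec); apply: (@filterS _ _ (nbhs_filter (z : R[i]^o))) => w.
rewrite /ball /= normc_def ltcR; apply: le_lt_trans.
rewrite -sqrtr_sqr ler_wsqrtr //; case: z {ec} => a b; case: w => c d /=.
by rewrite lerDr sqr_ge0.
Qed.

Lemma continuous_complex (T : topologicalType) (f g : T -> R) :
  continuous f -> continuous g -> continuous (fun t => f t +i* g t : R[i]).
Proof.
move=> cf cg t; apply/(@cvgrPdist_lt R[i] R[i]^o) => e e0.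
have [e' e'0 ->] : exists2 e' : R, 0 < e' & e = e'%:C.
  move: e0; rewrite ltcE => /andP[/eqP /= ei er]; exists (complex.Re e) => //.
  by case: e ei {er} => ? ? /= ->.
have h0 : 0 < e' / 2 by rewrite divr_gt0.
near=> u.
have fu : `|f t - f u| < e' / 2.
  by near: u; apply: (@cvgr_dist_lt _ R^o _ _ _ f _ (cf t)).
have gu : `|g t - g u| < e' / 2.
  by near: u; apply: (@cvgr_dist_lt _ R^o _ _ _ g _ (cg t)).
rewrite (_ : (_ - _) = (f t - f u)%:C + (g t - g u)%:C * 'i%C); last first.
  by simpc.
apply: le_lt_trans (ler_normD _ _) _.
rewrite normrM !normc_def /= !expr0n /= !addr0 expr1n add0r sqrtr1 mulr1 !sqrtr_sqr.
by rewrite -rmorphD ltcR [e']splitr ltrD.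
Unshelve. all: by end_near. Qed.

Lemma complex_eta (z : R[i]) : complex.Re z +i* complex.Im z = z.
Proof. by case: z. Qed.

Lemma continuousC (T : topologicalType) (f : T -> R[i]) :
  continuous (fun t => complex.Re (f t)) ->
  continuous (fun t => complex.Im (f t)) -> continuous f.
Proof.
move=> fr fi; have := continuous_complex fr fi.
by under eq_fun do rewrite complex_eta.
Qed.

Lemma continuous_if (T U : topologicalType) (h : T -> R) (c : R) (f g : T -> U) :
  continuous h -> continuous f -> continuous g ->
  (forall t, h t = c -> f t = g t) ->
  continuous (fun t => if h t <= c then f t else g t).
Proof.
move=> ch cf cg fg t; rewrite /continuous_at.
have [ltc|ltc|eqc] := ltgtP (h t) c.
- apply: (cvg_trans _ (cf t)); apply: near_eq_cvg; near=> u.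
  suff -> : h u <= c by [].
  by apply: ltW; near: u; apply: (@cvgr_lt _ _ _ _ _ (h t) (ch t)).
- apply: (cvg_trans _ (cg t)); apply: near_eq_cvg; near=> u.
  suff -> : (h u <= c) = false by [].
  by apply/negbTE; rewrite -ltNge; near: u; apply: (@cvgr_gt _ _ _ _ _ (h t) (ch t)).
- move=> B /= Bt.
  have gB : nbhs t (g @^-1` B) by apply: cg; rewrite -fg.
  have fB : nbhs t (f @^-1` B) by apply: cf; exact: Bt.
  have H: nbhs t (f @^-1` B `&` g @^-1` B) by apply: filterI.
  apply: (filterS _ H) => u [fu gu]. rewrite /preimage /=. by case: ifP.
Unshelve. all: by end_near. Qed.

(** Retraction of the line onto the unit interval. Composition with it turns a map continuous only
    within [0, 1] into one continuous everywhere, so that subspace topologies need not be carried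
    along. *)
Definition clamp (t : R) : R := Num.max 0 (Num.min 1 t).

Lemma continuous_clamp : continuous clamp.
Proof.
move=> t; apply: continuous_max; first exact: cst_continuous.
by apply: continuous_min; [exact: cst_continuous|].
Qed.

Lemma clamp_itv t : clamp t \in `[0, 1].
Proof. by rewrite in_itv /= /clamp le_max lexx ge_max ler01 ge_min lexx. Qed.

Lemma clamp_id t : t \in `[0, 1] -> clamp t = t.
Proof.
by rewrite in_itv => /andP[t0 t1]; rewrite /clamp (min_r t1) (max_r t0).
Qed.

Lemma continuous_within_comp (T U V : topologicalType) (B : set U)
    (f : U -> V) (g : T -> U) :
  {within B, continuous f} -> continuous g -> (forall t, B (g t)) ->
  continuous (f \o g).
Proof.
move=> /subspace_continuousP cf cg gB t W Wt.
move: (cf _ (gB t) W Wt); rewrite /fmap /within /=.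
move=> /(cg t) H; have {}H : nbhs t [set u | B (g u) -> W (f (g u))] by [].
by move: H; apply: filterS => u /(_ (gB u)).
Qed.


Section RealValued.
Context {T : topologicalType}.
Implicit Types f g : T -> R.

Lemma cts_cst (U : topologicalType) (c : U) : continuous (fun _ : T => c).
Proof. exact: cst_continuous. Qed.

Lemma cts_comp (U V : topologicalType) (h : U -> V) (k : T -> U) :
  continuous h -> continuous k -> continuous (fun t => h (k t)).
Proof. by move=> ch ck t; apply: (@continuous_comp _ _ _ k h); [exact: ck|exact: ch]. Qed.

Lemma ctsD f g : continuous f -> continuous g -> continuous (fun t => f t + g t).
Proof. by move=> cf cg t; apply: (@continuousD _ R^o); [exact: cf|exact: cg]. Qed.

Lemma ctsN f : continuous f -> continuous (fun t => - f t).
Proof. by move=> cf t; apply: (@continuousN _ R^o); exact: cf. Qed.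

Lemma ctsM f g : continuous f -> continuous g -> continuous (fun t => f t * g t).
Proof. by move=> cf cg t; apply: continuousM; [exact: cf|exact: cg]. Qed.

Lemma cts_min f g : continuous f -> continuous g -> continuous (fun t => Num.min (f t) (g t)).
Proof. by move=> cf cg t; apply: continuous_min; [exact: cf|exact: cg]. Qed.

Lemma cts_max f g : continuous f -> continuous g -> continuous (fun t => Num.max (f t) (g t)).
Proof. by move=> cf cg t; apply: continuous_max; [exact: cf|exact: cg]. Qed.

Lemma cts_norm f : continuous f -> continuous (fun t => `|f t|).
Proof.
move=> cf t; apply: (@continuous_comp _ _ _ f (fun x => `|x|)); first exact: cf.
exact: norm_continuous.
Qed.

Lemma cts_Re (f : T -> R[i]) : continuous f -> continuous (fun t => complex.Re (f t)).
Proof. by move=> cf; apply: cts_comp => //; exact: continuous_Re. Qed.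

Lemma cts_Im (f : T -> R[i]) : continuous f -> continuous (fun t => complex.Im (f t)).
Proof. by move=> cf; apply: cts_comp => //; exact: continuous_Im. Qed.

Lemma cts_fst (U V : topologicalType) (h : T -> U * V) : continuous h -> continuous (fun t => (h t).1).
Proof. by move=> ch t; apply: (@continuous_comp _ _ _ h fst); [exact: ch|exact: cvg_fst]. Qed.

Lemma cts_snd (U V : topologicalType) (h : T -> U * V) : continuous h -> continuous (fun t => (h t).2).
Proof. by move=> ch t; apply: (@continuous_comp _ _ _ h snd); [exact: ch|exact: cvg_snd]. Qed.

Lemma cts_pair (U V : topologicalType) (h : T -> U) (k : T -> V) :
  continuous h -> continuous k -> continuous (fun t => (h t, k t)).
Proof. by move=> ch ck t; apply: cvg_pair; [exact: ch|exact: ck]. Qed.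

Lemma cts_id : continuous (fun t : T => t).
Proof. by move=> t; exact: cvg_id. Qed.

Lemma ctsC_D (f g : T -> R[i]) : continuous f -> continuous g -> continuous (fun t => f t + g t).
Proof.
move=> cf cg; apply: continuousC.
  rewrite (_ : (fun t => _) = fun t => complex.Re (f t) + complex.Re (g t)).
    by apply: ctsD; apply: cts_Re.
  by apply/funext => t; case: (f t) => ? ?; case: (g t).
rewrite (_ : (fun t => _) = fun t => complex.Im (f t) + complex.Im (g t)).
  by apply: ctsD; apply: cts_Im.
by apply/funext => t; case: (f t) => ? ?; case: (g t).
Qed.

Lemma ctsC_M (f g : T -> R[i]) : continuous f -> continuous g -> continuous (fun t => f t * g t).
Proof.
move=> cf cg; apply: continuousC.
  rewrite (_ : (fun t => _) = fun t =>
    complex.Re (f t) * complex.Re (g t) + - (complex.Im (f t) * complex.Im (g t))).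
    by apply: ctsD; last apply: ctsN; apply: ctsM; (exact: cts_Re || exact: cts_Im).
  by apply/funext => t; case: (f t) => ? ?; case: (g t).
rewrite (_ : (fun t => _) = fun t =>
  complex.Re (f t) * complex.Im (g t) + complex.Im (f t) * complex.Re (g t)).
  by apply: ctsD; apply: ctsM; (exact: cts_Re || exact: cts_Im).
by apply/funext => t; case: (f t) => ? ?; case: (g t).
Qed.

Lemma ctsC_N (f : T -> R[i]) : continuous f -> continuous (fun t => - f t).
Proof.
move=> cf; apply: continuousC.
  rewrite (_ : (fun t => _) = fun t => - complex.Re (f t)); first by apply: ctsN; exact: cts_Re.
  by apply/funext => t; case: (f t).
rewrite (_ : (fun t => _) = fun t => - complex.Im (f t)); first by apply: ctsN; exact: cts_Im.
by apply/funext => t; case: (f t).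
Qed.

Lemma ctsC_real f : continuous f -> continuous (fun t => (f t)%:C : R[i]).
Proof. by move=> cf; apply: continuous_complex => //; exact: cts_cst. Qed.

Lemma ctsC_sum (I : Type) (r : seq I) (P : pred I) (F : I -> T -> R[i]) :
  (forall i, continuous (F i)) -> continuous (fun t => \sum_(i <- r | P i) F i t).
Proof.
move=> cF; elim: r => [|i r IH].
  by under eq_fun do rewrite big_nil; exact: cts_cst.
under eq_fun do rewrite big_cons.
case: (P i); last exact: IH.
apply: ctsC_D; [exact: cF|exact: IH].
Qed.

End RealValued.

End Topology.

(** Syntax-directed descent through an expression. The patterns with a bare [GRing.add _],
    [GRing.mul _], [GRing.opp], [fst] or [snd] catch functions that were eta-contracted. *)
Ltac cts := repeat match goal with
  | |- continuous (fun=> _) => exact: cts_cst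
  | |- continuous (fun t => t) => exact: cts_id
  | H : continuous ?f |- continuous ?f => exact: H
  | |- continuous (fun t => Complex _ _) => apply: continuous_complex
  | |- continuous (fun t => @real_complex_def _ _ _) => apply: ctsC_real
  | |- continuous (@real_complex_def _ _) => apply: ctsC_real
  | |- continuous (GRing.add _) => first [apply: ctsD | apply: ctsC_D]
  | |- continuous (GRing.mul _) => first [apply: ctsM | apply: ctsC_M]
  | |- continuous GRing.opp => first [apply: ctsN | apply: ctsC_N]
  | |- continuous fst => apply: cts_fst
  | |- continuous snd => apply: cts_snd
  | |- continuous (fun t => GRing.add _ _) => first [apply: ctsD | apply: ctsC_D]
  | |- continuous (fun t => GRing.mul _ _) => first [apply: ctsM | apply: ctsC_M]
  | |- continuous (fun t => GRing.opp _) => first [apply: ctsN | apply: ctsC_N]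
  | |- continuous (fun t => Order.min _ _) => apply: cts_min
  | |- continuous (fun t => Order.max _ _) => apply: cts_max
  | |- continuous (fun t => Num.norm _) => apply: cts_norm
  | |- continuous (fun t => complex.Re _) => apply: cts_Re
  | |- continuous (fun t => complex.Im _) => apply: cts_Im
  | |- continuous (fun t => (_).1) => apply: cts_fst
  | |- continuous (fun t => (_).2) => apply: cts_snd
  | |- continuous (fun t => (_, _)) => apply: cts_pair
  end.

Section Paths.
Context {R : realType}.

Lemma path_cat_continuous (f g : R -> R[i]) :
  continuous f -> continuous g -> f 1 = g 0 -> continuous (path_cat f g).
Proof.
move=> cf cg fg; apply: (@continuous_if R R _ (fun s => s)).
- exact: cts_id.
- by apply: (cts_comp cf); cts.
- by apply: (cts_comp cg); cts.
- by move=> s ->; rewrite divff ?pnatr_eq0 // subrr.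
Qed.

Lemma path_rev_continuous (f : R -> R[i]) : continuous f -> continuous (path_rev f).
Proof. by move=> cf; apply: (cts_comp cf); cts. Qed.

Lemma segment_continuous (u v : R[i]) : continuous (@segment R u v).
Proof. by rewrite /segment; cts. Qed.

Lemma circle_continuous (z d : R[i]) : continuous (@circle R z d).
Proof.
have cc : continuous (fun s : R => cos (2 * pi * s)).
  by apply: (cts_comp (@continuous_cos R)); cts.
have cs : continuous (fun s : R => sin (2 * pi * s)).
  by apply: (cts_comp (@continuous_sin R)); cts.
by rewrite /circle; cts.
Qed.

End Paths.

(** * Compactness and uniform bounds *)

Section Uniform.
Context {R : realType}.

(** [W] is any property of sets that passes to subsets and holds near each point of [K]. It will
    stand for being mapped into a convex set, for small oscillation, and for the existence of a
    potential of the holonomy. *)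
Lemma lebesgue_number (T : pseudoMetricType R) (K : set T) (W : set T -> Prop) :
  compact K -> (forall U V, U `<=` V -> W V -> W U) ->
  (forall z, K z -> exists2 d : R, 0 < d & W (ball z d)) ->
  exists2 d : R, 0 < d & forall z, K z -> W (ball z d).
Proof.
move=> /compact_near_coveringP cK Wsub Wloc.
have := cK R (0^'+) (fun d z => W (ball z d)) _.
case.
  move=> z /Wloc[d d0 Wd]; near=> z' d' => /=.
  apply: (Wsub _ _ _ Wd) => u zu; rewrite [d]splitr; apply: (@ball_triangle _ _ z').
    near: z'. exact: nbhsx_ballx (divr_gt0 d0 _).
  apply: le_ball zu. near: d'. exact: nbhs_right_le (divr_gt0 d0 _).
move=> e /= e0 He; exists (e / 2); first by rewrite divr_gt0.
move=> z Kz; apply: He => //=; last by rewrite divr_gt0.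
by rewrite sub0r normrN gtr0_norm ?divr_gt0 // ltr_pdivrMr // ltr_pMr // ltr1n.
Unshelve. all: by end_near. Qed.


Lemma finite_lower_bound (I : finType) (P : pred I) (f : I -> R) :
  (forall i, P i -> 0 < f i) -> exists2 e : R, 0 < e & forall i, P i -> e <= f i.
Proof.
move=> f0; exists (\big[Num.min/1]_(i | P i) f i).
  by apply/bigmin_gtP; split=> //; exact: ltr01.
by move=> i Pi; exact: bigmin_le_cond.
Qed.

Lemma small_inverse (d : R) : 0 < d ->
  exists2 N0 : nat, (0 < N0)%N & forall N, (N0 <= N)%N -> N%:R^-1 < d.
Proof.
move=> d0; exists (Num.bound d^-1).+1 => // N leN.
have dN : d^-1 < N%:R.
  have /archi_boundP /lt_le_trans : 0 <= d^-1 by rewrite invr_ge0 ltW.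
  by apply; rewrite ler_nat (leq_trans _ leN).
by rewrite -[d]invrK ltf_pV2 // ?posrE ?invr_gt0 //; apply: lt_trans dN; rewrite invr_gt0.
Qed.

End Uniform.

(** * Homotopies of paths *)

Section Homotopy.
Context {R : realType}.
Implicit Types (F : set R[i]) (u v w : R[i]).

(** Continuity is required on the whole line and membership in [F] only on [0, 1]; the same
    convention holds for homotopies. Continuity then composes without side conditions. *)
Record fpath F u v := FPath {
  fp :> R -> R[i];
  fp_continuous : continuous fp;
  fp_in : forall s, s \in `[0, 1] -> F (fp s);
  fp0 : fp 0 = u;
  fp1 : fp 1 = v
}.

Arguments fp_continuous [F u v] f.
Arguments fp_in [F u v] f [s].

Definition homotopic F u v (f g : fpath F u v) : Prop :=
  exists H : R * R -> R[i],
    [/\ continuous H,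
        forall t s, t \in `[0, 1] -> s \in `[0, 1] -> F (H (t, s)),
        forall t, t \in `[0, 1] -> H (t, 0) = u /\ H (t, 1) = v
      & forall s, s \in `[0, 1] -> H (0, s) = f s /\ H (1, s) = g s].

Lemma homotopic_refl F u v : RelationClasses.Reflexive (@homotopic F u v).
Proof.
move=> f; exists (fun z => f z.2); split => //.
- by apply: (cts_comp (fp_continuous f)); cts.
- by move=> t s _ s01; exact: fp_in.
- by move=> t _; rewrite /= fp0 fp1.
Qed.

Lemma homotopic_sym F u v : RelationClasses.Symmetric (@homotopic F u v).
Proof.
move=> f g [H [cH HF Hb He]]; exists (fun z => H (1 - z.1, z.2)); split => /=.
- by apply: (cts_comp cH); cts.
- by move=> t s t01 s01; apply: HF => //; rewrite !in_itv /= in t01 *; lra.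
- by move=> t t01; apply: Hb; rewrite !in_itv /= in t01 *; lra.
- by move=> s s01; rewrite subr0 subrr; case: (He _ s01).
Qed.

Lemma homotopic_trans F u v : RelationClasses.Transitive (@homotopic F u v).
Proof.
move=> f g k [H [cH HF Hb He]] [H' [cH' HF' Hb' He']].
(* The two homotopies agree at the seam only when the second coordinate is in [0, 1], whereas the
   glued map must be continuous on the whole plane; hence [clamp]. *)
exists (fun z => if z.1 <= 2^-1 then H (2 * Num.min z.1 2^-1, clamp z.2)
  else H' (2 * Num.max z.1 2^-1 - 1, clamp z.2)); split => /=.
- apply: continuous_if; first by cts.
  + by apply: (cts_comp cH); cts; apply: (cts_comp (@continuous_clamp R)); cts.
  + by apply: (cts_comp cH'); cts; apply: (cts_comp (@continuous_clamp R)); cts.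
  move=> [t s] /= ->; rewrite minxx maxxx divff ?pnatr_eq0 // subrr.
  by have [-> _] := He' _ (clamp_itv s); have [_ ->] := He _ (clamp_itv s).
- move=> t s t01 s01; rewrite clamp_id //; rewrite in_itv /= in t01.
  case: ifP => tl; [apply: HF|apply: HF'] => //; rewrite in_itv /=.
    by rewrite min_l //; lra.
  by rewrite max_l; lra.
- move=> t t01; rewrite !clamp_id ?in_itv /= ?lexx ?ler01 //; rewrite in_itv /= in t01.
  case: ifP => tl; [apply: Hb|apply: Hb'] => //; rewrite in_itv /=.
    by rewrite min_l //; lra.
  by rewrite max_l; lra.
- move=> s s01; rewrite clamp_id // invr_ge0 ler0n min_l ?invr_ge0 ?ler0n // mulr0.
  rewrite (_ : (1 <= 2^-1 :> R) = false); last by lra.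
  rewrite max_l; last by lra.
  rewrite mulr1 (_ : 2 - 1 = 1); last by lra.
  by case: (He _ s01); case: (He' _ s01).
Qed.

#[global] Instance homotopic_equiv F u v : RelationClasses.Equivalence (@homotopic F u v).
Proof.
split; [exact: homotopic_refl|exact: homotopic_sym|exact: homotopic_trans].
Qed.

Lemma homotopic_id F u v (f : fpath F u v) : homotopic f f.
Proof. exact: homotopic_refl. Qed.
Hint Resolve homotopic_id : core.

Lemma half_itvl (s : R) : s \in `[0, 1] -> s <= 2^-1 -> 2 * s \in `[0, 1].
Proof. by rewrite !in_itv /=; lra. Qed.

Lemma half_itvr (s : R) : s \in `[0, 1] -> (s <= 2^-1) = false -> 2 * s - 1 \in `[0, 1].
Proof. by rewrite !in_itv /=; lra. Qed.

(** Transparent, so that the underlying function reduces to [path_cat f g]; the loops of the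
    statement are later recognised by computation. *)
Definition pcat F u v w (f : fpath F u v) (g : fpath F v w) : fpath F u w.
Proof.
apply: (@FPath F u w (path_cat f g)).
- apply: path_cat_continuous; [exact: fp_continuous|exact: fp_continuous|].
  by rewrite fp0 fp1.
- move=> s s01; rewrite /path_cat; case: ifP => s2; apply: fp_in.
    exact: half_itvl.
  exact: half_itvr.
- by rewrite /path_cat invr_ge0 ler0n mulr0 fp0.
- rewrite /path_cat (_ : (1 <= 2^-1 :> R) = false); last by lra.
  by rewrite (_ : 2 * 1 - 1 = 1) ?fp1 //; lra.
Defined.

Definition preverse F u v (f : fpath F u v) : fpath F v u.
Proof.
apply: (@FPath F v u (path_rev f)).
- by apply: path_rev_continuous; exact: fp_continuous.
- by move=> s s01; apply: fp_in; rewrite !in_itv /= in s01 *; lra.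
- by rewrite /path_rev subr0 fp1.
- by rewrite /path_rev subrr fp0.
Defined.

Definition pcst F u (Fu : F u) : fpath F u u.
Proof. by apply: (@FPath F u u (fun=> u)) => //; exact: cts_cst. Defined.

Definition pseg F u v (h : forall s, s \in `[0, 1] -> F (segment u v s)) :
  fpath F u v.
Proof.
apply: (@FPath F u v (segment u v)) => //.
- exact: segment_continuous.
- by rewrite /segment mul0r addr0.
- by rewrite /segment mul1r addrC subrK.
Defined.

#[global] Instance pcat_proper F u v w :
  Morphisms.Proper (Morphisms.respectful (@homotopic F u v)
    (Morphisms.respectful (@homotopic F v w) (@homotopic F u w))) (@pcat F u v w).
Proof.
move=> f f' [H [cH HF Hb He]] g g' [H' [cH' HF' Hb' He']].
exists (fun z => if z.2 <= 2^-1 then H (clamp z.1, 2 * z.2) else H' (clamp z.1, 2 * z.2 - 1)).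
split => /=.
- apply: continuous_if; first by cts.
  + by apply: (cts_comp cH); cts; apply: (cts_comp (@continuous_clamp R)); cts.
  + by apply: (cts_comp cH'); cts; apply: (cts_comp (@continuous_clamp R)); cts.
  move=> [t s] /= ->; rewrite divff ?pnatr_eq0 // subrr.
  by have [-> _] := Hb' _ (clamp_itv t); have [_ ->] := Hb _ (clamp_itv t).
- move=> t s t01 s01; rewrite clamp_id //.
  by case: ifP => s2; [apply: HF => //; exact: half_itvl|apply: HF' => //; exact: half_itvr].
- move=> t t01; rewrite clamp_id // invr_ge0 ler0n mulr0.
  rewrite (_ : (1 <= 2^-1 :> R) = false); last by lra.
  rewrite (_ : 2 * 1 - 1 = 1); last by lra.
  by case: (Hb _ t01); case: (Hb' _ t01).
- move=> s s01; rewrite !clamp_id ?in_itv /= ?lexx ?ler01 // /path_cat.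
  by case: ifP => s2; [apply: He; exact: half_itvl|apply: He'; exact: half_itvr].
Qed.

#[global] Instance preverse_proper F u v :
  Morphisms.Proper (Morphisms.respectful (@homotopic F u v) (@homotopic F v u)) (@preverse F u v).
Proof.
move=> f f' [H [cH HF Hb He]]; exists (fun z => H (z.1, 1 - z.2)); split => /=.
- by apply: (cts_comp cH); cts.
- by move=> t s t01 s01; apply: HF => //; rewrite !in_itv /= in s01 *; lra.
- by move=> t t01; rewrite subr0 subrr; case: (Hb _ t01).
- by move=> s s01; apply: He; rewrite !in_itv /= in s01 *; lra.
Qed.

Lemma homotopic_ext F u v (f g : fpath F u v) :
  (forall s, s \in `[0, 1] -> f s = g s) -> homotopic f g.
Proof.
move=> fg; exists (fun z => f z.2); split => /=.
- by apply: (cts_comp (fp_continuous f)); cts.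
- by move=> t s _ s01; exact: fp_in.
- by move=> t _; rewrite fp0 fp1.
- by move=> s s01; rewrite -fg.
Qed.

Lemma homotopic_convex F u v (W : set R[i]) (f g : fpath F u v) :
  W `<=` F ->
  (forall a b t, W a -> W b -> t \in `[0, 1] -> W (segment a b t)) ->
  (forall s, s \in `[0, 1] -> W (f s)) -> (forall s, s \in `[0, 1] -> W (g s)) ->
  homotopic f g.
Proof.
move=> WF Wc Wf Wg; exists (fun z => segment (f z.2) (g z.2) z.1); split => /=.
- have cf : continuous (fun z : R * R => f z.2).
    by apply: (cts_comp (fp_continuous f)); cts.
  have cg : continuous (fun z : R * R => g z.2).
    by apply: (cts_comp (fp_continuous g)); cts.
  by rewrite /segment; cts.
- by move=> t s t01 s01; apply: WF; apply: Wc => //; [apply: Wf|apply: Wg].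
- by move=> t t01; rewrite !fp0 !fp1 /segment !subrr !mulr0 !addr0.
- by move=> s s01; rewrite /segment mul0r addr0 mul1r addrC subrK.
Qed.

(** Two ways of running along one path [k] are homotopic by interpolating the clocks [phi] and
    [psi], since [0, 1] is convex. The groupoid laws that change the parametrization all reduce to
    this. *)
Lemma homotopic_reparam F u v w w' (k : fpath F w w') (phi psi : R -> R)
    (f g : fpath F u v) :
  continuous phi -> continuous psi ->
  (forall s, s \in `[0, 1] -> phi s \in `[0, 1]) ->
  (forall s, s \in `[0, 1] -> psi s \in `[0, 1]) ->
  phi 0 = psi 0 -> phi 1 = psi 1 ->
  (forall s, s \in `[0, 1] -> f s = k (phi s)) ->
  (forall s, s \in `[0, 1] -> g s = k (psi s)) ->
  homotopic f g.
Proof.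
move=> cphi cpsi phi01 psi01 e0 e1 fk gk.
have i0 : (0 : R) \in `[0, 1] by rewrite in_itv /= lexx ler01.
have i1 : (1 : R) \in `[0, 1] by rewrite in_itv /= lexx ler01.
exists (fun z => k (phi z.2 + z.1 * (psi z.2 - phi z.2))); split => /=.
- apply: (cts_comp (fp_continuous k)).
  have c1 : continuous (fun z : R * R => phi z.2) by apply: (cts_comp cphi); cts.
  have c2 : continuous (fun z : R * R => psi z.2) by apply: (cts_comp cpsi); cts.
  by cts.
- move=> t s t01 s01; apply: fp_in.
  have := phi01 _ s01; have := psi01 _ s01; move: t01; rewrite !in_itv /=.
  by move=> /andP[? ?] /andP[? ?] /andP[? ?]; apply/andP; split; nra.
- move=> t t01; rewrite -e0 -e1 !subrr !mulr0 !addr0 -!fk //.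
  by rewrite fp0 fp1.
- move=> s s01; rewrite mul0r addr0 mul1r addrC subrK.
  by rewrite fk // gk.
Qed.

End Homotopy.

Arguments fp_continuous [R F u v] f.
Arguments fp_in [R F u v] f [s].

#[export] Hint Resolve homotopic_id : core.

(** * Groupoid laws up to homotopy *)

Section Groupoid.
Context {R : realType}.
Implicit Types (F : set R[i]) (u v w : R[i]).

Lemma homotopic_subdivide F u v w w' w'' (k : fpath F w' w'') (a b c : R)
    (f : fpath F u w) (g : fpath F u v) (h : fpath F v w) :
  a \in `[0, 1] -> b \in `[0, 1] -> c \in `[0, 1] ->
  (forall s, s \in `[0, 1] -> f s = k (a + (c - a) * s)) ->
  (forall s, s \in `[0, 1] -> g s = k (a + (b - a) * s)) ->
  (forall s, s \in `[0, 1] -> h s = k (b + (c - b) * s)) ->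
  homotopic f (pcat g h).
Proof.
move=> a01 b01 c01 fk gk hk.
apply: (@homotopic_reparam _ _ _ _ _ _ k (fun s => a + (c - a) * s)
  (* On the first half the [min] term runs from a to b, on the second half the [max] term runs from
     b to c. *)
  (fun s => a + (b - a) * Num.min (2 * s) 1 + (c - b) * Num.max (2 * s - 1) 0)).
- by cts.
- by cts.
- by move=> s; move: a01 c01; rewrite !in_itv /= => *; nra.
- move=> s; move: a01 b01 c01; rewrite !in_itv /= => a01 b01 c01 s01.
  have [s2|s2] := leP s 2^-1.
    by rewrite min_l ?max_r; nra.
  by rewrite min_r ?max_l; nra.
- by rewrite !mulr0 min_l ?max_r; lra.
- by rewrite !mulr1 min_r ?max_l; lra.
- exact: fk.
- move=> s s01; rewrite /= /path_cat; case: ifP => s2.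
    rewrite gk ?half_itvl // min_l ?max_r; [|lra|lra].
    by rewrite mulr0 addr0.
  rewrite hk ?half_itvr // min_r ?max_l; [|lra|lra].
  by congr (k _); ring.
Qed.

Lemma pcatA F u v w z (f : fpath F u v) (g : fpath F v w) (h : fpath F w z) :
  homotopic (pcat (pcat f g) h) (pcat f (pcat g h)).
Proof.
(* The clock sends 0, 1/4, 1/2, 1 to 0, 1/2, 3/4, 1 with slopes 2, 1, 1/2; it is concave, hence the
   minimum of its three affine pieces. *)
apply: (@homotopic_reparam _ _ _ _ _ _ (pcat f (pcat g h))
  (fun s => Num.min (2 * s) (Num.min (s + 4^-1) ((s + 1) / 2))) (fun s => s)).
- by cts.
- by cts.
- move=> s; rewrite !in_itv /= => s01; rewrite !le_min !ge_min; lra.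
- by [].
- by rewrite min_l ?le_min; lra.
- by rewrite min_r ?min_r; lra.
- move=> s s01; rewrite /= /path_cat; case: (leP s 2^-1) => s2.
    case: (leP (2 * s) 2^-1) => s4.
      rewrite min_l; last by rewrite le_min; lra.
      by rewrite s4.
    rewrite [X in Num.min _ X]min_l; last by lra.
    rewrite min_r; last by lra.
    rewrite ifF; last by lra.
    rewrite ifT; last by lra.
    by congr (g _); field.
  rewrite [X in Num.min _ X]min_r; last by lra.
  rewrite min_r; last by lra.
  rewrite ifF; last by lra.
  rewrite ifF; last by lra.
  by congr (h _); field.
- by [].
Qed.

Lemma pcat1p F u v (Fu : F u) (f : fpath F u v) : homotopic (pcat (pcst Fu) f) f.
Proof.
apply: (@homotopic_reparam _ _ _ _ _ _ f (fun s => Num.max 0 (2 * s - 1)) (fun s => s)) => //.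
- by cts.
- by cts.
- by move=> s; rewrite !in_itv /= le_max ge_max; lra.
- by rewrite max_l; lra.
- by rewrite max_r; lra.
- move=> s s01; rewrite /= /path_cat; case: (leP s 2^-1) => s2.
    by rewrite max_l ?fp0 //; lra.
  by rewrite max_r //; lra.
Qed.

Lemma pcatp1 F u v (Fv : F v) (f : fpath F u v) : homotopic (pcat f (pcst Fv)) f.
Proof.
apply: (@homotopic_reparam _ _ _ _ _ _ f (fun s => Num.min 1 (2 * s)) (fun s => s)) => //.
- by cts.
- by cts.
- by move=> s; rewrite !in_itv /= le_min ge_min; lra.
- by rewrite min_r; lra.
- by rewrite min_l; lra.
- move=> s s01; rewrite /= /path_cat; case: (leP s 2^-1) => s2.
    by rewrite min_r //; lra.
  by rewrite min_l ?fp1 //; lra.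
Qed.

Lemma pcatV F u v (Fu : F u) (f : fpath F u v) : homotopic (pcat f (preverse f)) (pcst Fu).
Proof.
apply: (@homotopic_reparam _ _ _ _ _ _ f (fun s => Num.min (2 * s) (2 - 2 * s)) (fun=> 0)) => //.
- by cts.
- by cts.
- by move=> s; rewrite !in_itv /= le_min ge_min; lra.
- by rewrite in_itv /= lexx ler01.
- by rewrite min_l; lra.
- by rewrite min_r; lra.
- move=> s s01; rewrite /= /path_cat /path_rev; case: (leP s 2^-1) => s2.
    by rewrite min_l //; lra.
  by rewrite min_r; [congr (f _); lra|lra].
- by move=> s _; rewrite fp0.
Qed.

Lemma preverseK F u v (f : fpath F u v) : homotopic (preverse (preverse f)) f.
Proof. by apply: homotopic_ext => s _; rewrite /= /path_rev subKr. Qed.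

Lemma preverse_cat F u v w (f : fpath F u v) (g : fpath F v w) :
  homotopic (preverse (pcat f g)) (pcat (preverse g) (preverse f)).
Proof.
apply: homotopic_ext => s _; rewrite /= /path_rev /path_cat.
case: (ltgtP s 2^-1) => s2.
- rewrite ifF; last by lra.
  by congr (g _); lra.
- rewrite ifT; last by lra.
  by congr (f _); lra.
- rewrite ifT; last by lra.
  rewrite (_ : 2 * (1 - s) = 1); last by lra.
  by rewrite (_ : 1 - 2 * s = 0) ?fp0 ?fp1 //; lra.
Qed.

Lemma pcatKV F u v w (f : fpath F u v) (g : fpath F u w) :
  homotopic (pcat f (pcat (preverse f) g)) g.
Proof.
have Fu : F u by rewrite -(fp0 f); apply: fp_in; rewrite in_itv /= lexx ler01.
by rewrite -pcatA (pcatV Fu) pcat1p.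
Qed.

Lemma pcatVK F u v w (f : fpath F u v) (g : fpath F v w) :
  homotopic (pcat (preverse f) (pcat f g)) g.
Proof. by have := pcatKV (preverse f) g; rewrite preverseK. Qed.

End Groupoid.

(** * Elementary generators and words *)

Section Segments.
Context {R : realType}.
Implicit Types (F : set R[i]) (u v w : R[i]).

Lemma Re_segment u v (s : R) :
  complex.Re (segment u v s) = complex.Re u + s * (complex.Re v - complex.Re u).
Proof. by case: u => a b; case: v => c d; rewrite /segment; simpc. Qed.

Lemma Im_segment u v (s : R) :
  complex.Im (segment u v s) = complex.Im u + s * (complex.Im v - complex.Im u).
Proof. by case: u => a b; case: v => c d; rewrite /segment; simpc. Qed.

Lemma segment1 u v : @segment R u v 1 = v.
Proof. by rewrite /segment mul1r addrC subrK. Qed.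

Lemma segment0 u v : @segment R u v 0 = u.
Proof. by rewrite /segment mul0r addr0. Qed.

Lemma complex_inj (z z' : R[i]) :
  complex.Re z = complex.Re z' -> complex.Im z = complex.Im z' -> z = z'.
Proof. by case: z => a b; case: z' => c d /= -> ->. Qed.

Lemma segment_segment u v (a b s : R) :
  segment (segment u v a) (segment u v b) s = segment u v (a + s * (b - a)).
Proof.
by apply: complex_inj; rewrite !(Re_segment, Im_segment); ring.
Qed.

(** The middle vertex of a broken line slides from [u] to [v]; both swept triangles lie in [F]. *)
Lemma segment_slide F a c u v
  (h1 : forall s, s \in `[0, 1] -> F (segment a u s))
  (h2 : forall s, s \in `[0, 1] -> F (segment u c s))
  (h3 : forall s, s \in `[0, 1] -> F (segment a v s))
  (h4 : forall s, s \in `[0, 1] -> F (segment v c s)) :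
  (forall t s, t \in `[0, 1] -> s \in `[0, 1] -> F (segment a (segment u v t) s)) ->
  (forall t s, t \in `[0, 1] -> s \in `[0, 1] -> F (segment (segment u v t) c s)) ->
  homotopic (pcat (pseg h1) (pseg h2)) (pcat (pseg h3) (pseg h4)).
Proof.
move=> Fa Fc.
exists (fun z => path_cat (segment a (segment u v z.1)) (segment (segment u v z.1) c) z.2).
have sv : continuous (fun z : R * R => segment u v z.1).
  by apply: (cts_comp (@segment_continuous R u v)); cts.
split => /=.
- apply: continuous_if; first by cts.
  + by rewrite {1}/segment; cts.
  + by rewrite {1}/segment; cts.
  by move=> z ->; rewrite divff ?pnatr_eq0 // subrr segment1 segment0.
- move=> t s t01 s01; rewrite /path_cat; case: ifP => s2.
    by apply: Fa => //; exact: half_itvl.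
  by apply: Fc => //; exact: half_itvr.
- move=> t t01; rewrite /path_cat invr_ge0 ler0n mulr0 segment0; split=> //.
  rewrite ifF; last by lra.
  by rewrite (_ : 2 * 1 - 1 = 1) ?segment1 //; lra.
- by move=> s s01; rewrite segment0 segment1.
Qed.

End Segments.

Section Generation.
Context {R : realType} {n : nat} (h : 'I_n -> R) (y0 : R[i]) (r : R).
Hypothesis h_incr : forall i j : 'I_n, (i < j)%N -> h i < h j.
Hypothesis y0_gt0 : 0 < complex.Im y0.
Hypothesis r_gt0 : 0 < r.
Hypothesis r_sep : forall i j, i != j -> 2 * r < `|h i - h j|.

Definition punctured : set R[i] := [set y | forall k, y <> (h k)%:C].
Local Notation F := punctured.

Lemma punctured_off (e : R) y : 0 < e * complex.Im y -> F y.
Proof. by move=> y_gt0 k yE; move: y_gt0; rewrite yE /= mulr0 ltxx. Qed.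

(** The sign [e], taken to be 1 or -1, designates the upper or the lower half plane. A segment
    starting strictly inside it can touch the real axis only at its end [v]. *)
Lemma segment_off (e : R) (u v : R[i]) : 0 < e * complex.Im u ->
  0 <= e * complex.Im v -> F v -> forall s, s \in `[0, 1] -> F (segment u v s).
Proof.
move=> u_gt0 v_ge0 Fv s; rewrite in_itv /= => /andP[s0].
rewrite le_eqVlt => /predU1P[->|s1]; first by rewrite segment1.
by apply: (@punctured_off e); rewrite Im_segment; nra.
Qed.

Lemma segment_off_rev (e : R) (u v : R[i]) : 0 < e * complex.Im v ->
  0 <= e * complex.Im u -> F u -> forall s, s \in `[0, 1] -> F (segment u v s).
Proof.
move=> v_gt0 u_ge0 Fu s; rewrite in_itv /= => /andP[].
rewrite le_eqVlt => /predU1P[<-|s0 s1]; first by rewrite segment0.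
by apply: (@punctured_off e); rewrite Im_segment; nra.
Qed.

Definition low : R[i] := - 'i%C.

Definition off (q : R) := forall k, q <> h k.

Lemma off_in q : off q -> F q%:C.
Proof. by move=> oq k [qk]; apply: (oq k). Qed.

Lemma vert1 q : off q -> forall s, s \in `[0, 1] -> F (segment y0 q%:C s).
Proof. by move=> oq; apply: (@segment_off 1); rewrite ?mul1r ?mulr0 //; exact: off_in. Qed.

Lemma vert2 q : off q -> forall s, s \in `[0, 1] -> F (segment q%:C low s).
Proof.
move=> oq; apply: (@segment_off_rev (-1)); rewrite ?mulr0 //=; last exact: off_in.
Qed.

(* From y0 straight down through the gap of the punctures containing q, to a
   second base point in the lower half plane.  The loop alpha_k is homotopic to
   vert q, followed by the reverse of vert q', for q and q' on either side of
   the puncture h k, so the alpha_k generate once the vertical paths do. *)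
Definition vert q (oq : off q) : fpath F y0 low := pcat (pseg (vert1 oq)) (pseg (vert2 oq)).

Lemma segment_real (q q' t : R) : segment q%:C q'%:C t = (q + t * (q' - q))%:C.
Proof. by rewrite /segment -rmorphB -rmorphM -rmorphD. Qed.

(** The crossing point slides from [q] to [q'] along the real axis and meets no puncture, since each
    puncture is on the same side of both. *)
Lemma vert_gap q q' (oq : off q) (oq' : off q') :
  (forall k, (h k < q) = (h k < q')) -> homotopic (vert oq) (vert oq').
Proof.
move=> qq'; have ot t : t \in `[0, 1] -> off (q + t * (q' - q)).
  rewrite in_itv /= => /andP[t0]; rewrite le_eqVlt => /predU1P[->|t1] k kE.
    by apply: (oq' k); rewrite -kE; ring.
  have := qq' k.
  have /eqP : h k <> q by move=> e; exact: (oq k).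
  have /eqP : h k <> q' by move=> e; exact: (oq' k).
  rewrite !neq_lt => /orP[] c1 /orP[] c2; rewrite ?c1 ?c2 ?(lt_gtF c1) ?(lt_gtF c2) // => _.
    have : 0 < (1 - t) * (q - h k) by rewrite mulr_gt0 ?subr_gt0.
    have : 0 <= t * (q' - h k) by rewrite mulr_ge0 ?subr_ge0 // ltW.
    lra.
  have : 0 < (1 - t) * (h k - q) by rewrite mulr_gt0 ?subr_gt0.
  have : 0 <= t * (h k - q') by rewrite mulr_ge0 ?subr_ge0 // ltW.
  lra.
by apply: segment_slide => t s t01 s01; rewrite segment_real;
  [apply: vert1|apply: vert2] => //; exact: ot.
Qed.


(** For [e] = 1 or -1, an open half plane with an open interval of its boundary attached. It is
    convex, and free of punctures as soon as the interval is; the homotopies around a single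
    puncture take place in such sets. *)
Definition half (e lo hi : R) : set R[i] :=
  [set y | 0 < e * complex.Im y \/ complex.Im y = 0 /\ lo < complex.Re y < hi].

Lemma half_sub e lo hi : (forall k, h k <= lo \/ hi <= h k) -> half e lo hi `<=` F.
Proof.
move=> lohi y [/punctured_off //|[_ /andP[ly yh]]] k yE; move: ly yh; rewrite yE /=.
by case: (lohi k); lra.
Qed.

Lemma half_convex e lo hi a b t : half e lo hi a -> half e lo hi b ->
  t \in `[0, 1] -> half e lo hi (segment a b t).
Proof.
rewrite /half /= Re_segment Im_segment => ha hb; rewrite in_itv /= => /andP[].
rewrite le_eqVlt => /predU1P[<-|t0]; first by rewrite !mul0r !addr0.
rewrite le_eqVlt => /predU1P[->|t1]; first by rewrite !mul1r ![_ + (_ - _)]addrC !subrK.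
case: ha => [a0|[a0 /andP[la ah]]]; case: hb => [b0|[b0 /andP[lb bh]]].
- by left; nra.
- by left; rewrite b0; nra.
- by left; rewrite a0; nra.
- by right; rewrite a0 b0; split; [ring|apply/andP; split; nra].
Qed.

Definition psub (g : R -> R[i]) (cg : continuous g) (a b : R) u v :
  (forall s, F (g s)) -> g a = u -> g b = v -> fpath F u v.
Proof.
move=> Fg ga gb; apply: (@FPath _ F u v (fun s => g (a + (b - a) * s))).
- by apply: (cts_comp cg); cts.
- by move=> s _; exact: Fg.
- by rewrite mulr0 addr0.
- by rewrite mulr1 addrC subrK.
Defined.

Section Lasso.
Variable k : 'I_n.
Let z : R[i] := (h k)%:C.
Let d := r%:C * ((y0 - z) / `|y0 - z|).

Definition arc (phi : R) : R[i] := (h k + r * cos phi) +i* (r * sin phi).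

Lemma arc_in phi : F (arc phi).
Proof.
move=> j [re /eqP]; rewrite mulf_eq0 gt_eqF //= => /eqP s0.
have := cos2Dsin2 phi; rewrite s0 expr0n addr0 => /eqP; rewrite sqrf_eq1.
have [jk c1|jk c1] := eqVneq j k.
  by case/orP: c1 => /eqP c1; move: re; rewrite c1 jk; have := r_gt0; lra.
have := r_sep jk; have := r_gt0; rewrite -re.
by case/orP: c1 => /eqP ->; rewrite mulr1 || rewrite mulrN1;
   rewrite addrC addKr ?normrN gtr0_norm //; lra.
Qed.

(** The circle of a lasso starts in the direction of the base point. That angle [th] is strictly
    between 0 and pi because the base point is above the axis; counting angles from the real
    direction makes the real points of the circle explicit. *)
Lemma circle_arc : exists2 th : R, 0 < th < pi & forall s, circle z d s = arc (th + 2 * pi * s).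
Proof.
have y0E : y0 = complex.Re y0 +i* complex.Im y0 by case: (y0).
pose B := complex.Im y0; pose A := complex.Re y0 - h k; pose rho := Num.sqrt (A ^+ 2 + B ^+ 2).
have rho2 : rho ^+ 2 = A ^+ 2 + B ^+ 2 by rewrite sqr_sqrtr // addr_ge0 ?sqr_ge0.
have rho0 : 0 < rho by rewrite sqrtr_gt0 ltr_wpDl ?sqr_ge0 ?exprn_gt0.
have dE : d = (r * (A / rho)) +i* (r * (B / rho)).
  rewrite /d (_ : y0 - z = A +i* B); last by rewrite y0E /z /B /A; simpc.
  rewrite normc_def /= -/rho -[rho%:C^-1]fmorphV /=.
  by simpc.
have A1 : -1 < A / rho < 1.
  rewrite ltr_pdivlMr // ltr_pdivrMr // mulN1r mul1r.
  have : 0 < B ^+ 2 by rewrite exprn_gt0.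
  by move: rho2 rho0; clearbody rho A B => ? ? ?; apply/andP; split; nra.
have [A1l A1r] := andP A1.
exists (acos (A / rho)); first by apply/andP; split;
  [apply: acos_gt0; rewrite A1r ltW|apply: acos_ltpi; rewrite A1l ltW].
have cosE : cos (acos (A / rho)) = A / rho by rewrite acosK // in_itv /= !ltW.
have sinE : sin (acos (A / rho)) = B / rho.
  rewrite sin_acos ?ltW // -[RHS]ger0_norm ?divr_ge0 1?ltW // -sqrtr_sqr.
  congr (Num.sqrt _); rewrite !exprMn !exprVn.
  rewrite (_ : B ^+ 2 = rho ^+ 2 - A ^+ 2); last by rewrite rho2; ring.
  by field; rewrite gt_eqF.
move=> s; rewrite /circle /arc dE cosD sinD cosE sinE /z; simpc.
by congr (_ +i* _); ring.
Qed.


Lemma circle_start : circle z d 0 = z + d.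
Proof. by rewrite /circle mulr0 cos0 sin0 (_ : 1 +i* 0 = 1) // mulr1. Qed.

Lemma circle_end : circle z d 1 = z + d.
Proof. by rewrite /circle mulr1 mulr_natl cos2pi sin2pi (_ : 1 +i* 0 = 1) // mulr1. Qed.

Lemma Im_start : 0 < 1 * complex.Im (z + d).
Proof.
have [th /andP[th0 thpi] cE] := circle_arc.
rewrite -circle_start cE mulr0 addr0 /= mul1r mulr_gt0 // sin_gt0_pi //.
by rewrite th0.
Qed.

Lemma Im_base : 0 < 1 * complex.Im y0. Proof. by rewrite mul1r. Qed.

Lemma lasso_continuous : continuous (lasso y0 z r).
Proof.
apply: path_cat_continuous; [apply: path_cat_continuous|exact: segment_continuous|].
- exact: segment_continuous.
- exact: circle_continuous.
- by rewrite segment1 circle_start.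
rewrite segment0 /path_cat ifF; last by lra.
by rewrite (_ : 2 * 1 - 1 = 1) ?circle_end //; lra.
Qed.

Lemma lasso_in s : s \in `[0, 1] -> F (lasso y0 z r s).
Proof.
move=> s01; rewrite /lasso -/d /path_cat; case: ifP => s2.
  have := half_itvl s01 s2; move: (2 * s) => {s2 s01}s s01; case: ifP => s2.
    by apply: (segment_off Im_base (ltW Im_start)) (half_itvl s01 s2); exact: punctured_off Im_start.
  by have [th _ ->] := circle_arc; exact: arc_in.
by apply: (segment_off Im_start (ltW Im_base)) (half_itvr s01 s2); exact: punctured_off Im_base.
Qed.

Lemma lasso0 : lasso y0 z r 0 = y0.
Proof. by rewrite /lasso /path_cat !invr_ge0 !ler0n mulr0 invr_ge0 ler0n mulr0 segment0. Qed.

Lemma lasso1 : lasso y0 z r 1 = y0.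
Proof.
rewrite /lasso /path_cat ifF; last by lra.
by rewrite (_ : 2 * 1 - 1 = 1) ?segment1 //; lra.
Qed.

Definition alpha_path : fpath F y0 y0 :=
  FPath lasso_continuous lasso_in lasso0 lasso1.

Lemma pcat_in (W : set R[i]) u v w (f : fpath F u v) (g : fpath F v w) :
  (forall s, s \in `[0, 1] -> W (f s)) -> (forall s, s \in `[0, 1] -> W (g s)) ->
  forall s, s \in `[0, 1] -> W (pcat f g s).
Proof.
move=> Wf Wg s s01; rewrite /= /path_cat; case: ifP => s2.
  by apply: Wf; exact: half_itvl.
by apply: Wg; exact: half_itvr.
Qed.

Lemma arc_upper_left phi : 0 < phi <= pi -> half 1 (h k - 2 * r) (h k) (arc phi).
Proof.
rewrite /half /= mul1r le_eqVlt => /andP[phi0 /predU1P[->|phi1]]; [right|left].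
  by rewrite sinpi cospi mulr0; split=> //; have := r_gt0; lra.
by rewrite mulr_gt0 // sin_gt0_pi // phi0.
Qed.

Lemma arc_upper_right phi : 0 <= phi < pi -> half 1 (h k) (h k + 2 * r) (arc phi).
Proof.
rewrite /half /= mul1r le_eqVlt => /andP[/predU1P[<-|phi0] phi1]; [right|left].
  by rewrite sin0 cos0 mulr0; split=> //; have := r_gt0; lra.
by rewrite mulr_gt0 // sin_gt0_pi // phi0.
Qed.

Lemma arc_lower_left phi : 0 <= phi < pi -> half (-1) (h k - 2 * r) (h k) (arc (phi + pi)).
Proof.
rewrite /half /= sinDpi cosDpi mulN1r mulrN opprK.
rewrite le_eqVlt => /andP[/predU1P[<-|phi0] phi1]; [right|left].
  by rewrite sin0 cos0 mulr0 oppr0; split=> //; have := r_gt0; lra.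
by rewrite mulr_gt0 // sin_gt0_pi // phi0.
Qed.

Lemma arc_lower_right phi : 0 < phi <= pi -> half (-1) (h k) (h k + 2 * r) (arc (phi + pi)).
Proof.
rewrite /half /= sinDpi cosDpi mulN1r mulrN opprK.
rewrite le_eqVlt => /andP[phi0 /predU1P[->|phi1]]; [right|left].
  by rewrite sinpi cospi mulr0 oppr0; split=> //; have := r_gt0; lra.
by rewrite mulr_gt0 // sin_gt0_pi // phi0.
Qed.

Lemma gap_left e : half e (h k - 2 * r) (h k) `<=` F.
Proof.
apply: half_sub => j; have [->|/r_sep jk] := eqVneq j k; first by right.
by move: jk; case: (leP (h k) (h j)) => ? jk; [right|left; rewrite ltr0_norm in jk]; lra.
Qed.

Lemma gap_right e : half e (h k) (h k + 2 * r) `<=` F.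
Proof.
apply: half_sub => j; have [->|/r_sep jk] := eqVneq j k; first by left.
by move: jk; case: (leP (h j) (h k)) => ? jk; [left|right; rewrite gtr0_norm in jk]; lra.
Qed.

(** The circle is cut at its leftmost, lowest and rightmost points. Each of the four arcs lies in a
    convex set [half] on one side of the puncture, where it is straightened into pieces of [vert].
    The detour [M] from [low] to the lowest point is inserted on the left and cancels with its
    reverse on the right. *)
Lemma alpha_path_vert (ol : off (h k - r)) (or : off (h k + r)) :
  homotopic alpha_path (pcat (vert ol) (preverse (vert or))).
Proof.
have [th /andP[th0 thpi] cE] := circle_arc.
have pi0 : 0 < pi :> R := pi_gt0 R.
have Fc s : F (circle z d s) by rewrite cE; exact: arc_in.
have cc := @circle_continuous R z d.
have circle0 := circle_start; have circle1 := circle_end.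
(* Times at which the angle is pi, 3 pi / 2 and 2 pi. *)
pose s1 := (pi - th) / (2 * pi); pose s2 := (3 / 2 * pi - th) / (2 * pi).
pose s3 := 1 - th / (2 * pi).
have pin0 : pi != 0 :> R by rewrite gt_eqF.
have aux (P t x : R) : P != 0 -> t + 2 * P * ((x - t) / (2 * P)) = x by move=> ?; field.
have e1 : th + 2 * pi * s1 = pi by rewrite aux.
have e2 : th + 2 * pi * s2 = pi + pi / 2 by rewrite aux //; lra.
have e3 : th + 2 * pi * s3 = pi + pi.
  rewrite (_ : s3 = (2 * pi - th) / (2 * pi)); first by rewrite aux // mulr_natl mulr2n.
  by rewrite /s3 mulrBl divff // mulf_neq0 // pnatr_eq0.
have auxi (P x : R) : 0 < P -> 0 <= x <= 2 * P -> x / (2 * P) \in `[0, 1].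
  by move=> P0 ?; rewrite in_itv /= ler_pdivrMr ?ler_pdivlMr ?mulr_gt0 // mul0r mul1r.
have s01 : s1 \in `[0, 1] by apply: auxi => //; lra.
have s02 : s2 \in `[0, 1] by apply: auxi => //; lra.
have s03 : s3 \in `[0, 1].
  have : th / (2 * pi) \in `[0, 1] by apply: auxi => //; lra.
  by rewrite !in_itv /=; rewrite /s3; lra.
have c1 : circle z d s1 = (h k - r)%:C.
  by rewrite cE e1 /arc cospi sinpi mulr0 mulrN1.
have c3 : circle z d s3 = (h k + r)%:C.
  by rewrite cE e3 /arc cosDpi sinDpi cospi sinpi opprK oppr0 mulr0 mulr1.
pose m := circle z d s2.
have mE : m = h k -i* r.
  rewrite /m cE e2 /arc [pi + _]addrC cosDpi sinDpi cos_pihalf sin_pihalf oppr0 mulr0 addr0.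
  by rewrite mulrN1.
pose a1 := @psub _ cc 0 s1 _ _ Fc circle0 c1.
pose a2 := @psub _ cc s1 s2 _ _ Fc c1 (erefl m).
pose a3 := @psub _ cc s2 s3 _ _ Fc (erefl m) c3.
pose a4 := @psub _ cc s3 1 _ _ Fc c3 circle1.
pose C := @psub _ cc 0 1 _ _ Fc circle0 circle1.
have HC : homotopic C (pcat a1 (pcat a2 (pcat a3 a4))).
  have i0 : (0 : R) \in `[0, 1] by rewrite in_itv /= lexx ler01.
  have i1 : (1 : R) \in `[0, 1] by rewrite in_itv /= lexx ler01.
  have base a b u v (ga : circle z d a = u) (gb : circle z d b = v) s :
      s \in `[0, 1] -> @psub _ cc a b _ _ Fc ga gb s = C (a + (b - a) * s).
    by move=> _ /=; rewrite add0r subr0 mul1r.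
  have h1 : homotopic C (pcat a1 (@psub _ cc s1 1 _ _ Fc c1 circle1)).
    by apply: (@homotopic_subdivide _ _ _ _ _ _ _ C 0 s1 1) => //; exact: base.
  have h2 : homotopic (@psub _ cc s1 1 _ _ Fc c1 circle1)
      (pcat a2 (@psub _ cc s2 1 _ _ Fc (erefl m) circle1)).
    by apply: (@homotopic_subdivide _ _ _ _ _ _ _ C s1 s2 1) => //; exact: base.
  have h3 : homotopic (@psub _ cc s2 1 _ _ Fc (erefl m) circle1) (pcat a3 a4).
    by apply: (@homotopic_subdivide _ _ _ _ _ _ _ C s2 s3 1) => //; exact: base.
  by rewrite h1 h2 h3.
have Im_d := Im_start; have y0d := Im_base.
pose S := pseg (segment_off y0d (ltW Im_d) (punctured_off Im_d)).
pose S' := pseg (segment_off Im_d (ltW y0d) (punctured_off y0d)).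
have HA : homotopic alpha_path (pcat (pcat S C) S').
  apply: homotopic_ext => s _ /=.
  rewrite (_ : (fun t => circle z d (0 + (1 - 0) * t)) = circle z d).
    by [].
  by apply/funext => t; rewrite add0r subr0 mul1r.
have mlow : 0 < -1 * complex.Im m by rewrite mE /= mulN1r opprK.
have lowlow : 0 < -1 * complex.Im low by rewrite /= mulN1r opprK.
pose M := pseg (segment_off lowlow (ltW mlow) (punctured_off mlow)).
have half_seg e lo hi u v s : half e lo hi u -> half e lo hi v -> s \in `[0, 1] ->
  half e lo hi (segment u v s) by exact: half_convex.
have dE : z + d = arc th by rewrite -circle0 cE mulr0 addr0.
have arcE a b s : circle z d (a + (b - a) * s) =
    arc ((th + 2 * pi * a) + ((th + 2 * pi * b) - (th + 2 * pi * a)) * s).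
  by rewrite cE; congr arc; ring.
have e0 : th + 2 * pi * 0 = th by rewrite mulr0 addr0.
have e4 : th + 2 * pi * 1 = th + pi + pi by rewrite mulr1 mulr_natl mulr2n addrA.
have hq e lo hi q : lo < q < hi -> half e lo hi q%:C by right.
have r0 := r_gt0.
have qlr : h k - 2 * r < h k - r < h k by lra.
have qrr : h k < h k + r < h k + 2 * r by lra.
have HS1 : homotopic (pcat S a1) (pseg (vert1 ol)).
  apply: (homotopic_convex (@gap_left 1) (@half_convex _ _ _)).
    apply: pcat_in => s si; first by apply: half_seg => //; left.
    by rewrite /= arcE e0 e1; apply: arc_upper_left; move: si; rewrite in_itv /= => /andP[??]; nra.
  by move=> s si; apply: half_seg => //; [left|exact: hq].
have HS4 : homotopic (pcat a4 S') (preverse (pseg (vert1 or))).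
  apply: (homotopic_convex (@gap_right 1) (@half_convex _ _ _)).
    apply: pcat_in => s si; last by apply: half_seg => //; left.
    rewrite /= arcE e3 e4 [X in arc X](_ : _ = th * s + pi + pi); last by ring.
    rewrite /arc cosDpi sinDpi cosDpi sinDpi !opprK; apply: arc_upper_right.
    by move: si; rewrite in_itv /= => /andP[??]; nra.
  move=> s si; apply: half_seg => //; [by left|exact: hq|].
  by move: si; rewrite !in_itv /=; lra.
have HS2 : homotopic a2 (pcat (pseg (vert2 ol)) M).
  apply: (homotopic_convex (@gap_left (-1)) (@half_convex _ _ _)).
    move=> s si; rewrite /= arcE e1 e2 [X in arc X](_ : _ = pi / 2 * s + pi); last by ring.
    by apply: arc_lower_left; move: si; rewrite in_itv /= => /andP[??]; nra.
  apply: pcat_in => s si; apply: half_seg => //; by [left|exact: hq].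
have HS3 : homotopic a3 (pcat (preverse M) (preverse (pseg (vert2 or)))).
  apply: (homotopic_convex (@gap_right (-1)) (@half_convex _ _ _)).
    move=> s si; rewrite /= arcE e2 e3 [X in arc X](_ : _ = (pi / 2 + pi / 2 * s) + pi); last by field.
    by apply: arc_lower_right; move: si; rewrite in_itv /= => /andP[??]; nra.
  apply: pcat_in => s si; (apply: half_seg; [by [left|exact: hq]|by [left|exact: hq]|]);
    by move: si; rewrite !in_itv /=; lra.
rewrite HA HC HS2 HS3 /vert preverse_cat.
rewrite !pcatA HS4 -(pcatA S a1) HS1 pcatKV.
by [].
Qed.

End Lasso.

End Generation.

(** * Every loop of the punctured plane is a word *)

Section Words.
Context {R : realType} {n : nat} (h : 'I_n -> R) (y0 : R[i]) (r : R).
Hypothesis h_incr : forall i j : 'I_n, (i < j)%N -> h i < h j.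
Hypothesis y0_gt0 : 0 < complex.Im y0.
Hypothesis r_gt0 : 0 < r.
Hypothesis r_sep : forall i j, i != j -> 2 * r < `|h i - h j|.

Local Notation F := (punctured h).
Local Notation alpha k := (alpha_path y0_gt0 r_gt0 r_sep k).
Local Notation V oq := (vert y0_gt0 oq).

Definition letter_path (l : @letter n) : fpath F y0 y0 :=
  if l.2 then alpha l.1 else preverse (alpha l.1).

Lemma base_in : F y0. Proof. exact: punctured_off (Im_base y0_gt0). Qed.

Fixpoint word_path (w : seq (@letter n)) : fpath F y0 y0 :=
  if w is l :: w' then pcat (letter_path l) (word_path w') else pcst base_in.

Lemma word_path_cat w1 w2 :
  homotopic (word_path (w1 ++ w2)) (pcat (word_path w1) (word_path w2)).
Proof.
elim: w1 => [|l w1 IH] /=; first by rewrite pcat1p.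
by rewrite IH pcatA.
Qed.

Definition wordy (f : fpath F y0 y0) := exists w, homotopic f (word_path w).

Lemma wordy_homotopic f g : homotopic f g -> wordy g -> wordy f.
Proof. by move=> fg [w gw]; exists w; rewrite fg. Qed.

Lemma wordy_cat f g : wordy f -> wordy g -> wordy (pcat f g).
Proof. by move=> [w fw] [w' gw]; exists (w ++ w'); rewrite word_path_cat fw gw. Qed.

Lemma wordy_letter l : wordy (letter_path l).
Proof. by exists [:: l]; rewrite /= pcatp1. Qed.

Lemma wordy_cst (Fy : F y0) : wordy (pcst Fy).
Proof. by exists [::]; apply: homotopic_ext. Qed.

Lemma off_left k : off h (h k - r).
Proof.
move=> j e; have [jk|/r_sep] := eqVneq j k; first by move: e; rewrite jk; move: r_gt0; lra.
by rewrite -e [_ - h k]addrC addrA addNr add0r normrN gtr0_norm //; move: r_gt0; lra.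
Qed.

Lemma off_right k : off h (h k + r).
Proof.
move=> j e; have [jk|/r_sep] := eqVneq j k; first by move: e; rewrite jk; move: r_gt0; lra.
by rewrite -e addrC addrA addNr add0r gtr0_norm //; move: r_gt0; lra.
Qed.

Lemma lt_left (j k : 'I_n) : (h j < h k - r) = (j < k)%N.
Proof.
have r0 := r_gt0; case: (ltngtP j k) => [jk|kj|/val_inj->]; last by lra.
  have := h_incr jk; have : j != k by rewrite neq_ltn jk.
  by move=> /r_sep + jk'; rewrite ltr0_norm; lra.
by have := h_incr kj; lra.
Qed.

Lemma lt_right (j k : 'I_n) : (h j < h k + r) = (j <= k)%N.
Proof.
have r0 := r_gt0; case: (ltngtP j k) => [jk|kj|/val_inj->]; last by lra.
  by have := h_incr jk; lra.
have := h_incr kj; have : j != k by rewrite neq_ltn kj orbT.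
by move=> /r_sep + jk'; rewrite gtr0_norm; lra.
Qed.

(** Induction on the number of punctures to the left of [q]: crossing the rightmost of them changes
    [V oq] by one letter, by [alpha_path_vert]. When none is left, [q] and [q0] lie in the same
    gap. *)
Lemma wordy_vert q0 (o0 : off h q0) : (forall k, q0 < h k) ->
  forall q (oq : off h q),
  wordy (pcat (V o0) (preverse (V oq))) /\ wordy (pcat (V oq) (preverse (V o0))).
Proof.
move=> q0h q oq; move: {2}#|_| (leqnn #|[pred k | h k < q]|) => m.
elim: m q oq => [|m IH] q oq cq.
  have Vq : homotopic (V oq) (V o0).
    apply: vert_gap => k; rewrite [RHS]ltNge (ltW (q0h k)) /=.
    by apply/negbTE/negP => kq; move: cq; rewrite leqNgt => /negP; apply; apply/card_gt0P; exists k.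
  by split; apply: (wordy_homotopic _ (wordy_cst base_in)); rewrite Vq pcatV.
case: (pickP (fun k => h k < q)) => [k0 k0q|qh]; last first.
  by apply: IH; rewrite (eq_card (B := pred0)) ?card0 // => k; rewrite !inE qh.
case: (arg_maxnP (P := fun k => h k < q) (fun k : 'I_n => k : nat) k0q) => k kq kmax.
have Vr : homotopic (V oq) (V (@off_right k)).
  apply: vert_gap => j; rewrite lt_right; apply/idP/idP; first exact: kmax.
  rewrite leq_eqVlt => /predU1P[/val_inj-> //|/h_incr jk]; exact: lt_trans kq.
have [|w1 w2] := IH _ (@off_left k).
  rewrite -ltnS; apply: leq_trans cq; apply: proper_card; apply/properP; split.
    apply/fintype.subsetP => j; rewrite !inE lt_left => /h_incr jk; exact: lt_trans kq.
  by exists k; rewrite !inE ?lt_left ?ltnn.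
have A := alpha_path_vert y0_gt0 r_gt0 r_sep (@off_left k) (@off_right k).
split.
  apply: (wordy_homotopic _ (wordy_cat w1 (wordy_letter (k, true)))).
  by rewrite /letter_path /= A Vr pcatA pcatVK.
apply: (wordy_homotopic _ (wordy_cat (wordy_letter (k, false)) w2)).
by rewrite /letter_path /= A Vr preverse_cat preverseK pcatA pcatVK.
Qed.


(** A triangle with its apex in an open half plane and its base in the closed one meets the real
    axis at most along the base, which avoids the punctures. *)
Lemma segment_triangle (e : R) (a y y' : R[i])
    (hy : forall s, s \in `[0, 1] -> F (segment a y s))
    (hs : forall s, s \in `[0, 1] -> F (segment y y' s))
    (hy' : forall s, s \in `[0, 1] -> F (segment a y' s)) :
  0 < e * complex.Im a -> 0 <= e * complex.Im y -> 0 <= e * complex.Im y' ->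
  homotopic (pcat (pseg hy) (pseg hs)) (pseg hy').
Proof.
move=> a0 ye y'e.
have Fy' : F y' by rewrite -(segment1 y y'); apply: hs; rewrite in_itv /= ler01 lexx.
have hc s : s \in `[0, 1] -> F (segment y' y' s) by rewrite /segment subrr mulr0 addr0.
have -> : homotopic (pcat (pseg hy) (pseg hs)) (pcat (pseg hy') (pseg hc)).
  apply: segment_slide => t s t01 s01.
    apply: (segment_off a0) => //; last exact: hs.
    by rewrite Im_segment; move: t01; rewrite in_itv /= => /andP[? ?]; nra.
  rewrite -{2}(segment1 y y') segment_segment; apply: hs.
  by move: t01 s01; rewrite !in_itv /= => /andP[? ?] /andP[? ?]; apply/andP; split; nra.
have -> : homotopic (pseg hc) (pcst Fy').
  by apply: homotopic_ext => s _; rewrite /= /segment subrr mulr0 addr0.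
by rewrite pcatp1.
Qed.

Lemma segment_split (y y' q : R[i]) (t : R)
    (hs : forall s, s \in `[0, 1] -> F (segment y y' s)) :
  t \in `[0, 1] -> q = segment y y' t ->
  exists h1 h2, homotopic (pseg hs) (pcat (@pseg _ F y q h1) (@pseg _ F q y' h2)).
Proof.
move=> t01 ->.
have h1 s : s \in `[0, 1] -> F (segment y (segment y y' t) s).
  move=> s01; rewrite -{1}(segment0 y y') segment_segment; apply: hs.
  by move: t01 s01; rewrite !in_itv /= => /andP[? ?] /andP[? ?]; apply/andP; split; nra.
have h2 s : s \in `[0, 1] -> F (segment (segment y y' t) y' s).
  move=> s01; rewrite -{2}(segment1 y y') segment_segment; apply: hs.
  by move: t01 s01; rewrite !in_itv /= => /andP[? ?] /andP[? ?]; apply/andP; split; nra.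
exists h1, h2; apply: (@homotopic_subdivide _ _ _ _ _ _ _ (pseg hs) 0 t 1) => //=.
- by rewrite in_itv /= lexx ler01.
- by rewrite in_itv /= lexx ler01.
- by move=> s _; congr segment; ring.
- by move=> s _; rewrite -{1}(segment0 y y') segment_segment; congr segment; ring.
- by move=> s _; rewrite -{2}(segment1 y y') segment_segment; congr segment; ring.
Qed.

Lemma real_crossing (y y' : R[i]) :
  complex.Im y * complex.Im y' <= 0 -> complex.Im y != complex.Im y' ->
  exists2 t, t \in `[0, 1] & exists q : R, q%:C = segment y y' t.
Proof.
set b := complex.Im y; set b' := complex.Im y' => bb' nb.
have nb0 : b - b' != 0 by rewrite subr_eq0.
exists (b / (b - b')).
  rewrite in_itv /=; move: nb; rewrite neq_lt => /orP[lb|lb].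
    have b0 : b <= 0 by rewrite leNgt; apply/negP => b0; nra.
    have b'0 : 0 <= b' by rewrite leNgt; apply/negP => b'0; nra.
    rewrite -[b - b']opprB invrN mulrN -mulNr ler_pdivrMr ?subr_gt0 //.
    by rewrite divr_ge0 ?subr_ge0 ?oppr_ge0 ?(ltW lb) //=; lra.
  have b0 : 0 <= b by rewrite leNgt; apply/negP => b0; nra.
  have b'0 : b' <= 0 by rewrite leNgt; apply/negP => b'0; nra.
  by rewrite ler_pdivrMr ?subr_gt0 // divr_ge0 ?subr_ge0 ?(ltW lb) //=; lra.
exists (complex.Re (segment y y' (b / (b - b')))).
apply: complex_inj => //=; rewrite Im_segment -/b -/b'.
by field.
Qed.

Section Generation.
Variables (q0 : R) (o0 : off h q0).
Hypothesis q0h : forall k, q0 < h k.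

(** A normal form for paths from [y0] to [y], playing the part of a spanning tree: straight when [y]
    is in the closed upper half plane, otherwise through the fixed gate [q0] to [low] and then
    straight. A path is [good] when it is a word followed by a normal form. *)
Definition canonical_path y (p : fpath F y0 y) : Prop :=
  (0 <= complex.Im y /\ exists hs, homotopic p (@pseg _ F y0 y hs)) \/
  (complex.Im y < 0 /\ exists hs, homotopic p (pcat (V o0) (@pseg _ F (@low R) y hs))).

Definition good y (p : fpath F y0 y) : Prop :=
  exists l p', [/\ wordy l, @canonical_path y p' & homotopic p (pcat l p')].

Lemma good_homotopic y (p p' : fpath F y0 y) : homotopic p p' -> good p' -> good p.
Proof. by move=> pp' [l [p'' [wl cp'' e]]]; exists l, p''; split=> //; rewrite pp'. Qed.

Lemma Im_low : 0 < -1 * complex.Im (@low R).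
Proof. by rewrite /= mulN1r opprK. Qed.

(** Within one half plane the new segment only closes a triangle. If it changes half plane it is cut
    at the point [q] where it crosses the axis, and the word gained compares the passages through
    [q] and through [q0]. *)
Lemma good_step y y' (p : fpath F y0 y)
    (hs : forall s, s \in `[0, 1] -> F (segment y y' s)) :
  good p -> good (pcat p (pseg hs)).
Proof.
move=> [l [p' [wl cp' e]]].
suff [l' [p'' [wl' cp'' e']]] : good (pcat p' (pseg hs)).
  exists (pcat l l'), p''; split=> //; first exact: wordy_cat.
  by rewrite e pcatA e' pcatA.
have bI := Im_base y0_gt0; have lI := Im_low.
have Fy : F y by rewrite -(fp1 p); apply: fp_in; rewrite in_itv /= ler01 lexx.
have Fy' : F y' by rewrite -(segment1 y y'); apply: hs; rewrite in_itv /= ler01 lexx.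
have up z : 0 <= complex.Im z -> F z -> forall s, s \in `[0, 1] -> F (segment y0 z s).
  by move=> z0; apply: (segment_off bI); rewrite mul1r.
have dn z : complex.Im z <= 0 -> F z -> forall s, s \in `[0, 1] -> F (segment (@low R) z s).
  by move=> z0; apply: (segment_off lI); rewrite mulN1r oppr_ge0.
have off_seg q t : t \in `[0, 1] -> q%:C = segment y y' t -> off h q.
  by move=> t01 qE k qk; apply: (hs _ t01 k); rewrite -qE qk.
have vert1E q (oq : off h q) (hu : forall s, s \in `[0, 1] -> F (segment y0 q%:C s)) :
    homotopic (pseg hu) (pseg (vert1 y0_gt0 oq)) by exact: homotopic_ext.
have vert2E q (oq : off h q) (hd : forall s, s \in `[0, 1] -> F (segment (@low R) q%:C s)) :
    homotopic (pseg (vert2 oq)) (preverse (pseg hd)).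
  apply: homotopic_ext => s _ /=; rewrite /path_rev.
  by apply: complex_inj; rewrite !(Re_segment, Im_segment); ring.
case: cp' => -[Iy [hy {}e]].
- have [Iy'|Iy'] := leP 0 (complex.Im y').
    exists (pcst base_in), (pseg (up _ Iy' Fy')); split; first exact: wordy_cst.
      by left; split=> //; exists (up _ Iy' Fy').
    by rewrite e pcat1p; apply: (@segment_triangle 1); rewrite ?mul1r.
  have [||t t01 [q qE]] := @real_crossing y y'.
  + by rewrite nmulr_lle0.
  + by rewrite gt_eqF // (lt_le_trans Iy').
  have oq := off_seg _ _ t01 qE.
  have [h1 [h2 E12]] := segment_split hs t01 qE.
  exists (pcat (V oq) (preverse (V o0))), (pcat (V o0) (pseg (dn _ (ltW Iy') Fy'))); split.
  + by have [] := @wordy_vert _ o0 q0h _ oq.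
  + by right; split=> //; exists (dn _ (ltW Iy') Fy').
  have hq : forall s, s \in `[0, 1] -> F (segment (@low R) q%:C s).
    by apply: dn => //; exact: off_in.
  have E1 : homotopic (pcat (pseg hy) (pseg h1)) (pseg (vert1 y0_gt0 oq)).
    by apply: (@segment_triangle 1); rewrite ?mul1r.
  have E2 : homotopic (pcat (pseg hq) (pseg h2)) (pseg (dn _ (ltW Iy') Fy')).
    by apply: (@segment_triangle (-1)) => //; rewrite mulN1r ?oppr0 // oppr_ge0 ltW.
  by rewrite e E12 -pcatA E1 (pcatA (V oq)) pcatVK -E2 /vert pcatA (vert2E _ _ hq) pcatVK.
have [Iy'|Iy'] := ltP (complex.Im y') 0.
  exists (pcst base_in), (pcat (V o0) (pseg (dn _ (ltW Iy') Fy'))); split; first exact: wordy_cst.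
    by right; split=> //; exists (dn _ (ltW Iy') Fy').
  have E : homotopic (pcat (pseg hy) (pseg hs)) (pseg (dn _ (ltW Iy') Fy')).
    by apply: (@segment_triangle (-1)) => //; rewrite mulN1r ?oppr0 // oppr_ge0 ltW.
  by rewrite e pcat1p pcatA E.
have [||t t01 [q qE]] := @real_crossing y y'.
- by rewrite nmulr_rle0.
- by rewrite lt_eqF // (lt_le_trans Iy).
have oq := off_seg _ _ t01 qE.
have [h1 [h2 E12]] := segment_split hs t01 qE.
exists (pcat (V o0) (preverse (V oq))), (pseg (up _ Iy' Fy')); split.
- by have [] := @wordy_vert _ o0 q0h _ oq.
- by left; split=> //; exists (up _ Iy' Fy').
have hq : forall s, s \in `[0, 1] -> F (segment (@low R) q%:C s).
  by apply: dn => //; exact: off_in.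
have E1 : homotopic (pcat (pseg hy) (pseg h1)) (pseg hq).
  by apply: (@segment_triangle (-1)) => //; rewrite mulN1r ?oppr0 // oppr_ge0 ltW.
have E2 : homotopic (pcat (pseg (vert1 y0_gt0 oq)) (pseg h2)) (pseg (up _ Iy' Fy')).
  by apply: (@segment_triangle 1); rewrite ?mul1r.
have E3 : homotopic (preverse (V oq)) (pcat (pseg hq) (preverse (pseg (vert1 y0_gt0 oq)))).
  by rewrite /vert preverse_cat (vert2E _ _ hq) preverseK.
by rewrite e E12 !pcatA E3 -E2 !pcatA pcatVK -(pcatA (pseg hy)) E1.
Qed.

End Generation.

End Words.

Section Generation.
Context {R : realType} {n : nat} (h : 'I_n -> R) (y0 : R[i]) (r : R).
Hypothesis h_incr : forall i j : 'I_n, (i < j)%N -> h i < h j.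
Hypothesis y0_gt0 : 0 < complex.Im y0.
Hypothesis r_gt0 : 0 < r.
Hypothesis r_sep : forall i j, i != j -> 2 * r < `|h i - h j|.

Local Notation F := (punctured h).

Lemma punctured_square c : F c -> exists2 e : R, 0 < e &
  forall y, `|complex.Re y - complex.Re c| < e -> `|complex.Im y - complex.Im c| < e -> F y.
Proof.
move=> Fc; have [k _|e e0 He] := @finite_lower_bound R 'I_n predT
    (fun k => `|complex.Re c - h k| + `|complex.Im c|).
  rewrite lt_neqAle addr_ge0 // andbT eq_sym; apply/negP.
  rewrite paddr_eq0 // !normr_eq0 subr_eq0 => /andP[/eqP re /eqP im].
  by apply: (Fc k); apply: complex_inj.
exists (e / 2); first by rewrite divr_gt0.
move=> y re im k yE; move: re im (He k isT); rewrite yE /= sub0r normrN distrC.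
by lra.
Qed.

Lemma norm_convex (e x y t : R) : 0 <= t -> t <= 1 -> `|x| < e -> `|y| < e ->
  `|x + t * (y - x)| < e.
Proof.
move=> t0; rewrite le_eqVlt => /predU1P[->|t1]; first by rewrite mul1r addrC subrK.
move=> xe ye; rewrite (_ : _ + _ = (1 - t) * x + t * y); last by ring.
apply: le_lt_trans (ler_normD _ _) _; rewrite !normrM (ger0_norm t0) gtr0_norm ?subr_gt0 //.
have : 0 < (1 - t) * (e - `|x|) by rewrite mulr_gt0 ?subr_gt0.
have : 0 <= t * (e - `|y|) by rewrite mulr_ge0 // subr_ge0 ltW.
by lra.
Qed.

Lemma generation (f : fpath F y0 y0) : wordy y0_gt0 r_gt0 r_sep f.
Proof.
have [q0 q0h] : exists q0, forall k, q0 < h k.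
  exists (- \sum_k `|h k| - 1) => k.
  have := ler_norm (- h k); rewrite normrN.
  have : `|h k| <= \sum_k `|h k| by rewrite (bigD1 k) //= lerDl sumr_ge0.
  by lra.
have o0 : off h q0 by move=> k e; have := q0h k; rewrite e ltxx.
pose W (U : set R) := exists C : set R[i], [/\ C `<=` F,
  forall a b t, C a -> C b -> t \in `[0, 1] -> C (segment a b t) &
  forall s, U s -> s \in `[0, 1] -> C (f s)].
have [||d d0 Hd] := @lebesgue_number R R [set` `[0, 1]] W (@segment_compact _ _ _).
- by move=> U U' UU' [C [CF Cc Cf]]; exists C; split=> // s /UU'; exact: Cf.
- move=> z z01; have [e e0 He] := punctured_square (fp_in f z01).
  have cre := cts_Re (fp_continuous f); have cim := cts_Im (fp_continuous f).
  have [d /= d0 Hd] : exists2 d : R, 0 < d & forall s, ball z d s ->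
      `|complex.Re (f s) - complex.Re (f z)| < e /\ `|complex.Im (f s) - complex.Im (f z)| < e.
    have : \forall s \near z, `|complex.Re (f s) - complex.Re (f z)| < e /\
                              `|complex.Im (f s) - complex.Im (f z)| < e.
      near=> s; split; rewrite distrC; near: s.
        exact: (@cvgr_dist_lt _ R^o _ _ _ _ _ (cre z)).
      exact: (@cvgr_dist_lt _ R^o _ _ _ _ _ (cim z)).
    by move=> /nbhs_ballP[d d0 Hd]; exists d => // s /Hd.
  exists d => //; exists [set y | `|complex.Re y - complex.Re (f z)| < e /\
                                  `|complex.Im y - complex.Im (f z)| < e]; split.
  + by move=> y [? ?]; exact: He.
  + move=> a b t [a1 a2] [b1 b2]; rewrite in_itv /= => /andP[t0 t1].
    rewrite /= Re_segment Im_segment; split.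
      rewrite (_ : _ - _ = complex.Re a - complex.Re (f z) +
        t * ((complex.Re b - complex.Re (f z)) - (complex.Re a - complex.Re (f z)))); last by ring.
      exact: norm_convex.
    rewrite (_ : _ - _ = complex.Im a - complex.Im (f z) +
        t * ((complex.Im b - complex.Im (f z)) - (complex.Im a - complex.Im (f z)))); last by ring.
    exact: norm_convex.
  + by move=> s /Hd.
have [N N0 HN] := small_inverse d0.
have {}HN := HN N (leqnn N).
have Nr0 : 0 < N%:R :> R by rewrite ltr0n.
have bnd j : (j <= N)%N -> (j%:R / N%:R : R) \in `[0, 1].
  move=> jN; rewrite in_itv /=; apply/andP; split; first by rewrite divr_ge0.
  by rewrite ler_pdivrMr // mul1r ler_nat.
(* The invariant is carried along the initial portions of [f]. At the end the normal form is the
   constant segment at [y0], so that only the word remains. *)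
suff H j : (j <= N)%N -> forall y (p : fpath F y0 y),
    (forall s, s \in `[0, 1] -> p s = f (j%:R / N%:R * s)) -> good y0_gt0 r_gt0 r_sep o0 p.
  have [l [p' [wl cp' e]]] : good y0_gt0 r_gt0 r_sep o0 f.
    by apply: (H N (leqnn N)) => s _; rewrite divff ?mul1r // gt_eqF.
  apply: (wordy_homotopic e); apply: (wordy_homotopic _ wl).
  case: cp' => -[]; last by rewrite ltNge (ltW y0_gt0).
  move=> _ [hs ->]; rewrite -[X in homotopic _ X](pcatp1 (base_in y0_gt0)).
  apply: pcat_proper; first by [].
  by apply: homotopic_ext => s _; rewrite /= /segment subrr mulr0 addr0.
elim: j => [|j IH] jN y p pE.
  have ey : y0 = y.
    by rewrite -(fp1 p) pE ?mul0r ?fp0 // in_itv /= ler01 lexx.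
  case: _ / ey p pE => p pE.
  have hs s : s \in `[0, 1] -> F (segment y0 y0 s).
    by move=> _; rewrite /segment subrr mulr0 addr0; exact: base_in.
  exists (pcst (base_in y0_gt0)), (pseg hs); split.
  - exact: wordy_cst.
  - by left; rewrite (ltW y0_gt0); split=> //; exists hs.
  rewrite pcat1p; apply: homotopic_ext => s s01; rewrite pE //= !mul0r fp0.
  by rewrite /segment subrr mulr0 addr0.
have jN' := ltnW jN.
have i1 : (1 : R) \in `[0, 1] by rewrite in_itv /= ler01 lexx.
have f1 : f (j.+1%:R / N%:R) = y by rewrite -(fp1 p) pE // mulr1.
have itvM a s : a \in `[0, 1] -> s \in `[0, 1] -> (a * s : R) \in `[0, 1].
  by rewrite !in_itv /= => /andP[? ?] /andP[? ?]; apply/andP; split; nra.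
pose a : R := j%:R / N%:R.
have jE : j.+1%:R / N%:R - a = N%:R^-1 by rewrite /a -mulrBl -natrB // subSnn mul1r.
have p1c : continuous (fun s => f (a * s)).
  by apply: (cts_comp (fp_continuous f)); cts.
have p1i s : s \in `[0, 1] -> F (f (a * s)).
  by move=> s01; apply: fp_in; apply: itvM => //; exact: bnd.
have p10 : f (a * 0) = y0 by rewrite mulr0 fp0.
have p11 : f (a * 1) = f a by rewrite mulr1.
pose p1 := @FPath R F y0 (f a) (fun s => f (a * s)) p1c p1i p10 p11.
have p2c : continuous (fun s => f (a + (j.+1%:R / N%:R - a) * s)).
  by apply: (cts_comp (fp_continuous f)); cts.
have p2b s : s \in `[0, 1] -> a + (j.+1%:R / N%:R - a) * s \in `[0, 1].
  move: (bnd _ jN') (bnd _ jN); rewrite -/a; move: (j.+1%:R / N%:R) => b.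
  by rewrite !in_itv /= => /andP[? ?] /andP[? ?] /andP[? ?]; apply/andP; split; nra.
have p2i s : s \in `[0, 1] -> F (f (a + (j.+1%:R / N%:R - a) * s)).
  by move=> s01; apply: fp_in; exact: p2b.
have p20 : f (a + (j.+1%:R / N%:R - a) * 0) = f a by rewrite mulr0 addr0.
have p21 : f (a + (j.+1%:R / N%:R - a) * 1) = y by rewrite mulr1 addrC subrK.
pose p2 := @FPath R F (f a) y _ p2c p2i p20 p21.
have pp : homotopic p (pcat p1 p2).
  apply: (@homotopic_subdivide _ _ _ _ _ _ _ f 0 a (j.+1%:R / N%:R)) => //.
  - by rewrite in_itv /= lexx ler01.
  - exact: bnd.
  - exact: bnd.
  - by move=> s s01; rewrite pE // add0r subr0.
  - by move=> s s01 /=; rewrite add0r subr0.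
have [C [CF Cc Cf]] := Hd a (bnd _ jN').
have p2C s : s \in `[0, 1] -> C (p2 s).
  move=> s01; apply: Cf; last exact: p2b.
  rewrite /ball /= opprD addrA subrr sub0r normrN jE.
  move: s01; rewrite in_itv /= => /andP[s0 s1].
  rewrite ger0_norm; last by rewrite mulr_ge0 // invr_ge0 ltW.
  by apply: le_lt_trans HN; rewrite ler_piMr // invr_ge0 ltW.
have i0 : (0 : R) \in `[0, 1] by rewrite in_itv /= ler01 lexx.
have Ca : C (f a) by rewrite -(fp0 p2); exact: p2C.
have Cy : C y by rewrite -(fp1 p2); exact: p2C.
have hs s : s \in `[0, 1] -> F (segment (f a) y s) by move=> s01; apply: CF; exact: Cc.
have p2s : homotopic p2 (pseg hs).
  by apply: (homotopic_convex CF Cc) => // s s01; exact: Cc.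
apply: (good_homotopic (p' := pcat p1 (pseg hs))); first by rewrite pp p2s.
by apply: (good_step h_incr) => //; exact: (IH jN').
Unshelve. all: by end_near. Qed.

End Generation.

(** * Moving punctures *)

Section Distance.
Context {R : realType}.
Implicit Types (y z : R[i]).

(** The l^1 norm, with values in [R]; the modulus of [R[i]] takes its values in [R[i]]. *)
Definition dist1 (y : R[i]) : R := `|complex.Re y| + `|complex.Im y|.

Lemma dist1_ge0 y : 0 <= dist1 y. Proof. by rewrite addr_ge0. Qed.

Lemma dist1_eq0 y : dist1 y = 0 -> y = 0.
Proof.
by move=> /eqP; rewrite paddr_eq0 // !normr_eq0 => /andP[/eqP a /eqP b]; case: y a b => ? ? /= -> ->.
Qed.

Lemma dist1_gt0 y : y != 0 -> 0 < dist1 y.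
Proof. by move=> y0; rewrite lt_neqAle dist1_ge0 andbT eq_sym; apply: contra y0 => /eqP /dist1_eq0 ->. Qed.

Lemma dist1D y z : dist1 (y + z) <= dist1 y + dist1 z.
Proof. by case: y => a b; case: z => c d; rewrite /dist1 /= addrACA lerD // ler_normD. Qed.

Lemma dist1N y : dist1 (- y) = dist1 y.
Proof. by case: y => a b; rewrite /dist1 /= !normrN. Qed.

Lemma dist1Z (a : R) y : dist1 (a%:C * y) = `|a| * dist1 y.
Proof. by case: y => c d; rewrite /dist1; simpc; rewrite !normrM mulrDr. Qed.

Lemma dist10 : dist1 (0 : R[i]) = 0. Proof. by rewrite /dist1 /= !normr0 addr0. Qed.

Lemma dist1_continuous (T : topologicalType) (f : T -> R[i]) :
  continuous f -> continuous (fun t => dist1 (f t)).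
Proof. by move=> cf; rewrite /dist1; cts. Qed.

End Distance.

Section Push.
Context {R : realType} {n : nat} (rho : R).
Hypothesis rho_gt0 : 0 < rho.
Implicit Types (c e : 'I_n -> R[i]).

Definition avoid c : set R[i] := [set y | forall i, y <> c i].

(** A tent of height 1 at [u] vanishing at distance [rho]; its slope 1 / rho is what bounds the
    displacements allowed in [push_avoid]. *)
Definition bump (u y : R[i]) : R := Num.max 0 (1 - dist1 (y - u) / rho).

Definition push c e (y : R[i]) : R[i] := y + \sum_i (bump (c i) y)%:C * (e i - c i).

Lemma bump_far u y : rho <= dist1 (y - u) -> bump u y = 0.
Proof. by move=> far; rewrite /bump max_l // subr_le0 ler_pdivlMr // mul1r. Qed.

Lemma bump_near u y : dist1 (y - u) < rho -> bump u y = 1 - dist1 (y - u) / rho.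
Proof. by move=> /ltW near; rewrite /bump max_r // subr_ge0 ler_pdivrMr // mul1r. Qed.

Lemma push_id c y : push c c y = y.
Proof. by rewrite /push big1 ?addr0 // => i _; rewrite subrr mulr0. Qed.

Lemma push_far c e y : (forall i, rho <= dist1 (y - c i)) -> push c e y = y.
Proof. by move=> far; rewrite /push big1 ?addr0 // => i _; rewrite bump_far // mul0r. Qed.

(** The discs of radius rho around the [c i] are disjoint, so at most one bump acts at [y]. If [y]
    is near [c i] and lands on [e i], then y - c i equals (dist1 (y - c i) / rho) (e i - c i), which
    is strictly shorter than itself. It cannot land on another [e j], because it stays within 2 rho
    of [c i] while [e j] is farther away. If no bump acts, [y] is fixed and is too far from every
    [c j] to be [e j]. *)
Lemma push_avoid c e y : (forall i j, i != j -> 3 * rho <= dist1 (c i - c j)) ->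
  (forall i, dist1 (e i - c i) < rho) -> avoid c y -> avoid e (push c e y).
Proof.
move=> sep small cy j.
case: (pickP (fun i => dist1 (y - c i) < rho)) => [i near|far]; last first.
  rewrite push_far => [|i]; last by rewrite leNgt far.
  by move=> yE; have := far j; rewrite yE small.
have far k : k != i -> rho <= dist1 (y - c k).
  move=> ki; have := sep _ _ ki; have := dist1D (c k - y) (y - c i).
  rewrite (_ : c k - y + (y - c i) = c k - c i); last by ring.
  by rewrite -(opprB y) dist1N; move: near rho_gt0; lra.
have -> : push c e y = y + (1 - dist1 (y - c i) / rho)%:C * (e i - c i).
  rewrite /push (bigD1 i) //= bump_near // big1 ?addr0 // => k ki.
  by rewrite bump_far ?mul0r // far.
have d0 : 0 < dist1 (y - c i) by apply: dist1_gt0; rewrite subr_eq0; apply/eqP; exact: cy.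
have [->|ji] := eqVneq j i.
  move=> yE; have : y - c i = (dist1 (y - c i) / rho)%:C * (e i - c i).
    apply/eqP; rewrite -subr_eq0; apply/eqP.
    by move: yE => /eqP; rewrite -subr_eq0 => /eqP yE; rewrite -{}yE rmorphB rmorph1; ring.
  move=> /(congr1 dist1); rewrite dist1Z ger0_norm ?divr_ge0 ?(ltW rho_gt0) ?(ltW d0) // => E.
  have := small i; move: E d0; move: (dist1 (y - c i)) (dist1 (e i - c i)) => D S E D0.
  have : D * rho = D * S by rewrite {1}E; field; rewrite gt_eqF.
  by move=> /(mulfI (lt0r_neq0 D0)) ->; rewrite ltxx.
move=> yE; have : c i - c j = - (y - c i) - (1 - dist1 (y - c i) / rho)%:C * (e i - c i) + (e j - c j).
  by rewrite -yE; ring.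
move=> /(congr1 dist1) => E; have := sep _ _ ji; rewrite -dist1N opprB E.
apply/negP; rewrite -ltNge.
apply: le_lt_trans (dist1D _ _) _; have := small j.
suff : dist1 (- (y - c i) - (1 - dist1 (y - c i) / rho)%:C * (e i - c i)) < 2 * rho by lra.
apply: le_lt_trans (dist1D _ _) _; rewrite !dist1N dist1Z.
suff : `|1 - dist1 (y - c i) / rho| * dist1 (e i - c i) <= rho by move: near; lra.
rewrite ger0_norm ?subr_ge0 ?ler_pdivrMr ?mul1r ?(ltW near) //.
apply: le_trans (ltW (small i)); rewrite ler_piMl ?dist1_ge0 // gerBl.
by rewrite divr_ge0 // ltW.
Qed.

Lemma push_continuous (T : topologicalType) (c e : T -> 'I_n -> R[i]) (b : T -> R[i]) :
  (forall i, continuous (fun t => c t i)) -> (forall i, continuous (fun t => e t i)) ->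
  continuous b -> continuous (fun t => push (c t) (e t) (b t)).
Proof.
move=> cc ce cb; rewrite /push; apply: ctsC_D; first exact: cb.
apply: ctsC_sum => i; apply: ctsC_M; last first.
  by apply: ctsC_D; [exact: ce|apply: ctsC_N; exact: cc].
apply: ctsC_real; rewrite /bump; apply: cts_max; first exact: cts_cst.
apply: ctsD; first exact: cts_cst.
apply: ctsN; apply: ctsM; last exact: cts_cst.
by apply: dist1_continuous; apply: ctsC_D; [exact: cb|apply: ctsC_N; exact: cc].
Qed.

End Push.

Section Mover.
Context {R : realType} {n : nat} (z : R -> 'I_n -> R[i]) (y0 : R[i]).
Hypothesis z_continuous : forall i, continuous (z^~ i).
Hypothesis z_distinct : forall t i j, t \in `[0, 1] -> i != j -> z t i != z t j.
Hypothesis z_base : forall t i, t \in `[0, 1] -> y0 != z t i.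

Lemma positive_lower_bound (f : R -> R) : continuous f ->
  (forall t, t \in `[0, 1] -> 0 < f t) ->
  exists2 e : R, 0 < e & forall t, t \in `[0, 1] -> e <= f t.
Proof.
move=> cf f0; have [c c01 Hc] := @EVT_min R f 0 1 ler01 (continuous_subspaceT cf).
by exists (f c) => //; exact: f0.
Qed.

Lemma separation : exists2 rho : R, 0 < rho & forall t, t \in `[0, 1] ->
  (forall i j, i != j -> 3 * rho <= dist1 (z t i - z t j)) /\
  (forall i, rho <= dist1 (y0 - z t i)).
Proof.
have H1 (ij : 'I_n * 'I_n) : exists e : R, 0 < e /\ (ij.1 != ij.2 ->
    forall t, t \in `[0, 1] -> e <= dist1 (z t ij.1 - z t ij.2)).
  have [_|ij12] := eqVneq ij.1 ij.2; first by exists 1.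
  have [||e e0 He] := @positive_lower_bound (fun t => dist1 (z t ij.1 - z t ij.2)).
  - by apply: dist1_continuous; apply: ctsC_D; [|apply: ctsC_N]; exact: z_continuous.
  - by move=> t t01; apply: dist1_gt0; rewrite subr_eq0 z_distinct.
  by exists e.
have H2 (i : 'I_n) : exists e : R, 0 < e /\
    forall t, t \in `[0, 1] -> e <= dist1 (y0 - z t i).
  have [||e e0 He] := @positive_lower_bound (fun t => dist1 (y0 - z t i)).
  - by apply: dist1_continuous; apply: ctsC_D; [exact: cts_cst|apply: ctsC_N; exact: z_continuous].
  - by move=> t t01; apply: dist1_gt0; rewrite subr_eq0 z_base.
  by exists e.
have [f1 Hf1] := choice H1; have [f2 Hf2] := choice H2.
have [i _|e1 e10 He1] := @finite_lower_bound R ('I_n * 'I_n)%type predT f1.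
  by have [] := Hf1 i.
have [i _|e2 e20 He2] := @finite_lower_bound R 'I_n predT f2; first by have [] := Hf2 i.
exists (Num.min (e1 / 3) e2); first by rewrite lt_min e20 divr_gt0.
move=> t t01; split=> [i j ij|i].
  apply: le_trans ((Hf1 (i, j)).2 ij t t01); apply: le_trans (He1 (i, j) isT).
  by rewrite mulrC -ler_pdivlMr // ge_min lexx.
by apply: le_trans ((Hf2 i).2 t t01); apply: le_trans (He2 i isT); rewrite ge_min lexx orbT.
Qed.

Lemma uniform_steps (rho : R) : 0 < rho -> exists2 d : R, 0 < d &
  forall t t', t \in `[0, 1] -> t' \in `[0, 1] -> `|t - t'| < d ->
  forall i, dist1 (z t i - z t' i) < rho.
Proof.
move=> rho0.
pose W (U : set R) := forall t t', U t -> U t' -> forall i, dist1 (z t i - z t' i) < rho.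
have [||d d0 Hd] := @lebesgue_number R R [set` `[0, 1]] W (@segment_compact _ _ _).
- by move=> U U' UU' HW t t' /UU' Ut /UU' Ut'; exact: HW.
- move=> t _.
  have : \forall s \near t, forall i, dist1 (z s i - z t i) < rho / 2.
    apply: (@filter_forall _ _ _ _ (nbhs_filter t)) => i.
    have cd : continuous (fun s => dist1 (z s i - z t i)).
      by apply: dist1_continuous; apply: ctsC_D; [exact: z_continuous|exact: cts_cst].
    have : dist1 (z t i - z t i) < rho / 2 by rewrite subrr dist10 divr_gt0.
    exact: (@cvgr_lt _ _ _ _ _ _ (cd t)).
  move=> /nbhs_ballP[d d0 Hd]; exists d => // s s' ts ts' i.
  have := dist1D (z s i - z t i) (- (z s' i - z t i)); rewrite dist1N.
  rewrite (_ : z s i - z t i + - _ = z s i - z s' i); last by ring.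
  by have := Hd _ ts i; have := Hd _ ts' i; lra.
exists d => // t t' t01 t'01 tt' i; apply: (Hd t t01); first exact: ballxx.
exact: tt'.
Qed.

(** The fibre at time p t is carried to the fibre at time q t by [N] pushes along the affine
    interpolation of the two times; uniform continuity gives one [N] for which every push moves the
    punctures by less than rho. The base point is at distance at least rho from all punctures and
    never moves. Both times vary with t, as needed to carry a fibre reached midway to the current
    one. *)
Lemma mover (p q : R -> R) : continuous p -> continuous q ->
  (forall t, t \in `[0, 1] -> p t \in `[0, 1]) ->
  (forall t, t \in `[0, 1] -> q t \in `[0, 1]) ->
  exists Th : R -> R[i] -> R[i],
  [/\ forall (T : topologicalType) (a : T -> R) (b : T -> R[i]),
        continuous a -> continuous b -> continuous (fun x => Th (a x) (b x)),
      forall t y, t \in `[0, 1] -> avoid (z (p t)) y -> avoid (z (q t)) (Th t y),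
      forall t, t \in `[0, 1] -> Th t y0 = y0
    & forall t y, p t = q t -> Th t y = y].
Proof.
move=> cp cq p01 q01; have [rho rho0 Hrho] := separation.
have [d d0 Hd] := uniform_steps rho0.
have [N N0 HN] := small_inverse d0; have {}HN := HN N (leqnn N).
have Nr0 : 0 < N%:R :> R by rewrite ltr0n.
pose c (k : nat) (t : R) := p t + k%:R / N%:R * (q t - p t).
pose Th := fix Th k t y := if k is k'.+1 then push rho (z (c k' t)) (z (c k'.+1 t)) (Th k' t y) else y.
have cc k : continuous (c k) by rewrite /c; cts.
have c01 k t : (k <= N)%N -> t \in `[0, 1] -> c k t \in `[0, 1].
  move=> kN t01; have := p01 _ t01; have := q01 _ t01; rewrite /c.
  have : 0 <= (k%:R / N%:R : R) <= 1.
    by rewrite divr_ge0 //= ler_pdivrMr // mul1r ler_nat.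
  move: (k%:R / N%:R) => a; rewrite !in_itv /= => /andP[? ?] /andP[? ?] /andP[? ?].
  by apply/andP; split; nra.
have cS k t : t \in `[0, 1] -> `|c k.+1 t - c k t| < d.
  move=> t01; rewrite /c (_ : _ - _ = N%:R^-1 * (q t - p t)); last first.
    by rewrite -natr1; field; rewrite gt_eqF.
  rewrite normrM gtr0_norm ?invr_gt0 //; apply: le_lt_trans HN.
  rewrite ler_piMr ?invr_ge0 ?(ltW Nr0) //.
  have := p01 _ t01; have := q01 _ t01; rewrite !in_itv /= => /andP[? ?] /andP[? ?].
  by rewrite ler_norml; lra.
exists (Th N); split.
- move=> T a b ca cb; elim: (N) => [|k IH]; first exact: cb.
  apply: push_continuous; last exact: IH.
    by move=> i; apply: (cts_comp (@z_continuous i)); exact: (cts_comp (cc k)).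
  by move=> i; apply: (cts_comp (@z_continuous i)); exact: (cts_comp (cc k.+1)).
- move=> t y t01 zy.
  suff H k : (k <= N)%N -> avoid (z (c k t)) (Th k t y).
    have := H N (leqnn N); rewrite (_ : c N t = q t) // /c divff ?gt_eqF // mul1r.
    by rewrite addrC subrK.
  elim: k => [|k IH] kN /=; first by rewrite /c mul0r mul0r addr0.
  apply: push_avoid => //; last exact: IH (ltnW kN).
  + by have [] := Hrho _ (c01 _ _ (ltnW kN) t01).
  + by apply: Hd; [exact: c01|exact: c01 (ltnW kN) t01|exact: cS].
- move=> t t01; suff H k : (k <= N)%N -> Th k t y0 = y0 by exact: H.
  elim: k => [|k IH] kN //=; rewrite IH ?(ltnW kN) // push_far // => i.
  by have [_] := Hrho _ (c01 _ _ (ltnW kN) t01).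
- move=> t y pq; suff H k : Th k t y = y by exact: H.
  by elim: k => [|k IH] //=; rewrite IH /c pq subrr !mulr0 push_id.
Qed.

(* With Phi moving the fibre from time 0 to time t, the homotopy from g to g'
   in the end fibre is absorbed by running at double speed (Phi, then the
   homotopy) and moving back from time min (2 t, 1) to time t. *)
Lemma transport_exists (f : fpath (avoid (z 0)) y0 y0) :
  exists g : fpath (avoid (z 1)) y0 y0, forall g' : fpath (avoid (z 1)) y0 y0,
  homotopic g g' -> exists H : R * R -> R[i],
    [/\ continuous H,
        forall t s, t \in `[0, 1] -> s \in `[0, 1] -> avoid (z t) (H (t, s)),
        forall t, t \in `[0, 1] -> H (t, 0) = y0 /\ H (t, 1) = y0
      & forall s, s \in `[0, 1] -> H (0, s) = f s /\ H (1, s) = g' s].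
Proof.
have i0 : (0 : R) \in `[0, 1] by rewrite in_itv /= lexx ler01.
have i1 : (1 : R) \in `[0, 1] by rewrite in_itv /= lexx ler01.
have [||//|//|Phi [cPhi aPhi bPhi iPhi]] := @mover (fun=> 0) (fun t => t).
- exact: cts_cst.
- exact: cts_id.
have g_cont : continuous (fun s => Phi 1 (f s)).
  by apply: cPhi; [exact: cts_cst|exact: fp_continuous].
have g_in s : s \in `[0, 1] -> avoid (z 1) (Phi 1 (f s)).
  by move=> s01; apply: aPhi => //; exact: fp_in.
have g_0 : Phi 1 (f 0) = y0 by rewrite fp0 bPhi.
have g_1 : Phi 1 (f 1) = y0 by rewrite fp1 bPhi.
exists (FPath g_cont g_in g_0 g_1) => g' [K [cK aK bK eK]].
have [||||Th [cTh aTh bTh iTh]] := @mover (fun t => Num.min (2 * t) 1) (fun t => t).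
- by cts.
- exact: cts_id.
- by move=> t; rewrite !in_itv /= le_min ge_min; lra.
- by [].
have ccl := @continuous_clamp R.
exists (fun x => Th x.1 (if x.1 <= 2^-1 then Phi (2 * x.1) (f (clamp x.2))
                         else K (2 * x.1 - 1, clamp x.2))); split.
- apply: cTh; first by cts.
  apply: continuous_if; first by cts.
  + apply: cPhi; first by cts.
    by apply: (cts_comp (fp_continuous f)); apply: (cts_comp ccl); cts.
  + apply: (cts_comp cK); apply: cts_pair; first by cts.
    by apply: (cts_comp ccl); cts.
  move=> [t s] /= ->; rewrite divff ?pnatr_eq0 // subrr.
  by have [-> _] := eK _ (clamp_itv s).
- move=> t s t01 s01 /=; rewrite clamp_id //; apply: aTh => //; case: ifP => t2.
    rewrite min_l; last by lra.
    by apply: aPhi; [exact: half_itvl|exact: fp_in].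
  rewrite min_r; last by lra.
  by apply: aK => //; exact: half_itvr.
- move=> t t01 /=; rewrite !clamp_id // fp0 fp1.
  case: ifP => t2; first by rewrite bPhi ?bTh //; exact: half_itvl.
  by have [-> ->] := bK _ (half_itvr t01 t2); rewrite bTh.
- move=> s s01 /=; rewrite clamp_id // invr_ge0 ler0n mulr0 iPhi // iTh; last first.
    by rewrite mulr0 min_l.
  rewrite iTh; last by rewrite min_r //; lra.
  rewrite ifF; last by lra.
  rewrite (_ : 2 * 1 - 1 = 1); last by lra.
  by have [_ ->] := eK _ s01.
Qed.

End Mover.

(** * Holonomy *)

Section PrefixProduct.
Context {G : groupType} {I : Type} (g : I -> G).
Local Open Scope group_scope.

(** The group is not commutative: the product splits because the elements satisfying [C] come first
    in [r]. *)
Lemma prod_prefix (r : seq I) (C P : pred I) :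
  pairwise (fun i j => C j ==> C i) r ->
  \prod_(i <- r | P i) g i =
  \prod_(i <- r | P i && C i) g i * \prod_(i <- r | P i && ~~ C i) g i.
Proof.
elim: r => [|i r IH] /=; first by rewrite !big_nil mulg1.
move=> /andP[Ci /IH {}IH]; rewrite !big_cons IH.
case: (P i) => //=; case: ifP Ci => /= Pi Ci; first by rewrite mulgA.
rewrite (_ : \prod_(j <- r | P j && C j) g j = 1) ?mul1g //.
have {Ci} : all (predC C) r by apply: sub_all Ci => j; rewrite implybF.
elim: r {IH} => [|j r IH] /=; first by rewrite big_nil.
by rewrite big_cons => /andP[/negbTE -> /IH]; rewrite andbF.
Qed.

End PrefixProduct.

Section Holonomy.
Context {R : realType} {n : nat} {G : groupType}.
Variables (a b : 'I_n -> R) (g : 'I_n -> G) (sg : R) (r : seq 'I_n).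
Hypothesis sg2 : sg * sg = 1.
Hypothesis r_sorted : pairwise (fun i j => sg * a j <= sg * a i) r.
Local Notation E := (R[i] * R[i])%type.
Implicit Types (e : E).

Definition below e (i : 'I_n) : bool := complex.Im e.2 < a i * complex.Im e.1.

Definition before e (i : 'I_n) : bool := complex.Re e.2 < a i * complex.Re e.1 + b i.

Definition crossing (S : pred 'I_n) e : G :=
  (\prod_(i <- r | S i && below e i) g i)%g.

(* A point of E is a pair (x, y).  The fibre over x is cut along the half lines
   going left from the punctures, and e, e' are two nearby points: only a cut
   with both points on its side (before) is crossed, and the crossed letters are
   collected in the order of r, that is by decreasing sg * slope. *)
Definition jump e e' : G :=
  let S := [pred i | before e i && before e' i] in
  ((crossing S e)^-1 * crossing S e')%g.

Lemma jump_rev e e' : jump e' e = (jump e e')^-1%g.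
Proof.
have SE : [pred i | before e' i && before e i] =1 [pred i | before e i && before e' i].
  by move=> i /=; rewrite andbC.
by rewrite /jump invgM invgK /crossing; congr (_^-1 * _)%g; apply: eq_bigl => i; rewrite SE.
Qed.

Lemma jump_refl e : jump e e = 1%g.
Proof. by rewrite /jump mulVg. Qed.

Lemma jump_above e e' : (forall i, ~~ below e i) -> (forall i, ~~ below e' i) -> jump e e' = 1%g.
Proof.
move=> ab ab'; rewrite /jump /crossing !big_pred0 ?invg1 ?mulg1 // => i.
  by rewrite (negbTE (ab' i)) andbF.
by rewrite (negbTE (ab i)) andbF.
Qed.

Lemma jump_below e e' : (forall i, below e i) -> (forall i, below e' i) -> jump e e' = 1%g.
Proof.
move=> ab ab'; rewrite /jump /crossing.
by under eq_bigl => i do rewrite ab andbT; under [X in (_ * X)%g]eq_bigl => i do rewrite ab' andbT;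
  rewrite mulVg.
Qed.

Lemma jump_strip (S : pred 'I_n) e e' : before e =1 S -> before e' =1 S ->
  jump e e' = ((crossing S e)^-1 * crossing S e')%g.
Proof.
by move=> Se Se'; rewrite /jump /crossing; congr (_^-1 * _)%g; apply: eq_bigl => i;
  rewrite /= Se Se' andbb.
Qed.

Definition intersect e (i : 'I_n) : R[i] := (a i)%:C * e.1 + (b i)%:C.

(* Near e0 the lines with e0 below their cut form a prefix of r, as Im x has
   sign sg; they contribute equally to both products and cancel. *)
Lemma jump_local e0 : 0 <= sg * complex.Im e0.1 -> (forall i, e0.2 <> intersect e0 i) ->
  exists2 U : set E, nbhs e0 U & exists Q : E -> G,
    forall e e', U e -> U e' -> jump e e' = ((Q e)^-1 * Q e')%g.
Proof.
move=> sg0 e0_off.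
pose dI e i := complex.Im e.2 - a i * complex.Im e.1.
pose dR e i := complex.Re e.2 - (a i * complex.Re e.1 + b i).
have c1 : continuous (fun e : E => e.1) by cts.
have c2 : continuous (fun e : E => e.2) by cts.
have cI i : continuous (fun e => dI e i) by rewrite /dI; cts.
have cR i : continuous (fun e => dR e i) by rewrite /dR; cts.
have belowE e i : below e i = (dI e i < 0) by rewrite /below subr_lt0.
have beforeE e i : before e i = (dR e i < 0) by rewrite /before subr_lt0.
pose U := [set e | forall i, [/\ dI e0 i < 0 -> dI e i < 0, 0 < dI e0 i -> 0 < dI e i,
  dR e0 i < 0 -> dR e i < 0 & 0 < dR e0 i -> 0 < dR e i]].
exists U.
  apply: (@filter_forall _ _ _ _ (nbhs_filter e0)) => i.
  have lt (f : E -> R) : continuous f -> \forall e \near e0, f e0 < 0 -> f e < 0.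
    move=> cf; case: (ltP (f e0) 0) => f0; last by near=> e.
    by near=> e => _; near: e; exact: (@cvgr_lt _ _ _ _ _ _ (cf e0) 0 f0).
  have gt (f : E -> R) : continuous f -> \forall e \near e0, 0 < f e0 -> 0 < f e.
    move=> cf; case: (ltP 0 (f e0)) => f0; last by near=> e.
    by near=> e => _; near: e; exact: (@cvgr_gt _ _ _ _ _ _ (cf e0) 0 f0).
  near=> e; split; near: e; [exact: lt|exact: gt|exact: lt|exact: gt].
pose C := [pred i | dI e0 i < 0].
exists (fun e => \prod_(i <- r | before e0 i && below e i && ~~ C i) g i)%g => e e' Ue Ue'.
have rC : pairwise (fun i j => C j ==> C i) r.
  apply: sub_pairwise r_sorted => i j ij; apply/implyP; rewrite /C /= /dI.
  by move: ij sg2 sg0; nra.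
pose S := [pred i | before e i && before e' i].
have rest f : U f -> (\prod_(i <- r | (S i && below f i) && ~~ C i) g i =
    \prod_(i <- r | before e0 i && below f i && ~~ C i) g i)%g.
  move=> Uf; apply: eq_bigl => i; rewrite /C /S /=.
  have [|dI0] := ltP (dI e0 i) 0; first by rewrite !andbF.
  rewrite !andbT; have [u1 u2 u3 u4] := Ue i; have [v1 v2 v3 v4] := Ue' i.
  have [w1 w2 w3 w4] := Uf i.
  move: dI0; rewrite le_eqVlt => /predU1P[dI0|dI0]; last first.
    by rewrite belowE (lt_gtF (w2 dI0)) !andbF.
  have dR0 : dR e0 i != 0.
    apply/eqP => dR0; apply: (e0_off i); move: dI0 dR0; rewrite /dI /dR.
    case: (e0) => -[x1 x2] [y1 y2] /= /esym/eqP; rewrite subr_eq0 => /eqP -> /eqP.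
    by rewrite subr_eq0 => /eqP ->; rewrite /intersect /=; simpc.
  move: dR0; rewrite neq_lt => /orP[dR0|dR0].
    by rewrite !beforeE dR0 (u3 dR0) (v3 dR0).
  by rewrite !beforeE (lt_gtF dR0) (lt_gtF (u4 dR0)).
rewrite /jump /crossing -/S (prod_prefix _ _ rC) [in X in (_ * X)%g](prod_prefix _ _ rC).
rewrite (rest _ Ue) (rest _ Ue').
have -> : (\prod_(i <- r | (S i && below e i) && C i) g i =
           \prod_(i <- r | (S i && below e' i) && C i) g i)%g.
  apply: eq_bigl => i; rewrite /C /=; have [Ci|] := ltP (dI e0 i) 0; last by rewrite !andbF.
  have [u1 _ _ _] := Ue i; have [v1 _ _ _] := Ue' i.
  by rewrite !belowE (u1 Ci) (v1 Ci).
by rewrite invgM -mulgA mulKg.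
Unshelve. all: by end_near. Qed.

End Holonomy.

#[global] Opaque jump.

Section Holonomy.
Context {R : realType} {n : nat} {G : groupType}.
Variables (a b : 'I_n -> R) (g : 'I_n -> G) (sg : R) (r : seq 'I_n).
Hypothesis sg2 : sg * sg = 1.
Hypothesis r_sorted : pairwise (fun i j => sg * a j <= sg * a i) r.
Local Notation E := (R[i] * R[i])%type.
Local Notation jump := (jump a b g r).
Implicit Types (e : E) (u : nat -> E).

Fixpoint hol u (N : nat) : G :=
  if N is N'.+1 then (hol u N' * jump (u N') (u N))%g else 1%g.

Lemma hol_add u M N : hol u (M + N) = (hol u M * hol (fun j => u (M + j)%N) N)%g.
Proof.
elim: N => [|N IH]; first by rewrite addn0 mulg1.
by rewrite addnS /= IH -mulgA addnS.
Qed.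

Lemma eq_hol u v N : (forall j, (j <= N)%N -> u j = v j) -> hol u N = hol v N.
Proof.
elim: N => //= N IH uv.
have -> : hol u N = hol v N by apply: IH => j jN; apply: uv; exact: leqW.
by rewrite !uv.
Qed.

Lemma hol_rev u N : hol (fun j => u (N - j)%N) N = (hol u N)^-1%g.
Proof.
elim: N => [|N IH]; first by rewrite invg1.
have -> : hol (fun j => u (N.+1 - j)%N) N.+1 = hol (fun j => u (N.+1 - j)%N) (1 + N) by [].
rewrite hol_add /= mul1g subn0 subn1 invgM -jump_rev -IH.
by congr (_ * _)%g; apply: eq_hol => j _; rewrite add1n subSS.
Qed.

(** Commuting squares let the rung between two sampled paths be carried from one end to the
    other. *)
Lemma hol_rows (u : nat -> nat -> E) (N : nat) (i : nat) :
  (forall j, (j < N)%N -> (jump (u i j) (u i j.+1) * jump (u i j.+1) (u i.+1 j.+1) =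
    jump (u i j) (u i.+1 j) * jump (u i.+1 j) (u i.+1 j.+1))%g) ->
  (hol (u i) N * jump (u i N) (u i.+1 N) = jump (u i 0) (u i.+1 0) * hol (u i.+1) N)%g.
Proof.
elim: N => [|N IH] sq /=; first by rewrite mul1g mulg1.
rewrite -mulgA sq // mulgA.
have {}IH := IH (fun j jN => sq j (ltnW jN)).
by rewrite IH -mulgA.
Qed.

(** On a fine grid the corners of each small square share a potential [Q] from [jump_local], so the
    square commutes. The vertical sides being trivial, all rows have the same holonomy. Having this
    for all large [N] allows passing to common multiples of several meshes. *)
Lemma hol_square (f : R * R -> E) : continuous f ->
  (forall z, z.1 \in `[0, 1] -> z.2 \in `[0, 1] ->
     0 <= sg * complex.Im (f z).1 /\ forall i, (f z).2 <> intersect a b (f z) i) ->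
  (forall t t', t \in `[0, 1] -> t' \in `[0, 1] ->
     jump (f (t, 0)) (f (t', 0)) = 1%g /\ jump (f (t, 1)) (f (t', 1)) = 1%g) ->
  exists2 N0 : nat, (0 < N0)%N & forall N, (N0 <= N)%N ->
    hol (fun j => f (0, j%:R / N%:R)) N = hol (fun j => f (1, j%:R / N%:R)) N.
Proof.
move=> cf f_ok sides.
pose W (U : set (R * R)) := exists Q : R * R -> G,
  forall z z', U z -> U z' -> jump (f z) (f z') = ((Q z)^-1 * Q z')%g.
have cK : compact ([set` `[(0 : R), 1]] `*` [set` `[(0 : R), 1]]).
  by apply: compact_setX; exact: segment_compact.
have [||d d0 Hd] := @lebesgue_number R _ _ W cK.
- by move=> U U' UU' [Q HQ]; exists Q => z z' /UU' ? /UU' ?; exact: HQ.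
- move=> z [z1 z2]; have [sg0 off] := f_ok _ z1 z2.
  have [U Uf [Q HQ]] := jump_local g sg2 r_sorted sg0 off.
  have := cf z U Uf; move=> /nbhs_ballP[d d0 Hd]; exists d => //.
  by exists (Q \o f) => z' z'' /Hd ? /Hd ?; exact: HQ.
have [N0 N00 HN] := small_inverse d0; exists N0 => // N N0N.
have {}HN := HN _ N0N; have Nr0 : 0 < N%:R :> R by rewrite ltr0n (leq_trans N00).
have Nn0 : N%:R != 0 :> R by rewrite gt_eqF.
have bnd j : (j <= N)%N -> (j%:R / N%:R : R) \in `[0, 1].
  by move=> jN; rewrite in_itv /= divr_ge0 //= ler_pdivrMr // mul1r ler_nat.
have i0 : (0 : R) \in `[0, 1] by rewrite in_itv /= lexx ler01.
have i1 : (1 : R) \in `[0, 1] by rewrite in_itv /= lexx ler01.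
have close j : `|(j%:R / N%:R : R) - j.+1%:R / N%:R| < d.
  rewrite -mulrBl -opprB -natrB // subSnn mulN1r normrN gtr0_norm ?invr_gt0 //.
pose u i j := f (i%:R / N%:R, j%:R / N%:R).
have step i : (i < N)%N -> hol (u i) N = hol (u i.+1) N.
  move=> iN; have := @hol_rows u N i; rewrite /u !mul0r divff //.
  have [-> _] := sides _ _ (bnd _ (ltnW iN)) (bnd _ iN).
  have [_ ->] := sides _ _ (bnd _ (ltnW iN)) (bnd _ iN).
  rewrite mul1g mulg1; apply => j jN.
  have [|Q HQ] := Hd (i%:R / N%:R, j%:R / N%:R).
    by split; [exact: (bnd _ (ltnW iN))|exact: (bnd _ (ltnW jN))].
  rewrite !HQ; try by split; rewrite /= /ball /= ?subrr ?normr0.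
  by rewrite !mulgA !mulgK.
have H i : (i <= N)%N -> hol (u 0%N) N = hol (u i) N.
  elim: i => [|i IH] iN; first by reflexivity.
  rewrite (IH (ltnW iN)); exact: step.
by have := H N (leqnn N); rewrite /u mul0r divff.
Qed.

(* Asking for all multiples of N0 makes the value c independent of N0. *)
Definition Hol (x : R) (f : R -> R[i]) (c : G) := exists2 N0 : nat, (0 < N0)%N &
  forall k, (0 < k)%N -> hol (fun j => (x%:C, f (j%:R / (k * N0)%:R))) (k * N0) = c.

Lemma itv_frac (j N : nat) : (j <= N)%N -> (0 < N)%N -> (j%:R / N%:R : R) \in `[0, 1].
Proof.
by move=> jN N0; rewrite in_itv /= divr_ge0 //= ler_pdivrMr ?ltr0n // mul1r ler_nat.
Qed.

Lemma Hol_cat x f f' c c' : f 1 = f' 0 -> Hol x f c -> Hol x f' c' ->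
  Hol x (path_cat f f') (c * c')%g.
Proof.
(* lia would otherwise record a dependency on the section hypotheses *)
clear sg2 r_sorted; move=> ff' [N N0 HN] [M M0 HM].
(* The factor 2 puts a sample at the seam, and each half then carries a common multiple of both
   meshes. *)
exists (2 * (N * M))%N; first by rewrite !muln_gt0 N0 M0.
move=> k k0; pose L := (k * (N * M))%N.
have L0 : (0 < L)%N by rewrite !muln_gt0 k0 N0.
have Lr0 : L%:R != 0 :> R by rewrite pnatr_eq0 -lt0n.
have aux (J M' : R) : M' != 0 -> 2 * (J / (M' + M')) = J / M'.
  by move=> M'0; rewrite -[M' + M']mulr2n -mulr_natl; field.
have -> : (k * (2 * (N * M)) = L + L)%N by rewrite /L; lia.
rewrite hol_add; congr (_ * _)%g.
  rewrite -(HN (k * M)%N) ?muln_gt0 ?k0 //.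
  have -> : (k * M * N = L)%N by rewrite /L; lia.
  apply: eq_hol => j jL; congr (_, _); rewrite /path_cat ifT.
    by congr f; rewrite natrD aux.
  by rewrite natrD ler_pdivrMr ?addr_gt0 ?ltr0n //; have : j%:R <= L%:R :> R by [rewrite ler_nat]; lra.
rewrite -(HM (k * N)%N) ?muln_gt0 ?k0 //.
have -> : (k * N * M = L)%N by rewrite /L; lia.
apply: eq_hol => j jL; congr (_, _); rewrite /path_cat.
have [|j0] := posnP j; last first.
  rewrite ifF; first by congr f'; rewrite !natrD aux // mulrDl divff // addrC addKr.
  apply/negbTE; rewrite -ltNge !natrD ltr_pdivlMr ?addr_gt0 ?ltr0n //.
  by have : 0 < j%:R :> R by [rewrite ltr0n]; lra.
move=> ->; rewrite addn0 mul0r -ff' natrD ifT; first by congr f; rewrite aux // divff.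
by rewrite ler_pdivrMr ?addr_gt0 ?ltr0n //; lra.
Qed.

Lemma Hol_rev x f c : Hol x f c -> Hol x (path_rev f) c^-1%g.
Proof.
move=> [N N0 HN]; exists N => // k k0; rewrite -(HN k k0) -hol_rev; apply: eq_hol => j jN.
have Lr0 : (k * N)%:R != 0 :> R by rewrite pnatr_eq0 -lt0n muln_gt0 k0.
by congr (_, _); rewrite /path_rev natrB // mulrBl divff.
Qed.

(** A potential valid along the whole path makes the product telescope, whatever the number of
    samples. *)
Lemma Hol_const x f (Q : R[i] -> G) :
  (forall s s', s \in `[0, 1] -> s' \in `[0, 1] ->
     jump (x%:C, f s) (x%:C, f s') = ((Q (f s))^-1 * Q (f s'))%g) ->
  Hol x f ((Q (f 0%R))^-1 * Q (f 1%R))%g.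
Proof.
move=> fQ; exists 1%N => // k k0; rewrite muln1.
have kr0 : k%:R != 0 :> R by rewrite pnatr_eq0 -lt0n.
suff H j : (j <= k)%N -> hol (fun j => (x%:C, f (j%:R / k%:R))) j =
    ((Q (f 0%R))^-1 * Q (f (j%:R / k%:R)%R))%g by rewrite H // divff.
elim: j => [|j IH] jk /=; first by rewrite mul0r mulVg.
rewrite IH ?(ltnW jk) // fQ ?itv_frac ?(ltnW jk) //.
by rewrite mulgA mulgK.
Qed.

(** A moving loop keeps its holonomy. All samples are taken at the common multiple N M L of the
    meshes of the two end loops and of the homotopy. *)
Lemma Hol_transport (gam : R -> R[i]) (x x' : R) (H : R * R -> R[i]) f f' c c' :
  continuous gam -> continuous H -> gam 0 = x%:C -> gam 1 = x'%:C ->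
  (forall t, t \in `[0, 1] -> 0 <= sg * complex.Im (gam t)) ->
  (forall t s, t \in `[0, 1] -> s \in `[0, 1] -> forall i, H (t, s) <> intersect a b (gam t, H (t, s)) i) ->
  (forall t t', t \in `[0, 1] -> t' \in `[0, 1] ->
     jump (gam t, H (t, 0)) (gam t', H (t', 0)) = 1%g /\
     jump (gam t, H (t, 1)) (gam t', H (t', 1)) = 1%g) ->
  (forall s, s \in `[0, 1] -> H (0, s) = f s /\ H (1, s) = f' s) ->
  Hol x f c -> Hol x' f' c' -> c = c'.
Proof.
move=> cg cH g0 g1 sg0 off sides ends [N N0 HN] [M M0 HM].
have [|||L L0 HL] := @hol_square (fun z => (gam z.1, H z)).
- by apply: cts_pair; [apply: (cts_comp cg); cts|exact: cH].
- by move=> [t s] t01 s01; split; [exact: sg0|exact: off].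
- by move=> t t' t01 t'01; exact: sides.
have K0 : (0 < N * M * L)%N by rewrite !muln_gt0 N0 M0.
have /HL : (L <= N * M * L)%N by rewrite leq_pmull // muln_gt0 N0.
rewrite (@eq_hol _ (fun j => (x%:C, f (j%:R / (M * L * N)%:R)))); last first.
  move=> j jK; rewrite /= g0 [(M * L * N)%N]mulnC mulnA; congr (_, _).
  by have [-> _] := ends _ (itv_frac jK K0).
rewrite [in RHS](@eq_hol _ (fun j => (x'%:C, f' (j%:R / (N * L * M)%:R)))); last first.
  move=> j jK; rewrite /= g1 [(N * L * M)%N]mulnAC; congr (_, _).
  by have [_ ->] := ends _ (itv_frac jK K0).
have E1 : (N * M * L = M * L * N)%N by lia.
have E2 : (N * M * L = N * L * M)%N by lia.
by rewrite {1}E1 E2 HN ?muln_gt0 ?M0 // HM ?muln_gt0 ?N0.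
Qed.

End Holonomy.

(** * Holonomy of the generators in a real fibre *)

Section FiberHolonomy.
Context {R : realType} {n : nat} {G : groupType}.
Variables (a b : 'I_n -> R) (g : 'I_n -> G) (sg : R) (rs : seq 'I_n).
Hypothesis sg2 : sg * sg = 1.
Hypothesis rs_sorted : pairwise (fun i j => sg * a j <= sg * a i) rs.
Variables (x : R) (h : 'I_n -> R) (y0 : R[i]) (r : R).
Hypothesis h_height : forall i, exists k, a i * x + b i = h k.
Hypothesis h_incr : forall i j : 'I_n, (i < j)%N -> h i < h j.
Hypothesis y0_gt0 : 0 < complex.Im y0.
Hypothesis r_gt0 : 0 < r.
Hypothesis r_sep : forall i j, i != j -> 2 * r < `|h i - h j|.
Local Notation F := (punctured h).
Local Notation Hol := (Hol a b g rs x).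
Local Notation jump := (jump a b g rs).

Lemma Hol_homotopic u v (f f' : fpath F u v) c : homotopic f f' -> Hol f c -> Hol f' c.
Proof.
move=> [H [cH FH bH eH]] [N N0 HN].
have [|||L L0 HL] := @hol_square R n G a b g sg rs sg2 rs_sorted (fun z => (x%:C, H z)).
- by apply: cts_pair; [exact: cts_cst|exact: cH].
- move=> [t s] t01 s01 /=; rewrite mulr0; split=> // i; have [k kE] := h_height i.
  rewrite /intersect /= -rmorphM -rmorphD kE; exact: FH.
- move=> t t' t01 t'01; have [-> ->] := bH _ t01; have [-> ->] := bH _ t'01.
  by rewrite !jump_refl.
exists (N * L)%N; first by rewrite muln_gt0 N0 L0.
move=> k k0; have K0 : (0 < k * (N * L))%N by rewrite !muln_gt0 k0 N0 L0.
rewrite mulnA; have := HL (k * N * L)%N; rewrite leq_pmull ?muln_gt0 ?k0 //.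
move=> /(_ isT) E; rewrite -(HN (k * L)%N) ?muln_gt0 ?k0 //.
have -> : (k * L * N = k * N * L)%N by rewrite mulnAC.
have K0' : (0 < k * N * L)%N by rewrite !muln_gt0 k0 N0 L0.
transitivity (hol a b g rs (fun j => (x%:C, H (1, j%:R / (k * N * L)%:R))) (k * N * L)).
  by apply: eq_hol => j jK; have [_ ->] := eH _ (itv_frac jK K0').
rewrite -E; apply: eq_hol => j jK; by have [-> _] := eH _ (itv_frac jK K0').
Qed.

Definition above_product (q : R) : G := (\prod_(i <- rs | q < a i * x + b i) g i)%g.

Lemma Hol_pcat u v w (f : fpath F u v) (f' : fpath F v w) c c' :
  Hol f c -> Hol f' c' -> Hol (pcat f f') (c * c')%g.
Proof.
move=> Hf Hf'; have e : f 1 = f' 0 by rewrite fp0 fp1.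
exact: (Hol_cat e Hf Hf').
Qed.

Lemma Hol_prev u v (f : fpath F u v) c : Hol f c -> Hol (preverse f) c^-1%g.
Proof. exact: Hol_rev. Qed.

Lemma Hol_upper u v (f : fpath F u v) : (forall s, s \in `[0, 1] -> 0 <= complex.Im (f s)) ->
  Hol f 1%g.
Proof.
move=> f0; rewrite -(mulVg (1%g : G)); apply: (@Hol_const _ _ _ _ _ _ _ _ _ (fun=> 1%g)) => s s' s01 s'01.
by rewrite mulVg jump_above // => i; rewrite /below /= mulr0 -leNgt f0.
Qed.

Lemma Hol_lower u v (f : fpath F u v) : (forall s, s \in `[0, 1] -> complex.Im (f s) < 0) ->
  Hol f 1%g.
Proof.
move=> f0; rewrite -(mulVg (1%g : G)); apply: (@Hol_const _ _ _ _ _ _ _ _ _ (fun=> 1%g)) => s s' s01 s'01.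
by rewrite mulVg jump_below // => i; rewrite /below /= mulr0 f0.
Qed.

(** The part in the closed upper half plane is above all cuts, and the part in the open lower half
    plane is below all of them. What counts is the vertical descent from [q] to the auxiliary point
    [q']: Re y is constant along it, so it crosses exactly the cuts of the punctures to the right of
    [q]. *)
Lemma Hol_vert q (oq : off h q) : Hol (vert y0_gt0 oq) (above_product q).
Proof.
have lI := @Im_low R.
pose q' : R[i] := q -i* 1.
have q'I : 0 < -1 * complex.Im q' by rewrite /= mulN1r opprK.
have Fq := off_in oq; have Fq' : F q' := punctured_off q'I.
pose S1 := pseg (segment_off lI (ltW q'I) Fq').
have qe : 0 <= -1 * complex.Im (q%:C : R[i]) by rewrite mulr0.
pose S2 := pseg (segment_off q'I qe Fq).
have S3i := segment_off lI qe Fq.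
pose S3 := pseg S3i.
have tri : homotopic (pcat S1 S2) S3 by apply: (@segment_triangle _ _ _ (-1)) => //; exact: ltW.
have v2 : homotopic (pseg (vert2 oq)) (pcat (preverse S2) (preverse S1)).
  rewrite -preverse_cat tri; apply: homotopic_ext => s _ /=; rewrite /path_rev.
  by apply: complex_inj; rewrite !(Re_segment, Im_segment); ring.
have H1 : Hol (pseg (vert1 y0_gt0 oq)) 1%g.
  apply: Hol_upper => s; rewrite in_itv /= Im_segment /= => /andP[s0 s1].
  by move: y0_gt0; nra.
have HS1 : Hol S1 1%g.
  apply: Hol_lower => s; rewrite in_itv -[S1 s]/(segment (@low R) q' s) Im_segment.
  by move=> /andP[/= s0 s1]; nra.
have HS2 : Hol S2 (above_product q)^-1%g.
  pose S : pred 'I_n := [pred i | q < a i * x + b i].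
  have bS s : before a b (x%:C, S2 s) =1 S.
    by move=> i; rewrite /before /S -[(_, _).2]/(segment q' q%:C s) Re_segment /= subrr mulr0 addr0.
  have := @Hol_const _ _ _ a b g rs x S2 (fun y => crossing a g rs S (x%:C, y)).
  rewrite fp0 fp1.
  have -> : crossing a g rs S (x%:C, q') = above_product q.
    by apply: eq_bigl => i; rewrite /below /= mulr0 ltrN10 andbT.
  have -> : crossing a g rs S (x%:C, q%:C) = 1%g.
    by apply: big_pred0 => i; rewrite /below /= mulr0 ltxx andbF.
  by rewrite mulg1; apply => s s' s01 s'01; apply: jump_strip; exact: bS.
have := Hol_pcat H1 (Hol_pcat (Hol_prev HS2) (Hol_prev HS1)).
rewrite invgK invg1 mulg1 mul1g.
apply: Hol_homotopic; rewrite /vert.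
by apply: pcat_proper => //; symmetry.
Qed.

Lemma Hol_alpha k : Hol (alpha_path y0_gt0 r_gt0 r_sep k)
  (above_product (h k - r) * (above_product (h k + r))^-1)%g.
Proof.
have A := alpha_path_vert y0_gt0 r_gt0 r_sep (@off_left _ _ _ _ r_gt0 r_sep k)
  (@off_right _ _ _ _ r_gt0 r_sep k).
have := Hol_pcat (Hol_vert (@off_left _ _ _ _ r_gt0 r_sep k))
  (Hol_prev (Hol_vert (@off_right _ _ _ _ r_gt0 r_sep k))).
by apply: Hol_homotopic; symmetry.
Qed.

Definition word_value (be : 'I_n -> G) (w : seq (@letter n)) : G :=
  (\prod_(l <- w) (if l.2 then be l.1 else (be l.1)^-1))%g.

Lemma Hol_word (be : 'I_n -> G) w :
  (forall k, Hol (alpha_path y0_gt0 r_gt0 r_sep k) (be k)) ->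
  Hol (word_path y0_gt0 r_gt0 r_sep w) (word_value be w).
Proof.
move=> Hbe; elim: w => [|[k e] w IH]; rewrite /word_value.
  rewrite big_nil; change (Hol (pcst (base_in (h := h) y0_gt0)) 1%g).
  by apply: Hol_upper => s _; exact: ltW.
rewrite big_cons; apply: (Hol_pcat _ IH).
by case: e; [exact: Hbe|apply: Hol_prev; exact: Hbe].
Qed.

End FiberHolonomy.

(** * The affine group and Fox derivatives *)

Section Affine.
Variable K : fieldType.

(** The element (s, v) stands for the map z -> s z + v, and the product is composition, the right
    factor acting first. *)
Definition affine : Type := ({s : K | s != 0} * K)%type.
HB.instance Definition _ := Choice.on affine.

Definition affine_mk (s v : K) (s0 : s != 0) : affine := (exist _ s s0, v).
Definition scale (e : affine) : K := val e.1.
Definition shift (e : affine) : K := e.2.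

Lemma scale_neq0 e : scale e != 0. Proof. exact: valP e.1. Qed.

Lemma affine_inj e f : scale e = scale f -> shift e = shift f -> e = f.
Proof.
case: e f => [s v] [t w]; rewrite /scale /shift /= => st vw.
by congr (_, _); [exact: val_inj|].
Qed.

Definition affine_one : affine := affine_mk 0 (oner_neq0 K).
Definition affine_mul (e f : affine) : affine :=
  affine_mk (shift e + scale e * shift f) (mulf_neq0 (scale_neq0 e) (scale_neq0 f)).
Definition affine_inv (e : affine) : affine :=
  affine_mk (- ((scale e)^-1 * shift e)) (invr_neq0 (scale_neq0 e)).

Fact affine_mulA : associative affine_mul.
Proof.
move=> e f k; apply: affine_inj; rewrite /scale /shift /= ?mulrA //.
by rewrite mulrDr mulrA addrA.
Qed.

Fact affine_mul1 : left_id affine_one affine_mul.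
Proof. by move=> e; apply: affine_inj; rewrite /scale /shift /= ?mul1r ?add0r. Qed.

Fact affine_mulr1 : right_id affine_one affine_mul.
Proof. by move=> e; apply: affine_inj; rewrite /scale /shift /= ?mulr1 ?mulr0 ?addr0. Qed.

Fact affine_mulV : left_inverse affine_one affine_inv affine_mul.
Proof.
move=> e; apply: affine_inj; rewrite /scale /shift /= ?addNr //.
by rewrite mulVf // (valP e.1).
Qed.

Fact affine_mulrV : right_inverse affine_one affine_inv affine_mul.
Proof.
move=> e; apply: affine_inj; rewrite /scale /shift /=; first by rewrite mulfV // (valP e.1).
by rewrite mulrN mulrA mulfV ?(valP e.1) // mul1r subrr.
Qed.

HB.instance Definition _ := isGroup.Build affine
  affine_mulA affine_mul1 affine_mulr1 affine_mulV affine_mulrV.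

Lemma scaleM (e f : affine) : scale (e * f)%g = scale e * scale f. Proof. by []. Qed.
Lemma shiftM (e f : affine) : shift (e * f)%g = shift e + scale e * shift f. Proof. by []. Qed.
Lemma scaleV (e : affine) : scale e^-1%g = (scale e)^-1. Proof. by []. Qed.
Lemma shiftV (e : affine) : shift e^-1%g = - ((scale e)^-1 * shift e). Proof. by []. Qed.
Lemma scale1 : scale 1%g = 1. Proof. by []. Qed.
Lemma shift1 : shift 1%g = 0. Proof. by []. Qed.

Lemma scale_prod (I : Type) (r : seq I) (P : pred I) (F : I -> affine) :
  scale (\prod_(i <- r | P i) F i)%g = \prod_(i <- r | P i) scale (F i).
Proof. exact: (big_morph scale scaleM scale1). Qed.

(** The shape of the monodromy comes from here: when [e] is the product of the generators of a block
    and [f] one of them, the first term is a sum over the block and the second a diagonal term. *)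
Lemma shift_conj (e f : affine) :
  shift (e * f * e^-1)%g = (1 - scale f) * shift e + scale e * shift f.
Proof.
rewrite !(shiftM, scaleM, shiftV); move: (scale e) (scale_neq0 e) => a a0.
by field.
Qed.

Lemma shift_range (F : nat -> affine) (c e : nat) :
  shift (\prod_(c <= j < e) F j)%g =
  \sum_(c <= j < e) (\prod_(c <= l < j) scale (F l)) * shift (F j).
Proof.
have [ec|ce] := leqP e c; first by rewrite !big_geq.
rewrite -(subnKC (ltnW ce)); elim: (e - c)%N => [|k IH]; first by rewrite addn0 !big_geq.
rewrite addnS big_nat_recr ?leq_addr // shiftM IH [RHS]big_nat_recr ?leq_addr //=; congr (_ + _ * _).
exact: scale_prod.
Qed.

Section FoxCalculus.
Variables (n : nat) (s : 'I_n -> K) (s_neq0 : forall k, s k != 0) (xi : 'I_n -> K).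

Definition generator (k : 'I_n) : affine := affine_mk (xi k) (s_neq0 k).

Lemma eval_sum_cat (c c' : seq (int * word n)) :
  eval_sum s (c ++ c') = eval_sum s c + eval_sum s c'.
Proof. by rewrite /eval_sum big_cat. Qed.

Lemma eval_sum_cons (l : @letter n) (c : seq (int * word n)) :
  eval_sum s [seq (cu.1, l :: cu.2) | cu <- c] =
  (if l.2 then s l.1 else (s l.1)^-1) * eval_sum s c.
Proof.
rewrite /eval_sum big_map big_distrr /=; apply: eq_bigr => cu _.
by rewrite /eval_word big_cons /= mulrCA.
Qed.

(** Composition of affine maps gives shift (e f) = shift e + scale e shift f, which is the product
    rule of Fox derivatives after evaluation. Both sides obey the same recursion, an inverse letter
    contributing - xi_k / s_k. *)
Lemma shift_word (w : word n) :
  shift (\prod_(l <- w) (if l.2 then generator l.1 else (generator l.1)^-1))%g =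
  \sum_j eval_sum s (fox j w) * xi j.
Proof.
elim: w => [|l w IH].
  rewrite big_nil shift1 big1 // => j _; by rewrite /eval_sum big_nil mul0r.
rewrite big_cons shiftM IH /=.
under [RHS]eq_bigr => j _ do rewrite eval_sum_cat eval_sum_cons mulrDl -mulrA.
rewrite big_split /= -big_distrr /=; congr (_ + _ * _); last by case: (l.2).
rewrite (bigD1 l.1) //= big1 ?addr0; last first.
  by move=> j jl; rewrite /fox_letter eq_sym jl /eval_sum big_nil mul0r.
rewrite /fox_letter eqxx /=; case: l => k [] /=; rewrite /eval_sum big_seq1 /= /eval_word.
  by rewrite big_nil !mul1r.
by rewrite big_seq1 /= mulN1r mulNr.
Qed.

End FoxCalculus.

End Affine.

(** * Half twists and full twists *)

Section Order.
Context {R : realType} {n m : nat} (A : arrangement R n m).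
Implicit Types (x : R) (i j : 'I_n).
Local Notation ht := (height A).
Local Notation ord := (ordered_line A).

Lemma ordered_line_inj x : injective (ord x).
Proof. by apply/tuple_uniqP; rewrite sort_uniq /= enum_uniq. Qed.

Lemma ordered_line_le x (j k : 'I_n) : (j <= k)%N -> ht x (ord x j) <= ht x (ord x k).
Proof.
move=> jk; rewrite /ordered_line !(tnth_nth j) /=.
set le := fun i i' : 'I_n => ht x i <= ht x i'.
have s : sorted le (sort le (enum 'I_n)).
  by apply: sort_sorted => i i'; exact: le_total.
apply: (sorted_leq_nth _ _ j s) => //.
- by move=> i1 i2 i3; exact: le_trans.
- by move=> i; exact: lexx.
- by rewrite inE size_sort size_enum_ord.
- by rewrite inE size_sort size_enum_ord.
Qed.

Definition position x (i : 'I_n) : 'I_n := invF (@ordered_line_inj x) i.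

Lemma positionK x : cancel (position x) (ord x).
Proof. exact: f_invF. Qed.

Lemma ordered_lineK x : cancel (ord x) (position x).
Proof. exact: invF_f. Qed.

Lemma crossing_singular x i j : i != j -> ht x i = ht x j -> singular_abscissae A x%:C.
Proof.
move=> ij hij; exists (x%:C, (ht x i)%:C) => //.
exists (inl i), (inl j); split; first by apply: contra ij => /eqP[->].
  by rewrite /line /= /height -rmorphM -rmorphD.
by rewrite /line /= hij /height -rmorphM -rmorphD.
Qed.

Lemma height_inj x : ~ singular_abscissae A x%:C -> injective (ht x).
Proof.
move=> xs i j hij; apply/eqP; apply: contra_notT xs => ij; exact: crossing_singular ij hij.
Qed.

Lemma ordered_line_lt x : ~ singular_abscissae A x%:C ->
  forall j k : 'I_n, (j < k)%N -> ht x (ord x j) < ht x (ord x k).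
Proof.
move=> xs j k jk; rewrite lt_neqAle ordered_line_le ?(ltnW jk) // andbT.
apply: contraTN jk => /eqP /(height_inj xs) /ordered_line_inj ->.
by rewrite ltnn.
Qed.

Lemma position_le x : ~ singular_abscissae A x%:C ->
  forall i j, (position x i <= position x j)%N = (ht x i <= ht x j).
Proof.
move=> xs i j; apply/idP/idP => [ij|].
  by have := ordered_line_le x ij; rewrite !positionK.
by apply: contraTT; rewrite -ltnNge -ltNge => /(ordered_line_lt xs); rewrite !positionK.
Qed.

Lemma position_lt x : ~ singular_abscissae A x%:C ->
  forall i j, (position x i < position x j)%N = (ht x i < ht x j).
Proof. by move=> xs i j; rewrite ltnNge ltNge position_le. Qed.

Lemma card_ord_lt c : (c <= n)%N -> #|[pred l : 'I_n | (l < c)%N]| = c.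
Proof. by move=> cn; rewrite -sum1_card -(big_ord_widen n (fun=> 1%N) cn) sum1_card card_ord. Qed.

(** In terms of positions [q] is an initial segment, and an initial segment is determined by its
    cardinality. *)
Lemma position_count x (q : pred 'I_n) : ~ singular_abscissae A x%:C ->
  (forall i j, q j -> ht x i < ht x j -> q i) ->
  forall i, q i = (position x i < #|q|)%N.
Proof.
move=> xs qdown i.
pose D := [set k : 'I_n | q (ord x k)]%SET.
have Dq : #|D| = #|q|.
  rewrite -(card_imset _ (@ordered_line_inj x)); apply: eq_card => j.
  apply/imsetP/idP => [[k]|qj]; first by rewrite inE => ? ->.
  by exists (position x j); rewrite ?inE positionK.
have Ddown (k l : 'I_n) : k \in D -> (l < k)%N -> l \in D.
  by rewrite !inE => qk /(ordered_line_lt xs) lk; exact: qdown lk.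
rewrite -Dq; have -> : q i = (position x i \in D) by rewrite inE positionK.
move: (position x i) => k; apply/idP/idP => [kD|].
  rewrite -(card_ord_lt (ltn_ord k)); apply: subset_leq_card; apply/fintype.subsetP => l.
  rewrite inE ltnS leq_eqVlt => /predU1P[/val_inj-> //|]; exact: Ddown.
apply: contraTT => kD; rewrite -leqNgt -(card_ord_lt (ltnW (ltn_ord k))).
apply: subset_leq_card; apply/fintype.subsetP => l lD; rewrite inE ltnNge.
apply/negP; rewrite leq_eqVlt => /predU1P[/val_inj kl|kl].
  by move: kD; rewrite kl lD.
by move: kD; rewrite (Ddown _ _ lD kl).
Qed.

(** Otherwise the two lines would meet over a point of pi(S) other than [p] and no farther from [p]
    than [x] is. *)
Lemma no_crossing p x i j : close_to A p x -> ht p i < ht p j -> ht x i < ht x j.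
Proof.
move=> [xp close] hp; rewrite ltNge; apply/negP => hx.
have ij : i != j by apply: contraTneq hp => ->; rewrite ltxx.
pose D := ht p j - ht p i; pose s := slope A j - slope A i.
have D0 : 0 < D by rewrite subr_gt0.
have Ds : D + s * (x - p) <= 0.
  by rewrite (_ : _ + _ = ht x j - ht x i) ?subr_le0 // /D /s /height; ring.
have s0 : s != 0 by apply: contraTneq D0 => s0; rewrite -leNgt; move: Ds; rewrite s0; lra.
(* The difference of the two heights is D at [p] and has slope [s]; it vanishes here. *)
pose xi := p - D / s.
have xiE : ht xi i = ht xi j.
  apply/eqP; rewrite eq_sym -subr_eq0; apply/eqP.
  have -> : ht xi j - ht xi i = D - s * (D / s) by rewrite /height /xi /D /s /height; ring.
  by rewrite mulrCA divff // mulr1 subrr.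
have xip : xi%:C <> p%:C :> R[i].
  move=> [e]; have : D / s = 0 by move: e; rewrite /xi; lra.
  by move/eqP; rewrite mulf_eq0 invr_eq0 (negbTE s0) gt_eqF.
have := close _ (crossing_singular ij xiE) xip.
rewrite -!rmorphB !normc_def /= expr0n !addr0 !sqrtr_sqr ltcR; apply/negP; rewrite -leNgt.
rewrite /xi addrAC subrr add0r normrN normrM normfV ler_pdivrMr ?normr_gt0 //.
rewrite -normrM (gtr0_norm D0) mulrC -normrN; apply: le_trans (ler_norm _).
by move: Ds; lra.
Qed.

End Order.

(** * Ordered products over the lines above a position *)

Section Tails.
Context {R : realType} {n m : nat} (A : arrangement R n m) {G : groupType}.
Local Notation ht := (height A).
Local Notation ord := (ordered_line A).
Local Notation position := (position A).

Definition by_slope (sg : R) : seq 'I_n :=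
  sort (fun i j => sg * slope A j <= sg * slope A i) (enum 'I_n).

Lemma by_slope_sorted sg :
  pairwise (fun i j => sg * slope A j <= sg * slope A i) (by_slope sg).
Proof.
rewrite -sorted_pairwise; last by move=> i j k /= ij jk; exact: le_trans jk ij.
by apply: sort_sorted => i j; exact: le_total.
Qed.

Lemma by_slope_uniq sg : uniq (by_slope sg).
Proof. by rewrite sort_uniq enum_uniq. Qed.

Lemma mem_by_slope sg i : i \in by_slope sg.
Proof. by rewrite mem_sort mem_enum. Qed.

Local Open Scope group_scope.

(* The holonomy of the vertical path passing just left of position c; hence
   twist is the holonomy of the generator alpha_k. *)
Definition tail sg (g : 'I_n -> G) x (c : nat) : G :=
  \prod_(i <- by_slope sg | (c <= position x i)%N) g i.

Definition twist sg g x (k : nat) : G := tail sg g x k * (tail sg g x k.+1)^-1.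

Lemma tail_end sg g x : tail sg g x n = 1.
Proof. by apply: big_pred0 => i; rewrite leqNgt ltn_ord. Qed.

Lemma twist_range sg g x c e : (c <= e)%N ->
  \prod_(c <= j < e) twist sg g x j = tail sg g x c * (tail sg g x e)^-1.
Proof.
move=> /subnKC <-; elim: (e - c)%N => [|k IH]; first by rewrite addn0 big_geq // mulgV.
by rewrite addnS big_nat_recr ?leq_addr //= IH /twist mulgA mulgVK.
Qed.

(** The last tail is 1, so the tails are recovered from the twists by telescoping. *)
Lemma eq_tail sg sg' g g' x : (forall k, (k < n)%N -> twist sg g x k = twist sg' g' x k) ->
  forall c, (c <= n)%N -> tail sg g x c = tail sg' g' x c.
Proof.
move=> E c cn.
have tailE s f : tail s f x c = \prod_(c <= j < n) twist s f x j.
  by rewrite twist_range // tail_end invg1 mulg1.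
rewrite !tailE.
by apply: eq_big_nat => k /andP[_ kn]; exact: E.
Qed.

(** Descending induction on the position. Let L be the product of the factors that precede the line
    at position k0 in the slope order and have a higher position. The twist at k0 is the conjugate L
    g L^-1 of the element g of this line, and L is already fixed, so the equation can be solved for
    g without disturbing the later twists. *)
Lemma twist_solve sg x (be : 'I_n -> G) : exists g, forall k : 'I_n, twist sg g x k = be k.
Proof.
suff H d : (d <= n)%N -> exists g, forall k : 'I_n, (n - d <= k)%N -> twist sg g x k = be k.
  by have [g Hg] := H n (leqnn n); exists g => k; apply: Hg; rewrite subnn.
elim: d => [|d IH] dn.
  by exists (fun=> 1) => k; rewrite subn0 leqNgt ltn_ord.
have [g Hg] := IH (ltnW dn).
have k0n : (n - d.+1 < n)%N by rewrite -subSn // subSS leq_subr.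
pose k0 := Ordinal k0n; pose i0 := ord x k0.
have [l1 [l2 [rsE i0l1 i0l2]]] : exists l1 l2,
    [/\ by_slope sg = l1 ++ i0 :: l2, i0 \notin l1 & i0 \notin l2].
  have := by_slope_uniq sg; have := mem_by_slope sg i0.
  move: (by_slope sg) => s si us; case/splitPr: si us => p1 p2 us.
  exists p1, p2; split=> //; move: us; rewrite cat_uniq /=.
    by case/and3P => _; rewrite negb_or => /andP[].
  by case/and3P => _ _ /andP[].
pose L g := \prod_(i <- l1 | (k0 <= position x i)%N) g i : G.
pose g' := fun i => if i == i0 then (L g)^-1 * be k0 * L g else g i.
have g'E c (s : seq 'I_n) : (k0 < c)%N ->
    \prod_(i <- s | (c <= position x i)%N) g' i = \prod_(i <- s | (c <= position x i)%N) g i.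
  move=> kc; apply: eq_bigr => i ci; rewrite /g'; case: eqP => // ii.
  by move: ci; rewrite ii ordered_lineK leqNgt kc.
have notin (s : seq 'I_n) : i0 \notin s ->
    \prod_(i <- s | (k0 <= position x i)%N) g' i = \prod_(i <- s | (k0.+1 <= position x i)%N) g i.
  move=> si; rewrite big_seq_cond [RHS]big_seq_cond; apply: eq_big => i.
    case: (boolP (i \in s)) => //= is_; rewrite leq_eqVlt; case: eqP => //= e.
    move: is_; rewrite -(positionK A x i) (_ : position x i = k0) ?(negbTE si) //.
    exact: val_inj.
  by case/andP => is_ _; rewrite /g'; case: eqP => // ii; move: si; rewrite -ii is_.
have gL : L g = \prod_(i <- l1 | (k0.+1 <= position x i)%N) g i.
  rewrite -notin //; rewrite /L big_seq_cond [RHS]big_seq_cond.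
  by apply: eq_bigr => i /andP[is_ _]; rewrite /g'; case: eqP => // ii; move: i0l1; rewrite -ii is_.
exists g' => k kd; have [kk0|kk0] := eqVneq k k0; last first.
  have lt : (k0 < k)%N.
    by rewrite ltn_neqAle kd andbT eq_sym; apply: contra kk0 => /eqP e; apply/eqP/val_inj.
  rewrite /twist /tail !g'E ?(leqW lt) //; apply: Hg.
  by move: lt => /=; lia.
rewrite kk0 /twist /tail rsE !big_cat !big_cons /= ordered_lineK leqnn ltnn !notin //.
rewrite !g'E // /g' eqxx gL.
set P1 := \prod_(i <- l1 | _) _; set P2 := \prod_(i <- l2 | _) _.
by rewrite invgM !mulgA mulgV mul1g mulgK mulgK.
Qed.

End Tails.

Section HalfTwist.
Context {R : realType} {n m : nat} (A : arrangement R n m) {G : groupType}.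
Local Notation ht := (height A).
Variables (p : R).
Implicit Types (eta : R).

(** In fibres close to [p], on either side, the lines at height eta over [p] occupy the positions
    from [lower eta] to [upper eta] - 1. *)
Definition lower eta : nat := #|[pred i | ht p i < eta]|.
Definition upper eta : nat := #|[pred i | ht p i <= eta]|.

Lemma lower_position x eta i : ~ singular_abscissae A x%:C -> close_to A p x ->
  (lower eta <= position A x i)%N = (eta <= ht p i).
Proof.
move=> xs close; rewrite leqNgt leNgt -(position_count (q := [pred i | ht p i < eta])) //.
move=> j k /= kh jk; rewrite ltNge; apply/negP => hj.
have := no_crossing close (lt_le_trans kh hj); by rewrite ltNge (ltW jk).
Qed.

Lemma upper_position x eta i : ~ singular_abscissae A x%:C -> close_to A p x ->
  (upper eta <= position A x i)%N = (eta < ht p i).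
Proof.
move=> xs close; rewrite leqNgt ltNge -(position_count (q := [pred i | ht p i <= eta])) //.
move=> j k /= kh jk; rewrite leNgt; apply/negP => hj.
have := no_crossing close (le_lt_trans kh hj); by rewrite ltNge (ltW jk).
Qed.

Lemma lower_upper eta : (lower eta <= upper eta)%N.
Proof. by apply: subset_leq_card; apply/fintype.subsetP => i; rewrite !inE => /ltW. Qed.

Lemma upper_le eta : (upper eta <= n)%N.
Proof. by rewrite -[X in (_ <= X)%N]card_ord; exact: max_card. Qed.

Section OneHalf.
Variables (X Y sg : R) (g : 'I_n -> G).
Hypothesis sg2 : sg * sg = 1.
Hypothesis sgX : 0 < sg * (X - p).
Hypothesis XY : Y = 2 * p - X.
Hypothesis Xs : ~ singular_abscissae A X%:C.
Hypothesis Ys : ~ singular_abscissae A Y%:C.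
Hypothesis Xc : close_to A p X.
Hypothesis Yc : close_to A p Y.
Local Notation tl := (tail A sg g).

Lemma height_from i x : ht x i = ht p i + slope A i * (x - p).
Proof. by rewrite /height; ring. Qed.

Lemma block_height_X i l : ht p i = ht p l -> (ht X i < ht X l) = (sg * slope A i < sg * slope A l).
Proof.
move=> il; rewrite !(height_from _ X) il ltrD2l -subr_gt0 -[RHS]subr_gt0 -mulrBl -mulrBr.
have -> : (slope A l - slope A i) * (X - p) = (sg * (slope A l - slope A i)) * (sg * (X - p)).
  by rewrite mulrACA sg2 mul1r.
by rewrite pmulr_lgt0.
Qed.

Lemma block_height_Y i l : ht p i = ht p l -> (ht Y i < ht Y l) = (sg * slope A l < sg * slope A i).
Proof.
move=> il; rewrite !(height_from _ Y) il ltrD2l -subr_gt0 -[RHS]subr_gt0 -mulrBl -mulrBr XY.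
have -> : (slope A l - slope A i) * (2 * p - X - p) =
    (sg * (slope A i - slope A l)) * (sg * (X - p)).
  rewrite mulrACA sg2 mul1r; ring.
by rewrite pmulr_lgt0.
Qed.

Lemma outside_X i l : ht p l < ht p i -> ht X l < ht X i.
Proof. exact: no_crossing. Qed.

Lemma outside_Y i l : ht p l < ht p i -> ht Y l < ht Y i.
Proof. exact: no_crossing. Qed.

Local Open Scope group_scope.

Lemma tail_lower eta : tl X (lower eta) = tl Y (lower eta).
Proof. by apply: eq_bigl => i; rewrite !lower_position. Qed.

Lemma tail_upper eta : tl X (upper eta) = tl Y (upper eta).
Proof. by apply: eq_bigl => i; rewrite !upper_position. Qed.

(* The lines through a point at height eta are in opposite orders on the two
   sides of p, and a prefix C of the slope order is a segment of both. *)
Lemma tail_split (C : pred 'I_n) (eta : R) (P Q : pred 'I_n) :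
  (forall i j, (sg * slope A j <= sg * slope A i)%R -> C j -> C i) ->
  (forall i, P i = (eta < ht p i)%R || (ht p i == eta) && C i) ->
  (forall i, Q i = (eta < ht p i)%R || (ht p i == eta) && ~~ C i) ->
  \prod_(i <- by_slope A sg | P i) g i =
  tl X (lower eta) * (\prod_(i <- by_slope A sg | Q i) g i)^-1 * tl X (upper eta).
Proof.
move=> Cup PE QE.
have rC : pairwise (fun i j => C j ==> C i) (by_slope A sg).
  by apply: sub_pairwise (by_slope_sorted A sg) => i j ij; apply/implyP; exact: Cup.
rewrite /tail (prod_prefix _ P rC) (prod_prefix _ Q rC).
rewrite (prod_prefix _ (fun i => (lower eta <= position A X i)%N) rC).
rewrite (prod_prefix _ (fun i => (upper eta <= position A X i)%N) rC).
have E1 i : P i && C i = (lower eta <= position A X i)%N && C i.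
  by rewrite PE lower_position // le_eqVlt orbC eq_sym; case: (C i); rewrite ?andbF ?andbT.
have E2 i : P i && ~~ C i = (upper eta <= position A X i)%N && ~~ C i.
  by rewrite PE upper_position //; case: (C i); rewrite ?andbF ?andbT ?orbF.
have E3 i : Q i && C i = (upper eta <= position A X i)%N && C i.
  by rewrite QE upper_position //; case: (C i); rewrite ?andbF ?andbT ?orbF.
have E4 i : Q i && ~~ C i = (lower eta <= position A X i)%N && ~~ C i.
  by rewrite QE lower_position // le_eqVlt orbC eq_sym; case: (C i); rewrite ?andbF ?andbT.
under eq_bigl => i do rewrite E1.
under [X in _ * X = _]eq_bigl => i do rewrite E2.
under [X in _ = _ * (X * _)^-1 * _]eq_bigl => i do rewrite E3.
under [X in _ = _ * (_ * X)^-1 * _]eq_bigl => i do rewrite E4.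
by rewrite invgM !mulgA mulgK mulgVK.
Qed.

(** The lines of the block lying above [l] over X are those lying below it over Y. Hence the two
    products in [tail_split] can be read as tails in two different fibres. *)
Lemma half_twist_above l : tl X (position A X l).+1 =
  tl X (lower (ht p l)) * (tl Y (position A Y l))^-1 * tl X (upper (ht p l)).
Proof.
apply: (@tail_split [pred i | sg * slope A l < sg * slope A i]%R).
- by move=> i j /= ij lj; exact: lt_le_trans lj ij.
- move=> i /=; rewrite position_lt //; case: (ltgtP (ht p l) (ht p i)) => h /=.
  + by rewrite outside_X.
  + by rewrite lt_gtF // outside_X.
  + by rewrite block_height_X.
- move=> i /=; rewrite position_le // leNgt; case: (ltgtP (ht p l) (ht p i)) => h /=.
  + by rewrite (lt_gtF (outside_Y h)).
  + by rewrite outside_Y.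
  + by rewrite block_height_Y.
Qed.

Lemma half_twist_from l : tl X (position A X l) =
  tl X (lower (ht p l)) * (tl Y (position A Y l).+1)^-1 * tl X (upper (ht p l)).
Proof.
apply: (@tail_split [pred i | sg * slope A l <= sg * slope A i]%R).
- by move=> i j /= ij lj; exact: le_trans lj ij.
- move=> i /=; rewrite position_le // leNgt; case: (ltgtP (ht p l) (ht p i)) => h /=.
  + by rewrite (lt_gtF (outside_X h)).
  + by rewrite outside_X.
  + by rewrite block_height_X // -leNgt.
- move=> i /=; rewrite position_lt //; case: (ltgtP (ht p l) (ht p i)) => h /=.
  + by rewrite outside_Y.
  + by rewrite lt_gtF // outside_Y.
  + by rewrite block_height_Y // -ltNge.
Qed.

End OneHalf.

(** Two half twists, the second with the opposite sign. The tails at the ends of a block are the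
    same over [x] and [x']; substituting one half twist in the other conjugates the twist by the
    lower tail times the inverse of the upper one, which is the product over the block. *)
Lemma full_twist x x' sg (g g' : 'I_n -> G) : sg * sg = 1 -> 0 < sg * (x - p) ->
  x' = 2 * p - x ->
  ~ singular_abscissae A x%:C -> ~ singular_abscissae A x'%:C ->
  close_to A p x -> close_to A p x' ->
  (forall k, (k < n)%N -> twist A sg g x' k = twist A (- sg) g' x' k) ->
  forall k : 'I_n, let eta := ht p (ordered_line A x k) in
  let full := (\prod_(lower eta <= j < upper eta) twist A (- sg) g' x j)%g in
  twist A sg g x k = (full * twist A (- sg) g' x k * full^-1)%g.
Proof.
move=> sg2 sgx xE xs x's xc x'c link k eta full.
set l := ordered_line A x k in eta full *.
have sg2' : - sg * - sg = 1 by rewrite mulrNN.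
have sgx' : 0 < - sg * (x' - p) by rewrite xE; move: sgx; lra.
have xE' : x = 2 * p - x' by rewrite xE; ring.
have T c : (c <= n)%N -> tail A sg g x' c = tail A (- sg) g' x' c by exact: eq_tail.
have kE : k = position A x l :> nat by rewrite /l ordered_lineK.
have le_n (i : 'I_n) : (i <= n)%N by exact: ltnW.
have ln : (lower eta <= n)%N := leq_trans (lower_upper eta) (upper_le eta).
rewrite /full twist_range ?lower_upper // /twist kE.
rewrite (half_twist_above g sg2 sgx xE xs x's xc x'c) (half_twist_from g sg2 sgx xE xs x's xc x'c).
rewrite -/eta (tail_lower _ _ xs x's xc x'c) (tail_upper _ _ xs x's xc x'c) !T ?upper_le //.
rewrite (half_twist_above g' sg2' sgx' xE' x's xs x'c xc) (half_twist_from g' sg2' sgx' xE' x's xs x'c xc).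
rewrite -/eta (tail_lower _ _ xs x's xc x'c) (tail_upper _ _ xs x's xc x'c).
by rewrite !invgM !invgK !mulgA !mulgK !mulgVK.
Qed.

End HalfTwist.

Section Inclusion.
Context {R : realType}.

(** A real fibre occurs both as [punctured] and as [avoid]. These are equal sets but give different
    types of paths; inclusions pass from one to the other. *)
Definition pincl (F F' : set R[i]) (FF' : F `<=` F') u v (f : fpath F u v) : fpath F' u v :=
  FPath (fp_continuous f) (fun s s01 => FF' _ (fp_in f s01)) (fp0 f) (fp1 f).

Lemma homotopic_incl (F F' : set R[i]) u v (f f' : fpath F u v) (g g' : fpath F' u v) :
  F `<=` F' -> f =1 g -> f' =1 g' -> homotopic f f' -> homotopic g g'.
Proof.
move=> FF' fg fg' [H [cH HF Hb He]]; exists H; split=> //.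
- by move=> t s t01 s01; apply: FF'; exact: HF.
- by move=> s s01; rewrite -fg -fg'; exact: He.
Qed.

End Inclusion.

(** * Loops and holonomy in the real fibres of the arrangement *)

Section Fiber.
Context {R : realType} {n m : nat} (A : arrangement R n m).
Variables (x : R) (y0 : R[i]).
Hypothesis xs : ~ singular_abscissae A x%:C.
Hypothesis y0_gt0 : 0 < complex.Im y0.

Definition heights (k : 'I_n) : R := height A x (ordered_line A x k).

Lemma heights_incr (i j : 'I_n) : (i < j)%N -> heights i < heights j.
Proof. exact: ordered_line_lt. Qed.

Lemma radius_gt0 : 0 < Defs.radius A x y0.
Proof.
rewrite divr_gt0 //; apply: lt_bigmin => // -[i j] /= ij.
by rewrite normr_gt0 subr_eq0; apply: contra ij => /eqP/(height_inj xs)->.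
Qed.

Lemma radius_sep i j : i != j -> 2 * Defs.radius A x y0 < `|heights i - heights j|.
Proof.
move=> ij; have r0 := radius_gt0.
have : 3 * Defs.radius A x y0 <= `|heights i - heights j|.
  rewrite /Defs.radius mulrC divfK ?pnatr_eq0 //.
  apply: (@bigmin_le_cond _ _ _ _ (ordered_line A x i, ordered_line A x j)
    (fun ij : 'I_n * 'I_n => ij.1 != ij.2)
    (fun ij : 'I_n * 'I_n => `|height A x ij.1 - height A x ij.2|)).
  by rewrite (inj_eq (@ordered_line_inj _ _ _ A x)).
by lra.
Qed.

Definition fiber_word := word_path y0_gt0 radius_gt0 radius_sep.

(** Identifies the word paths, for which homotopies are available, with the loops used in the
    statement. *)
Lemma fiber_wordE w : fp (fiber_word w) = word_loop A x y0 w.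
Proof.
elim: w => [|[k e] w IH] //=.
rewrite /word_loop /= -/(word_loop A x y0 w) -IH.
by case: e.
Qed.

Lemma heights_lines i : exists k, slope A i * x + offset A i = heights k.
Proof. by exists (position A x i); rewrite /heights positionK. Qed.

Context {G : groupType} (sg : R) (g : 'I_n -> G).
Hypothesis sg2 : sg * sg = 1.

Lemma above_left (k : 'I_n) :
  above_product (slope A) (offset A) g (by_slope A sg) x (heights k - Defs.radius A x y0) = tail A sg g x k.
Proof.
apply: eq_bigl => i; rewrite -/(height A x i) -{1}(positionK A x i) -/(heights _).
have := lt_left heights_incr radius_gt0 radius_sep (position A x i) k.
have := @off_left _ _ _ _ radius_gt0 radius_sep k (position A x i).
by move=> /eqP oq E; rewrite [RHS]leqNgt -E -leNgt [RHS]le_eqVlt (negbTE oq).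
Qed.

Lemma above_right (k : 'I_n) :
  above_product (slope A) (offset A) g (by_slope A sg) x (heights k + Defs.radius A x y0) = tail A sg g x k.+1.
Proof.
apply: eq_bigl => i; rewrite -/(height A x i) -{1}(positionK A x i) -/(heights _).
have := lt_right heights_incr radius_gt0 radius_sep (position A x i) k.
have := @off_right _ _ _ _ radius_gt0 radius_sep k (position A x i).
by move=> /eqP oq E; rewrite [RHS]ltnNge -E -leNgt [RHS]le_eqVlt (negbTE oq).
Qed.

Lemma Hol_generator (k : 'I_n) : Hol (slope A) (offset A) g (by_slope A sg) x
  (alpha_loop A x y0 k) (twist A sg g x k).
Proof.
have := Hol_alpha g sg2 (by_slope_sorted A sg) heights_lines y0_gt0 radius_gt0 radius_sep k.
by rewrite above_left above_right.
Qed.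

Lemma Hol_fiber_word w : Hol (slope A) (offset A) g (by_slope A sg) x
  (word_loop A x y0 w) (word_value (fun k => twist A sg g x k) w).
Proof.
rewrite -fiber_wordE; apply: Hol_word => k; exact: Hol_generator.
Qed.

End Fiber.

(** * Parallel transport along a path in a half plane *)

Section Transport.
Context {R : realType} {n m : nat} (A : arrangement R n m).
Variables (X Y : R) (gamma : R -> R[i]) (y0 : R[i]) (sg : R).
Hypothesis sg2 : sg * sg = 1.
Hypothesis sgXY : 0 < sg * (X - Y).
Hypothesis gammaP : half_plane_path A X Y gamma.
Hypothesis gammaY : high_above A gamma y0.

Lemma itv0 : (0 : R) \in `[0, 1]. Proof. by rewrite in_itv /= lexx ler01. Qed.
Lemma itv1 : (1 : R) \in `[0, 1]. Proof. by rewrite in_itv /= lexx ler01. Qed.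

Lemma path_nonsingular t : t \in `[0, 1] -> ~ singular_abscissae A (gamma t).
Proof. by move=> t01; case: gammaP => _ _ sub _ _; apply: sub; exists t. Qed.

Lemma path_ends : gamma 0 = X%:C /\ gamma 1 = Y%:C.
Proof. by case: gammaP. Qed.

Lemma source_nonsingular : ~ singular_abscissae A X%:C.
Proof. by have [<- _] := path_ends; apply: path_nonsingular; exact: itv0. Qed.

Lemma target_nonsingular : ~ singular_abscissae A Y%:C.
Proof. by have [_ <-] := path_ends; apply: path_nonsingular; exact: itv1. Qed.

Lemma path_side t : t \in `[0, 1] -> 0 <= sg * complex.Im (gamma t).
Proof.
move=> t01; have [_ _ _ _ /(_ t t01) side] := gammaP.
rewrite leNgt; apply/negP => neg; have : (sg * complex.Im (gamma t)) * (sg * (X - Y)) < 0.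
  by rewrite nmulr_rlt0.
by rewrite mulrACA sg2 mul1r ltNge side.
Qed.

(** The base point is bounded below only through the lines, hence the index [k]. Over the real
    starting point of the path the puncture is real. *)
Lemma base_above (k : 'I_n) : 0 < complex.Im y0.
Proof.
have := gammaY k itv0; have [-> _] := path_ends.
by rewrite -rmorphM -rmorphD.
Qed.

Let gam t := gamma (clamp t).
Let z t (i : 'I_n) : R[i] := (slope A i)%:C * gam t + (offset A i)%:C.

Lemma clamped_continuous : continuous gam.
Proof.
have [cg _ _ _ _] := gammaP.
by apply: (continuous_within_comp cg); [exact: continuous_clamp|exact: clamp_itv].
Qed.

(** Two punctures that collide form a singular point, and the path avoids pi(S). *)
Lemma moving_distinct t i j : t \in `[0, 1] -> i != j -> z t i != z t j.
Proof.
move=> _ ij; apply/negP => /eqP e; apply: (path_nonsingular (clamp_itv t)).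
exists (gam t, z t i) => //; exists (inl i), (inl j); split=> //.
Qed.

Lemma moving_base t i : t \in `[0, 1] -> y0 != z t i.
Proof.
move=> _; apply/negP => /eqP e; have := gammaY i (clamp_itv t).
by rewrite -/(gam t) -/(z t i) -e ltxx.
Qed.

Lemma moving_continuous i : continuous (z^~ i).
Proof.
have := clamped_continuous; rewrite /z => cg.
by apply: ctsC_D; [apply: ctsC_M; [exact: cts_cst|exact: cg]|exact: cts_cst].
Qed.

Lemma moving_real x t i : gam t = x%:C -> z t i = (height A x i)%:C.
Proof. by rewrite /z => ->; rewrite -rmorphM -rmorphD. Qed.

Lemma punctured_avoid x t : gam t = x%:C -> punctured (heights A x) = avoid (z t).
Proof.
move=> gx; apply/seteqP; split=> y yP i.
  by rewrite (moving_real _ gx) -(positionK A x i); exact: yP.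
by have := yP (ordered_line A x i); rewrite (moving_real _ gx).
Qed.

Lemma gam0 : gam 0 = X%:C. Proof. by rewrite /gam clamp_id ?itv0 //; case: path_ends. Qed.
Lemma gam1 : gam 1 = Y%:C. Proof. by rewrite /gam clamp_id ?itv1 //; case: path_ends. Qed.

Lemma transport_word_exists k : exists w, transports A gamma y0 (alpha_loop A X y0 k) (word_loop A Y y0 w).
Proof.
have y0_gt0 := base_above k.
have Xs := source_nonsingular; have Ys := target_nonsingular.
pose f := alpha_path y0_gt0 (radius_gt0 Xs y0_gt0) (radius_sep Xs y0_gt0) k.
have sub0 : punctured (heights A X) `<=` avoid (z 0) by rewrite (punctured_avoid gam0).
have sub1 : avoid (z 1) `<=` punctured (heights A Y) by rewrite (punctured_avoid gam1).
have sub1' : punctured (heights A Y) `<=` avoid (z 1) by rewrite (punctured_avoid gam1).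
have [g Hg] := transport_exists moving_continuous moving_distinct moving_base (pincl sub0 f).
have [w gw] := generation (heights_incr Ys) y0_gt0 (radius_gt0 Ys y0_gt0) (radius_sep Ys y0_gt0)
  (pincl sub1 g).
have /Hg[H [cH aH bH eH]] : homotopic g (pincl sub1' (fiber_word Ys y0_gt0 w)).
  exact: (homotopic_incl sub1' _ _ gw).
exists w; exists H; split.
- exact: continuous_subspaceT.
- move=> t s t01 s01 i; have := aH t s t01 s01 i.
  by rewrite /z /gam clamp_id.
- exact: bH.
- by move=> s s01; have [-> ->] := eH s s01; split=> //=; rewrite -(fiber_wordE Ys y0_gt0).
Qed.

(** Since a suitable word exists, [xget] does not fall back on its default. *)
Lemma transport_word_transports k :
  transports A gamma y0 (alpha_loop A X y0 k) (word_loop A Y y0 (transport_word A X Y gamma y0 k)).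
Proof. exact: (xgetPex _ (transport_word_exists k)). Qed.

(** The base point stays above all the cuts, so the sides of the homotopy contribute nothing and the
    source generator and the target word have the same holonomy. *)
Lemma transport_word_value {G : groupType} (g : 'I_n -> G) k :
  word_value (fun j => twist A sg g Y j) (transport_word A X Y gamma y0 k) = twist A sg g X k.
Proof.
have y0_gt0 := base_above k.
have Xs := source_nonsingular; have Ys := target_nonsingular.
have [H [cH fH bH eH]] := transport_word_transports k.
have ccl := @continuous_clamp R.
symmetry.
apply: (Hol_transport (sg := sg) (gam := gam) (H := fun zz => H (clamp zz.1, clamp zz.2))
  sg2 (by_slope_sorted A sg) clamped_continuous _ gam0 gam1 _ _ _ _
  (Hol_generator Xs y0_gt0 g sg2 k) (Hol_fiber_word Ys y0_gt0 g sg2 _)).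
- have := @continuous_within_comp _ _ _ _ _ (fun zz : R * R => (clamp zz.1, clamp zz.2)) cH.
  apply; last by move=> t; split; exact: clamp_itv.
  by apply: cts_pair; apply: (cts_comp ccl); cts.
- by move=> t _; apply: path_side; exact: clamp_itv.
- move=> t s _ _ i; exact: (fH _ _ (clamp_itv t) (clamp_itv s) i).
- move=> t t' _ _; rewrite /= !(clamp_id itv0) !(clamp_id itv1).
  have above u i : ~~ below (slope A) (gam u, y0) i.
    rewrite /below /= -leNgt ltW //; have := gammaY i (clamp_itv u).
    by rewrite -/(gam u); case: (gam u) => c d /=; simpc.
  have [-> ->] := bH _ (clamp_itv t); have [-> ->] := bH _ (clamp_itv t').
  by split; apply: jump_above => i; exact: above.
- by move=> s s01; rewrite /= !(clamp_id itv0) !(clamp_id itv1) !(clamp_id s01); exact: eH.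
Qed.

End Transport.

(** * The monodromy matrix *)

Section AbelSummation.
Context {K : fieldType} (s u : nat -> K).

(** The translation part of the product of the generators of a block, expressed in the normalised
    coordinates u_j = xi_j / (1 - s_j). *)
Definition block_sum (c e : nat) : K :=
  \sum_(c <= j < e) ((\prod_(c <= l < j) s l) * (1 - s j)) * u j.

Lemma prod_telescope c e : (c <= e)%N ->
  \sum_(c <= j < e) (\prod_(c <= l < j) s l) * (1 - s j) = 1 - \prod_(c <= j < e) s j.
Proof.
move=> /subnKC <-; elim: (e - c)%N => [|k IH].
  by rewrite addn0 !big_geq // subrr.
rewrite addnS big_nat_recr ?leq_addr //= IH [in RHS]big_nat_recr ?leq_addr //=; ring.
Qed.

(** By [prod_telescope] the coefficients on the left add up to 1, so the left side is u_i plus a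
    combination of differences. The expansion is anchored at the last index of the block, as needed
    for the left block of the second formula. *)
Lemma block_sum_last c i : (c <= i)%N ->
  block_sum c i.+1 + (\prod_(c <= j < i.+1) s j) * u i =
  u i + \sum_(c <= k < i) (1 - \prod_(c <= j < k.+1) s j) * (u k - u k.+1).
Proof.
move=> /subnKC <-; elim: (i - c)%N => [|k IH].
  rewrite addn0 /block_sum !big_nat1 [in RHS]big_geq // [in LHS]big_geq //; ring.
rewrite addnS /block_sum big_nat_recr ?leqW ?leq_addr //= -/(block_sum _ _).
rewrite [in RHS]big_nat_recr ?leq_addr //=.
rewrite [X in _ + X * u _ = _]big_nat_recr ?leqW ?leq_addr //=.
move: IH; move: (block_sum c (c + k).+1) => S; set P := \prod_(c <= j < (c + k).+1) s j.
move: (\sum_(c <= k < _) _) => T IH.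
have -> : S = u (c + k)%N + T - P * u (c + k)%N by rewrite -IH addrK.
ring.
Qed.

(** The same combination anchored at the first index, for the right block. Here the coefficients
    change with the end of the block, which makes the induction less direct. *)
Lemma block_sum_first d b : (d <= b)%N ->
  block_sum d b.+1 + (\prod_(d <= j < b.+1) s j) * u d =
  u d - \sum_(d.+1 <= k < b.+1)
    ((\prod_(d <= j < k) s j) * (1 - \prod_(k <= j < b.+1) s j)) * (u k.-1 - u k).
Proof.
move=> /subnKC <-; elim: (b - d)%N => [|k IH].
  rewrite addn0 /block_sum !big_nat1 [in RHS]big_geq // [in LHS]big_geq //; ring.
rewrite addnS /block_sum big_nat_recr ?leqW ?leq_addr //= -/(block_sum _ _).
rewrite [X in _ + X * u _ = _]big_nat_recr ?leqW ?leq_addr //=.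
rewrite [X in _ = _ - X]big_nat_recr ?ltnS ?leq_addr //= big_nat1.
set P := \prod_(d <= j < (d + k).+1) s j in IH *; set sb := s (d + k).+1.
(* A new last parameter [sb] multiplies each inner product. Each coefficient grows by the same P (1
   - sb), and the differences it multiplies telescope. *)
have -> : \sum_(d.+1 <= i < (d + k).+1)
    (\prod_(d <= j < i) s j) * (1 - \prod_(i <= j < (d + k).+2) s j) * (u i.-1 - u i) =
  \sum_(d.+1 <= i < (d + k).+1)
    (\prod_(d <= j < i) s j) * (1 - \prod_(i <= j < (d + k).+1) s j) * (u i.-1 - u i) +
  P * (1 - sb) * (u d - u (d + k)%N).
  have -> : u d - u (d + k)%N = \sum_(d.+1 <= i < (d + k).+1) (u i.-1 - u i).
    elim: (k) => [|l IHl]; first by rewrite addn0 big_geq // subrr.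
    by rewrite addnS big_nat_recr ?ltnS ?leq_addr //= -IHl; ring.
  rewrite big_distrr -big_split /=; apply: eq_big_nat => i /andP[di ik].
  rewrite [X in 1 - X]big_nat_recr 1?ltnW //=.
  have -> : P = (\prod_(d <= j < i) s j) * \prod_(i <= j < (d + k).+1) s j.
    by rewrite -big_cat_nat // ltnW.
  rewrite -/sb; ring.
move: IH; move: (\sum_(d.+1 <= i < _) _) => T; move: (block_sum d (d + k).+1) => S IH.
have -> : S = u d - T - P * u d by rewrite -IH addrK.
ring.
Qed.

End AbelSummation.

Section NatIndexed.
Context {n : nat}.

(** A block becomes a range of natural numbers, on which induction and telescoping are available. *)
Definition nat_ext {V : Type} (v0 : V) (F : 'I_n -> V) (j : nat) : V :=
  if insub j is Some k then F k else v0.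

Lemma nat_extE V (v0 : V) (F : 'I_n -> V) (k : 'I_n) : nat_ext v0 F k = F k.
Proof. by rewrite /nat_ext valK. Qed.

Lemma big_ord_range {V : Type} (v0 : V) (op : Monoid.com_law v0) (F : 'I_n -> V)
    (f : nat -> V) c e (P : pred 'I_n) : (e <= n)%N ->
  (forall k : 'I_n, P k = (c <= k < e)%N) ->
  (forall k : 'I_n, (c <= k < e)%N -> F k = f k) ->
  \big[op/v0]_(k < n | P k) F k = \big[op/v0]_(c <= k < e) f k.
Proof.
move=> en PE Ff.
rewrite (big_nat_widen c e n xpredT f en) big_geq_mkord.
by apply: eq_big => k; [rewrite PE /= andbC|rewrite PE => /Ff].
Qed.

End NatIndexed.

Section Monodromy.
Context {R : realType} {n m : nat} (A : arrangement R n m).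
Variables (a : 'I_n + 'I_m -> R[i]) (p x x' sg : R) (gamma gamma' : R -> R[i]) (y0 : R[i]).
Local Notation K := (R[i] : fieldType).
Hypothesis a_neq0 : forall l, a l != 0.
Hypothesis a_neq1 : forall i, a (inl i) != 1.
Hypothesis sg2 : sg * sg = 1.
Hypothesis sgx : 0 < sg * (x - p).
Hypothesis x'E : x' = 2 * p - x.
Hypothesis xc : close_to A p x.
Hypothesis gammaP : half_plane_path A x x' gamma.
Hypothesis gammaP' : half_plane_path A x' x gamma'.
Hypothesis gammaY : high_above A gamma y0.
Hypothesis gammaY' : high_above A gamma' y0.

Definition transport_mx (X Y : R) (gam : R -> R[i]) : 'M[R[i]]_n :=
  \matrix_(i < n, j < n) eval_sum (parameter A a Y) (fox j (transport_word A X Y gam y0 i)).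

Definition monodromy_mx := transport_mx x x' gamma *m transport_mx x' x gamma'.

Lemma monodromyE v : monodromy A a x x' gamma gamma' y0 v = v *m monodromy_mx.
Proof. by rewrite /monodromy /= /tau -mulmxA. Qed.

Lemma mirror_close : close_to A p x'.
Proof.
have [xp close] := xc; split.
  by apply: contra xp => /eqP e; apply/eqP; move: e; rewrite x'E; lra.
move=> xi xis xip; have := close xi xis xip.
rewrite (_ : x'%:C - p%:C = - (x%:C - p%:C)) ?normrN // x'E rmorphB rmorphM rmorph_nat.
by ring.
Qed.

Local Notation s := (parameter A a x).
Local Notation s' := (parameter A a x').

Lemma source_parameter_neq0 k : s k != 0. Proof. exact: a_neq0. Qed.
Lemma target_parameter_neq0 k : s' k != 0. Proof. exact: a_neq0. Qed.

(** Linear parts commute, so in the quotient of two consecutive tails only the factor of the line at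
    position k survives. *)
Lemma scale_twist (sg' : R) (g : 'I_n -> affine K) X (k : 'I_n) :
  scale (twist A sg' g X k) = scale (g (ordered_line A X k)).
Proof.
rewrite /twist scaleM scaleV /tail !scale_prod.
have E (P : pred 'I_n) : \prod_(i <- by_slope A sg' | P i) scale (g i) = \prod_(i | P i) scale (g i).
  rewrite (perm_big (enum 'I_n)) ?perm_sort // big_enum_cond; exact: eq_bigl.
rewrite !E (bigD1 (ordered_line A X k)) ?ordered_lineK //=.
rewrite (eq_bigl (fun i => (k < position A X i)%N)) ?mulfK //.
  by rewrite -scale_prod scale_neq0.
move=> i; rewrite /= ltn_neqAle andbC; congr (_ && _).
apply/idP/idP; apply: contra => /eqP.
  by move=> e; apply/eqP; rewrite -(positionK A X i) -(val_inj e).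
by move=> ->; rewrite ordered_lineK.
Qed.

(** The Fox derivatives of a word paired with [xi] give the translation part of its value, and this
    value is the holonomy of the generator in the source fibre. *)
Lemma transport_mx_value (sg' : R) X Y gam (sY : forall k, parameter A a Y k != 0)
    (g : 'I_n -> affine K) (xi : 'I_n -> R[i]) :
  sg' * sg' = 1 -> 0 < sg' * (X - Y) -> half_plane_path A X Y gam -> high_above A gam y0 ->
  (forall k : 'I_n, twist A sg' g Y k = generator sY xi k) ->
  forall k : 'I_n, \sum_j transport_mx X Y gam k j * xi j = shift (twist A sg' g X k).
Proof.
move=> sg'2 sgXY gP gY gE k.
rewrite -(transport_word_value sg'2 sgXY gP gY g k) /word_value.
under [in RHS]eq_bigr => l _ do rewrite gE.
by rewrite shift_word; apply: eq_bigr => j _; rewrite mxE.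
Qed.

Definition block_start (k : 'I_n) : nat := lower A p (height A p (ordered_line A x k)).
Definition block_end (k : 'I_n) : nat := upper A p (height A p (ordered_line A x k)).

(** The transports are handled backwards: [xi] is prescribed at the end of the return path and
    produces [eta] over [x'], which is then prescribed for the outward path. Conjugation by the
    block product gives the two terms. *)
Lemma monodromy_mx_value (xi : 'I_n -> R[i]) (k : 'I_n) :
  \sum_j monodromy_mx k j * xi j =
  (1 - s k) * (\sum_(block_start k <= j < block_end k)
     (\prod_(block_start k <= l < j) nat_ext 1 s l) * nat_ext 0 xi j) +
  (\prod_(block_start k <= j < block_end k) nat_ext 1 s j) * xi k.
Proof.
pose zeta := generator source_parameter_neq0 xi.
have [g2 g2E] := twist_solve A (- sg) x zeta.
have g2s i : scale (g2 i) = a (inl i).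
  by rewrite -(positionK A x i) -(scale_twist (- sg) g2 x) g2E.
pose eta k := shift (twist A (- sg) g2 x' k).
have etaE (j : 'I_n) : twist A (- sg) g2 x' j = generator target_parameter_neq0 eta j.
  by apply: affine_inj => //; rewrite scale_twist g2s.
(* A second family, for the opposite half plane, with the same values as the first on the generators
   over [x']. *)
have [g1 g1E] := twist_solve A sg x' (generator target_parameter_neq0 eta).
have sgxx' : 0 < sg * (x - x') by rewrite x'E; move: sgx; lra.
have sgx'x : 0 < - sg * (x' - x) by move: sgxx'; lra.
have sgN2 : - sg * - sg = 1 by rewrite mulrNN.
have E2 := transport_mx_value sgN2 sgx'x gammaP' gammaY' g2E.
have E1 := transport_mx_value sg2 sgxx' gammaP gammaY g1E.
transitivity (\sum_j transport_mx x x' gamma k j * eta j).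
  under eq_bigr => j _ do rewrite mxE big_distrl /=.
  rewrite exchange_big /=; apply: eq_bigr => i _; rewrite /eta -E2 big_distrr /=.
  by apply: eq_bigr => j _; rewrite mulrA.
have xs := source_nonsingular gammaP; have x's := target_nonsingular gammaP.
rewrite E1 (full_twist sg2 sgx x'E xs x's xc mirror_close (g' := g2)); last first.
  by move=> j jn; rewrite (g1E (Ordinal jn)) (etaE (Ordinal jn)).
have bound j : (block_start k <= j < block_end k)%N -> (j < n)%N.
  by case/andP => _ /leq_trans; apply; exact: upper_le.
have natE j : (block_start k <= j < block_end k)%N ->
    scale (twist A (- sg) g2 x j) = nat_ext 1 s j /\ shift (twist A (- sg) g2 x j) = nat_ext 0 xi j.
  move=> /bound jn; rewrite (g2E (Ordinal jn)).
  split; first exact: esym (nat_extE 1 s (Ordinal jn)).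
  exact: esym (nat_extE 0 xi (Ordinal jn)).
rewrite shift_conj g2E shift_range scale_prod; congr (_ * _ + _ * _).
  apply: eq_big_nat => j jb; have [_ ->] := natE j jb; congr (_ * _).
  apply: eq_big_nat => l /andP[l1 l2].
  have lb : (block_start k <= l < block_end k)%N by rewrite l1 (ltn_trans l2) //; case/andP: jb.
  by have [-> _] := natE l lb.
by apply: eq_big_nat => j /natE[->].
Qed.

End Monodromy.

(** * The two formulas and invertibility on the homology *)

Section Conclusion.
Context {R : realType} {n m : nat} (A : arrangement R n m).
Variables (a : 'I_n + 'I_m -> R[i]) (p x x' sg : R) (gamma gamma' : R -> R[i]) (y0 : R[i]).
Hypothesis a_neq0 : forall l, a l != 0.
Hypothesis a_neq1 : forall i, a (inl i) != 1.
Hypothesis sg2 : sg * sg = 1.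
Hypothesis sgx : 0 < sg * (x - p).
Hypothesis x'E : x' = 2 * p - x.
Hypothesis xc : close_to A p x.
Hypothesis gammaP : half_plane_path A x x' gamma.
Hypothesis gammaP' : half_plane_path A x' x gamma'.
Hypothesis gammaY : high_above A gamma y0.
Hypothesis gammaY' : high_above A gamma' y0.
Local Notation mu := (monodromy A a x x' gamma gamma' y0).
Local Notation B := (monodromy_mx A a x x' gamma gamma' y0).
Local Notation s := (parameter A a x).
Local Notation sN := (nat_ext 1 s).
Local Notation block_start := (block_start A p x).
Local Notation block_end := (block_end A p x).

Let B_value := monodromy_mx_value a_neq0 sg2 sgx x'E xc gammaP gammaP' gammaY gammaY'.

Lemma parameter_neq1 k : 1 - s k != 0.
Proof. by rewrite subr_eq0 eq_sym a_neq1. Qed.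

Lemma nat_parameter_neq1 j : (j < n)%N -> 1 - sN j != 0.
Proof. by move=> jn; have := nat_extE 1 s (Ordinal jn); rewrite /= => ->; exact: parameter_neq1. Qed.

Lemma block_end_le k : (block_end k <= n)%N. Proof. exact: upper_le. Qed.

Lemma block_start_end k : (block_start k <= block_end k)%N. Proof. exact: lower_upper. Qed.

Lemma base_nonsingular : ~ singular_abscissae A x%:C.
Proof. exact: source_nonsingular gammaP. Qed.

Lemma block_position (j k : 'I_n) : (block_start k <= j < block_end k)%N =
  (height A p (ordered_line A x j) == height A p (ordered_line A x k)).
Proof.
rewrite ltnNge -{1 2}(ordered_lineK A x j) lower_position ?upper_position //; try exact: base_nonsingular.
by rewrite -leNgt andbC -eq_le.
Qed.

Lemma in_block k : (block_start k <= k < block_end k)%N.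
Proof. by rewrite block_position. Qed.

(* coordinate j of alpha_k / (1 - s_k) *)
Let unit_coord (j : 'I_n) (k : nat) : R[i] :=
  (1 - sN k)^-1 * nat_ext 0 (fun l : 'I_n => (l == j)%:R) k.

Lemma alpha_pair_coord (k l j : 'I_n) :
  alpha_pair A a x k l 0 j = unit_coord j k - unit_coord j l.
Proof. by rewrite !mxE /unit_coord !nat_extE /= ![_ == j]eq_sym. Qed.

(** The j-th unit vector as [xi] extracts column j of the matrix; dividing by 1 - s_k passes to the
    normalised generator alpha_k / (1 - s_k). *)
Lemma monodromy_coord (k j : 'I_n) :
  (1 - s k)^-1 * B k j =
  block_sum sN (unit_coord j) (block_start k) (block_end k) +
  (\prod_(block_start k <= l < block_end k) sN l) * unit_coord j k.
Proof.
have := B_value (fun l => (l == j)%:R) k; rewrite (bigD1 j) //= eqxx mulr1 big1 ?addr0; last first.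
  by move=> l /negbTE ->; rewrite mulr0.
move=> ->; rewrite mulrDr mulKf ?parameter_neq1 //; congr (_ + _).
  apply: eq_big_nat => l /andP[l1 l2]; rewrite -mulrA; congr (_ * _).
  by rewrite /unit_coord mulVKf // nat_parameter_neq1 // (leq_trans l2) // block_end_le.
by rewrite /unit_coord !nat_extE mulrCA.
Qed.

Lemma monodromy_alpha (k l j : 'I_n) :
  mu (alpha_pair A a x k l) 0 j =
  (1 - s k)^-1 * B k j - (1 - s l)^-1 * B l j.
Proof.
rewrite monodromyE /alpha_pair mulmxBl -!scalemxAl -!rowE !mxE; by [].
Qed.

Lemma prod_block (y : R[i]) (k : 'I_n) : block A p x y k ->
  \prod_(j < n | j \in block A p x y) s j = \prod_(block_start k <= j < block_end k) sN j.
Proof.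
move=> yk; apply: big_ord_range; first exact: block_end_le.
  move=> j; rewrite block_position; apply/idP/eqP; rewrite inE /block /=.
    move: yk; rewrite /block /= => -> /eqP; rewrite -!rmorphM -!rmorphD => /eqP/complexI e.
    by rewrite /height.
  by move: yk; rewrite /block /= => -> e; rewrite -!rmorphM -!rmorphD -/(height A p _) -/(height A p _) e.
by move=> j _; rewrite nat_extE.
Qed.

Lemma blockE y k : block A p x y k <-> y = (height A p (ordered_line A x k))%:C.
Proof. by rewrite /block /= -rmorphM -rmorphD. Qed.

Lemma block_height y k l : block A p x y k -> block A p x y l ->
  height A p (ordered_line A x k) = height A p (ordered_line A x l).
Proof. by move=> /blockE -> /blockE /complexI. Qed.

(** Both normalised generators receive the same block sum, which cancels in their difference; only
    the multiplication by the product of the parameters remains. *)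
Lemma monodromy_same_block (y : R[i]) (i i' : 'I_n) :
  block A p x y i -> block A p x y i' ->
  mu (alpha_pair A a x i i') =
  (\prod_(j < n | j \in block A p x y) s j) *: alpha_pair A a x i i'.
Proof.
move=> yi yi'; apply/rowP => j; rewrite monodromy_alpha !monodromy_coord.
have e := block_height yi' yi.
rewrite (prod_block yi) mxE alpha_pair_coord /block_start /block_end e -/(block_start i) -/(block_end i).
by ring.
Qed.

(** Distinct vertical lines do not meet, so a singular point lies on some horizontal line. *)
Lemma block_nonempty y : singular A (p%:C, y) -> exists k, block A p x y k.
Proof.
have line_block i : line A (inl i) (p%:C, y) -> exists k, block A p x y k.
  by move=> yi; exists (position A x i); rewrite /block /= positionK.
move=> [[i|j] [l' [ll' yl yl']]]; first exact: line_block yl.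
case: l' ll' yl' => [i|j'] ll' yl'; first exact: line_block yl'.
exfalso; move/negP: ll'; apply; apply/eqP; congr inr.
by apply: (@vertical_inj _ _ _ A); apply/complexI; rewrite -[LHS]yl -[RHS]yl'.
Qed.

(** The interval could a priori be empty; the singular point rules this out. Its ends are then found
    by testing the membership of c, of the first index of the block and of e + 1. *)
Lemma block_interval y (c e : 'I_n) : singular A (p%:C, y) ->
  block A p x y = [set k : 'I_n | (c <= k <= e)%N] ->
  [/\ (c <= e)%N, block_start c = c, block_end c = e.+1, block_start e = c & block_end e = e.+1].
Proof.
move=> /block_nonempty[k yk] yE.
have ce : (c <= e)%N by move: yk; rewrite yE /= => /andP[]; exact: leq_trans.
have yc : block A p x y c by rewrite yE /= leqnn.
have ye : block A p x y e by rewrite yE /= leqnn ce.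
have hce := block_height yc ye.
have mem (j : 'I_n) : (block_start e <= j < block_end e)%N = (c <= j <= e)%N.
  rewrite block_position; apply/eqP/idP => [je|cje].
    have : block A p x y j by apply/blockE; rewrite je; apply/blockE.
    by rewrite yE.
  have yj : block A p x y j by rewrite yE.
  exact: block_height yj ye.
have fe : block_start e = c.
  apply/eqP; rewrite eqn_leq; apply/andP; split.
    by have := mem c; rewrite leqnn ce => /andP[].
  have fn : (block_start e < n)%N.
    by have /andP[fe _] := in_block e; exact: leq_ltn_trans fe (ltn_ord e).
  have := mem (Ordinal fn); rewrite /= leqnn /= => H.
  have : (block_start e < block_end e)%N by have /andP[] := in_block e; exact: leq_ltn_trans.
  by rewrite H => /andP[].
have pe : block_end e = e.+1.
  apply/eqP; rewrite eqn_leq; apply/andP; split; last by have /andP[] := in_block e.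
  rewrite leqNgt; apply/negP => ep.
  have en : (e.+1 < n)%N by exact: leq_trans ep (block_end_le e).
  have := mem (Ordinal en); rewrite /= ep andbT ltnn andbF.
  by have /andP[fe' _] := in_block e; rewrite leqW.
by split=> //; [rewrite -fe|rewrite -pe]; rewrite /block_start /block_end hce.
Qed.

Lemma monodromy_adjacent_blocks y y' (i i' c b : 'I_n) : i' = i.+1 :> nat ->
  singular A (p%:C, y) -> singular A (p%:C, y') ->
  block A p x y = [set k : 'I_n | (c <= k <= i)%N] ->
  block A p x y' = [set k : 'I_n | (i' <= k <= b)%N] ->
  mu (alpha_pair A a x i i') =
    alpha_pair A a x i i'
    + \sum_(k < n | (c <= k < i)%N)
        (1 - \prod_(j < n | (c <= j <= k)%N) s j) *: alpha_pair A a x k (ordS k)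
    + \sum_(k < n | (i' < k <= b)%N)
        ((\prod_(j < n | (i' <= j < k)%N) s j)
         * (1 - \prod_(j < n | (k <= j <= b)%N) s j))
        *: alpha_pair A a x (ord_pred k) k.
Proof.
move=> ii' ys ys' yE y'E.
have [ci _ _ fi pi] := block_interval ys yE.
have [ib fi' pi' _ _] := block_interval ys' y'E.
apply/rowP => j; rewrite monodromy_alpha !monodromy_coord fi pi fi' pi'.
rewrite (block_sum_last _ _ ci) (block_sum_first _ _ ib).
rewrite [RHS](_ : _ = alpha_pair A a x i i' 0 j +
  \sum_(c <= k < i) (1 - \prod_(c <= l < k.+1) sN l) * (unit_coord j k - unit_coord j k.+1) +
  \sum_(i'.+1 <= k < b.+1) ((\prod_(i' <= l < k) sN l) * (1 - \prod_(k <= l < b.+1) sN l)) *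
    (unit_coord j k.-1 - unit_coord j k)); last first.
  rewrite mxE [X in X + _ = _]mxE; congr (_ + _ + _); rewrite summxE.
    apply: big_ord_range => [|//|k /andP[ck ki]]; first exact: ltnW.
    rewrite mxE alpha_pair_coord; congr ((1 - _) * (_ - unit_coord j _)).
      by apply: big_ord_range => [|//|l _]; rewrite ?nat_extE.
    (* [ordS] is cyclic; k + 1 <= i < n excludes wrapping around. *)
    by rewrite /= modn_small // (leq_ltn_trans ki).
  apply: big_ord_range => [|//|k /andP[ik kb]]; first exact: ltn_ord.
  rewrite mxE alpha_pair_coord; congr (_ * (1 - _) * (unit_coord j _ - _)).
  - by apply: big_ord_range => [|//|l _]; rewrite ?nat_extE // ltnW.
  - by apply: big_ord_range => [|//|l _]; rewrite ?nat_extE.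
  (* [ord_pred] is cyclic too; k > i' makes k positive. *)
  rewrite /= -subn1 -addnBAC ?subn1; last by rewrite (leq_trans _ ik).
  by rewrite modnDr modn_small // (leq_ltn_trans (leq_pred _)).
rewrite alpha_pair_coord opprB.
move: (\sum_(c <= k < i) _) (\sum_(i'.+1 <= k < b.+1) _) => T1 T2.
ring.
Qed.

(** The column s_l - 1 is the map whose kernel is [H1]; that it is fixed makes [H1] stable. For this
    column the sum over the block telescopes to P - 1, where P is the product of the parameters of
    the block. *)
Lemma monodromy_mx_fix (k : 'I_n) : \sum_l B k l * (s l - 1) = s k - 1.
Proof.
rewrite B_value.
have -> : \sum_(block_start k <= j < block_end k) (\prod_(block_start k <= l < j) sN l) *
           nat_ext 0 (fun l => s l - 1) j =
   - (1 - \prod_(block_start k <= j < block_end k) sN j).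
  rewrite -prod_telescope ?block_start_end // -sumrN; apply: eq_big_nat => j /andP[_ jp].
  have jn := leq_trans jp (block_end_le k).
  have -> := nat_extE 0 (fun l => s l - 1) (Ordinal jn).
  by have -> := nat_extE 1 s (Ordinal jn); rewrite -mulrN opprB.
ring.
Qed.

(** Row l of a block reads (1 - s_l) D + P xi_l = 0, where D is the weighted sum of the xi_l.
    Summing the rows with the same weights gives (1 - P) D + P D = 0, so D = 0; then xi_l = 0
    because P is a product of nonzero parameters. *)
Lemma monodromy_mx_inj (xi : 'I_n -> R[i]) : (forall k, \sum_l B k l * xi l = 0) -> forall k, xi k = 0.
Proof.
move=> B0 k.
pose D := \sum_(block_start k <= j < block_end k) (\prod_(block_start k <= l < j) sN l) * nat_ext 0 xi j.
pose P := \prod_(block_start k <= j < block_end k) sN j.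
have H (l : 'I_n) : (block_start k <= l < block_end k)%N -> (1 - s l) * D + P * xi l = 0.
  rewrite block_position => /eqP e; rewrite -[RHS](B0 l) B_value.
  by rewrite /D /P /block_start /block_end e.
have D0 : D = 0.
  have : \sum_(block_start k <= j < block_end k) (\prod_(block_start k <= l < j) sN l) *
      ((1 - sN j) * D + P * nat_ext 0 xi j) = 0.
    rewrite big_nat big1 // => j jb.
    have jn : (j < n)%N by case/andP: jb => _ jp; exact: leq_trans jp (block_end_le k).
    have -> := nat_extE 0 xi (Ordinal jn); have -> := nat_extE 1 s (Ordinal jn).
    by rewrite H // mulr0.
  rewrite (eq_bigr (fun j => (\prod_(block_start k <= l < j) sN l) * (1 - sN j) * D +
      P * ((\prod_(block_start k <= l < j) sN l) * nat_ext 0 xi j))); last by move=> j _; ring.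
  rewrite big_split /= -big_distrl /= prod_telescope ?block_start_end // -big_distrr /= -/D -/P.
  by move=> <-; ring.
have /eqP := H k (in_block k); rewrite D0 mulr0 add0r mulf_eq0 => /orP[|/eqP //].
rewrite /P prodf_seq_eq0 => /hasP[j]; rewrite mem_index_iota => /andP[_ jp] /=.
have jn := leq_trans jp (block_end_le k).
by have -> := nat_extE 1 s (Ordinal jn); rewrite /parameter (negbTE (a_neq0 _)).
Qed.

Lemma monodromy_mx_unit : B \in unitmx.
Proof.
rewrite -unitmx_tr -row_free_unit -kermx_eq0; apply/eqP/matrixP => k l; rewrite [RHS]mxE.
apply: (monodromy_mx_inj (xi := fun l => kermx B^T k l)) => i.
have := congr1 (fun M : 'M[R[i]]_n => M k i) (mulmx_ker B^T); rewrite !mxE => E; rewrite -[RHS]E.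
by apply: eq_bigr => j _; rewrite !mxE mulrC.
Qed.

Lemma H1E v : H1 A a x v <-> v *m (\col_k (s k - 1)) = 0.
Proof.
have E : (v *m (\col_k (s k - 1))) 0 0 = \sum_(k < n) v 0 k * (s k - 1).
  by rewrite mxE; apply: eq_bigr => k _; rewrite mxE.
split=> [v0|v0]; last by rewrite /H1 /= -E v0 mxE.
by apply/matrixP => i j; rewrite !ord1 E mxE.
Qed.

(** The matrix and its inverse both fix the boundary column, hence both preserve its kernel. *)
Lemma monodromy_bij : set_bij (H1 A a x) (H1 A a x) mu.
Proof.
have Bs : B *m (\col_k (s k - 1)) = \col_k (s k - 1).
  apply/matrixP => k j; rewrite [LHS]mxE [RHS]mxE -monodromy_mx_fix.
  by apply: eq_bigr => l _; rewrite [X in _ * X]mxE.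
have muE : mu = fun v => v *m B by apply/funext => v; exact: monodromyE.
rewrite muE; split.
- move=> v Hv; apply: (H1E _).2; rewrite -mulmxA Bs; exact: (H1E v).1.
- by move=> v w _ _ /(congr1 (mulmx^~ (invmx B))); rewrite !mulmxK ?monodromy_mx_unit.
- move=> v Hv; exists (v *m invmx B); last by rewrite mulmxKV ?monodromy_mx_unit.
  apply: (H1E _).2; rewrite -Bs -mulmxA mulKmx ?monodromy_mx_unit //; exact: (H1E v).1.
Qed.

End Conclusion.

Theorem theorem2p4 (R : realType) (n m : nat) (A : arrangement R n m)
    (a : 'I_n + 'I_m -> R[i]) (p x x' : R) (gamma gamma' : R -> R[i])
    (y0 : R[i]) :
  fibered A ->
  (forall l, a l != 0) ->
  (forall i, a (inl i) != 1) ->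
  singular_abscissae A p%:C ->
  close_to A p x ->
  x' = 2 * p - x ->
  half_plane_path A x x' gamma ->
  half_plane_path A x' x gamma' ->
  high_above A gamma y0 ->
  high_above A gamma' y0 ->
  let mu := monodromy A a x x' gamma gamma' y0 in
  let s := parameter A a x in
  let alpha := alpha_pair A a x in
  let Delta := block A p x in
  set_bij (H1 A a x) (H1 A a x) mu /\
  forall i i' : 'I_n, i' = i.+1 :> nat ->
    (forall y, singular A (p%:C, y) -> Delta y i -> Delta y i' ->
       mu (alpha i i') = (\prod_(j < n | j \in Delta y) s j) *: alpha i i') /\
    (forall y y' (c b : 'I_n),
       singular A (p%:C, y) -> singular A (p%:C, y') ->
       Delta y = [set k : 'I_n | (c <= k <= i)%N] ->
       Delta y' = [set k : 'I_n | (i' <= k <= b)%N] ->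
       mu (alpha i i') =
         alpha i i'
         + \sum_(k < n | (c <= k < i)%N)
             (1 - \prod_(j < n | (c <= j <= k)%N) s j) *: alpha k (ordS k)
         + \sum_(k < n | (i' < k <= b)%N)
             ((\prod_(j < n | (i' <= j < k)%N) s j)
              * (1 - \prod_(j < n | (k <= j <= b)%N) s j))
             *: alpha (ord_pred k) k).
Proof.
move=> _ a0 a1 _ xc x'E gP gP' gY gY' mu s alpha Delta.
have xp : x - p != 0 by rewrite subr_eq0; case: xc.
(* Also the sign of x - x' = 2 (x - p), hence of the half plane swept by the outward path. *)
pose sg := Num.sg (x - p).
have sg2 : sg * sg = 1 by rewrite -expr2 sqr_sg xp.
have sgx : 0 < sg * (x - p) by rewrite /sg -normrEsg normr_gt0.

split; first exact: (monodromy_bij a0 sg2 sgx x'E xc gP gP' gY gY').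
move=> i i' ii'; split=> [y _|y y' c b].
  exact: (monodromy_same_block a0 a1 sg2 sgx x'E xc gP gP' gY gY').
exact: (monodromy_adjacent_blocks a0 a1 sg2 sgx x'E xc gP gP' gY gY' ii').
Qed.
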